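(* Let $n\ge1$ and $\mu>0$. The normalized reproducing kernel $\widetilde{\mathbf B}^{(\mu)}_{\mathbb G_n}$ for $\mathbb A^{(\mu)}(\mathbb G_n)$ is given by $$\widetilde{\mathbf B}^{(\mu)}_{\mathbb G_n}(\boldsymbol s,\boldsymbol t)=\frac{\boldsymbol\delta!}{(\mu)_{\boldsymbol\delta}}\sum_{\boldsymbol p\in[n]}\gamma_{\boldsymbol p}^2\,\det\Big(\big(s_{p_i'+j-i}\big)_{i,j=1}^r\Big)\,\overline{\det\Big(\big(t_{p_i'+j-i}\big)_{i,j=1}^r\Big)}$$ for all $\boldsymbol s=(s_1,\dots,s_n)$, $\boldsymbol t=(t_1,\dots,t_n)\in\mathbb G_n$, where for each $\boldsymbol p\in[n]$, $\boldsymbol p'=(p_1',\dots,p_r')$ is the conjugate partition to $\boldsymbol p$.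
   Context: $[n]=\{\boldsymbol m\in\mathbb Z_+^n: m_1\ge m_2\ge\dots\ge m_n\}$ (non-negative integers), $\boldsymbol\delta=(n-1,n-2,\dots,1,0)$. For $\boldsymbol m\in\mathbb Z_+^n$, $\boldsymbol m!=\prod_j m_j!$ and $(\mu)_{\boldsymbol m}=\prod_j(\mu)_{m_j}$ with $(\mu)_{k}=\mu(\mu+1)\cdots(\mu+k-1)$. $\gamma_{\boldsymbol p}=\sqrt{(\mu)_{\boldsymbol p+\boldsymbol\delta}/(\boldsymbol p+\boldsymbol\delta)!}$. The conjugate partition $\boldsymbol p'=(p_1',\dots,p_r')$ of $\boldsymbol p$ is obtained by transposing the Young diagram, with $p_r'>0$ (so $r=p_1$). In the determinants the conventions are $s_0=t_0=1$, $s_k=t_k=0$ for $k>n$ or $k<0$, and the empty determinant ($\boldsymbol p=\boldsymbol 0$) is $1$. $\mathbb D^n$ is the open unit polydisc, $\boldsymbol s:\mathbb C^n\to\mathbb C^n$ is also used for the symmetrization map whose components are the elementary symmetric polynomials, $\mathbb G_n=\boldsymbol s(\mathbb D^n)$ is the symmetrized polydisc, $\Delta(\boldsymbol z)=\prod_{i<j}(z_i-z_j)$. For $\boldsymbol p\in[n]$ the Schur polynomial is $S_{\boldsymbol p}(\boldsymbol z)=\det\big((z_i^{p_j+n-j})_{i,j=1}^n\big)/\Delta(\boldsymbol z)$, a symmetric polynomial, hence it may be regarded as a function on $\mathbb G_n$. For $\mu>1$, $\mathbb A^{(\mu)}(\mathbb G_n)$ is the weighted Bergman space of holomorphic functions $f$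 on $\mathbb G_n$ with $\|f\|^2=\frac1{n!}\int_{\mathbb D^n}|f\circ\boldsymbol s|^2|\Delta|^2dV^{(\mu)}<\infty$, where $dV^{(\mu)}=\big(\frac{\mu-1}{\pi}\big)^n\prod_{i=1}^n(1-r_i^2)^{\mu-2}r_i\,dr_i\,d\theta_i$ ($z_i=r_ie^{i\theta_i}$). Its reproducing kernel is denoted $\mathbf B^{(\mu)}_{\mathbb G_n}$. For $0<\mu\le1$, $\mathbb A^{(\mu)}(\mathbb G_n)$ is the Hilbert space of holomorphic functions on $\mathbb G_n$ whose reproducing kernel is the positive definite kernel $\mathbf B^{(\mu)}_{\mathbb G_n}(\boldsymbol s(\boldsymbol z),\boldsymbol s(\boldsymbol w))=\sum_{\boldsymbol p\in[n]}\gamma_{\boldsymbol p}^2S_{\boldsymbol p}(\boldsymbol z)\overline{S_{\boldsymbol p}(\boldsymbol w)}$. The normalized reproducing kernel is $\widetilde{\mathbf B}^{(\mu)}_{\mathbb G_n}=\mathbf B^{(\mu)}_{\mathbb G_n}/\mathbf B^{(\mu)}_{\mathbb G_n}(\boldsymbol 0,\boldsymbol 0)$, which is identically $1$ when the second argument is $\boldsymbol 0$. *)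

(* Defs.v *)
From HB Require Import structures.
From mathcomp Require Import all_boot all_order all_algebra finmap complex.
From mathcomp Require mpoly.
(* The notations of mpoly clash with those of MathComp-Analysis. *)
Import -(notations) mpoly.
From mathcomp Require Import all_classical all_reals all_analysis.
From mathcomp Require Import summability.
Set Implicit Arguments.
Unset Strict Implicit.
Unset Printing Implicit Defensive.
Import Order.TTheory GRing.Theory Num.Theory.
Import numFieldNormedType.Exports.
Local Open Scope classical_set_scope.
Local Open Scope ring_scope.
Local Open Scope complex_scope.

(* R[i] as a one-dimensional normed space over itself: [differentiable] on
   'rV[R[i]]_n is then complex Frechet differentiability. *)
HB.instance Definition _ (R : realType) := GRing.ComAlgebra.copy R[i] (R[i])^o.
HB.instance Definition _ (R : realType) := Vector.copy R[i] (R[i])^o.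
HB.instance Definition _ (R : realType) := NormedModule.copy R[i] (R[i])^o.

Section product_measure.
Context d1 d2 (T1 : measurableType d1) (T2 : measurableType d2) (R : realType).
Variables (m1 : {sigma_finite_measure set T1 -> \bar R})
          (m2 : {sigma_finite_measure set T2 -> \bar R}).

Definition sf_product_def : set (T1 * T2) -> \bar R := (m1 \x m2)%E.

HB.instance Definition _ := Measure.on sf_product_def.

Lemma sf_product_sigma_finite : sigma_finite setT sf_product_def.
Proof.
have /sigma_finiteP[F [TF ndF Foo]] := sigma_finiteT m1.
have /sigma_finiteP[G [TG ndG Goo]] := sigma_finiteT m2.
exists (fun n => F n `*` G n).
  rewrite -setXTT TF TG predeqE => -[x y]; split.
    move=> [/= [n _ Fnx] [k _ Gky]]; exists (maxn n k) => //; split.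
    - by move: x Fnx; exact/subsetPset/ndF/leq_maxl.
    - by move: y Gky; exact/subsetPset/ndG/leq_maxr.
  by move=> [n _ []/= ? ?]; split; exists n.
move=> k; have [? ?] := Foo k; have [? ?] := Goo k.
split; first exact: measurableX.
by rewrite /sf_product_def product_measure1E// lte_mul_pinfty// ge0_fin_numE.
Qed.

HB.instance Definition _ := Measure_isSigmaFinite.Build _ _ _ sf_product_def
  sf_product_sigma_finite.

Definition sf_product : {sigma_finite_measure set (T1 * T2)%type -> \bar R} :=
  sf_product_def.

End product_measure.

(* Sigma-finite measure spaces, packed so that n-fold products can be formed by
   recursion on n. *)
Record sfspace (R : realType) := SfSpace {
  sf_display : measure_display;
  sf_sort : measurableType sf_display;
  sf_measure : {sigma_finite_measure set sf_sort -> \bar R} }.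

Section measure_spaces.
Variable R : realType.

Definition sf_unit : sfspace R := @SfSpace R _ unit (\d_ tt).

Definition sf_prod (S T : sfspace R) : sfspace R :=
  SfSpace (sf_product (sf_measure S) (sf_measure T)).

Fixpoint sf_pow (S : sfspace R) (n : nat) : sfspace R :=
  if n is n'.+1 then sf_prod S (sf_pow S n') else sf_unit.

Fixpoint sf_tuple (S : sfspace R) (n : nat) :
    sf_sort (sf_pow S n) -> n.-tuple (sf_sort S) :=
  if n is n'.+1 then fun x => [tuple of x.1 :: sf_tuple x.2]
  else fun=> [tuple].

Definition sf_line : sfspace R := SfSpace (@lebesgue_measure R).

(* pairs (r, theta) with the measure dr dtheta *)
Definition sf_polar : sfspace R := sf_prod sf_line sf_line.

End measure_spaces.

Section combinatorics.
Variables (R : realType) (n : nat).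

Definition delta (j : 'I_n) : nat := (n - j.+1)%N.

Definition pochhammer (mu : R) (k : nat) : R := \prod_(0 <= j < k) (mu + j%:R).

Definition mpochhammer (mu : R) (m : 'I_n -> nat) : R :=
  \prod_j pochhammer mu (m j).

Definition mfact (m : 'I_n -> nat) : nat := (\prod_j (m j)`!)%N.

(* the index set [n] *)
Definition npart := {p : n.-tuple nat | sorted geq p}.

Definition part (p : npart) (j : 'I_n) : nat := tnth (val p) j.

(* the first (largest) part, 0 if n = 0 *)
Definition part1 (p : npart) : nat := head 0%N (val p).

Definition gamma (mu : R) (p : npart) : R :=
  Num.sqrt (mpochhammer mu (fun j => part p j + delta j)%N /
            (mfact (fun j => part p j + delta j)%N)%:R).

(* p'_(i+1): the number of cells in column i (counted from 0) of the Young
   diagram of p; it is positive exactly for i < part1 p *)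
Definition conj_part (p : npart) (i : nat) : nat :=
  #|[set j : 'I_n | (i < part p j)%N]|.

(* s_k, with s_0 = 1 and s_k = 0 for k < 0 or k > n; the coordinate s_k,
   1 <= k <= n, of the vector s is its entry of index k - 1 *)
Definition ecoord (s : 'rV[R[i]]_n) (k : int) : R[i] :=
  match k with
  | Posz 0 => 1
  | Posz k'.+1 => if insub k' is Some i then s 0 i else 0
  | Negz _ => 0
  end.

Definition conj_det (p : npart) (s : 'rV[R[i]]_n) : R[i] :=
  \det (\matrix_(i < part1 p, j < part1 p)
          ecoord s ((conj_part p i)%:Z + j%:Z - i%:Z)).

Definition mvar (i : 'I_n) : mpoly n R[i] := mpolyX _ (mnm1 i).

Definition vandermonde : mpoly n R[i] :=
  \prod_(i < n) \prod_(j < n | (i < j)%N) (mvar i - mvar j).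

(* The quotient det (z_i ^ (p_j + n - j)) / Delta, i.e. the unique polynomial
   whose product with Delta is the determinant. *)
Definition schur (p : npart) : mpoly n R[i] :=
  xget 0 [set P | P * vandermonde =
    \det (\matrix_(i < n, j < n) (mvar i ^+ (part p j + delta j)%N))].

Definition peval (P : mpoly n R[i]) (z : 'rV[R[i]]_n) : R[i] :=
  meval (fun i => z 0 i) P.

Definition polydisc : set 'rV[R[i]]_n := [set z | forall i, `|z 0 i| < 1].

Definition symmetrization (z : 'rV[R[i]]_n) : 'rV[R[i]]_n :=
  \row_(k < n) peval (mesym n R[i] k.+1) z.

Definition sym_polydisc : set 'rV[R[i]]_n := symmetrization @` polydisc.

End combinatorics.

Section function_spaces.
Variables (R : realType) (n : nat).
Implicit Types (f g h : 'rV[R[i]]_n -> R[i]) (G : set 'rV[R[i]]_n).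

(* A function on G is represented by any of its extensions to C^n; only its
   values on G matter. *)
Record fun_space := FunSpace {
  fs_mem : set ('rV[R[i]]_n -> R[i]);
  fs_dot : ('rV[R[i]]_n -> R[i]) -> ('rV[R[i]]_n -> R[i]) -> R[i] }.

Definition holomorphic_on G f := forall u, G u -> differentiable f u.

Definition fs_sqdist (H : fun_space) f g : R[i] :=
  fs_dot H (fun u => f u - g u) (fun u => f u - g u).

Record hilbert_on G (H : fun_space) : Prop := HilbertOn {
  hilbert_ext : forall f g, fs_mem H f -> (forall u, G u -> f u = g u) ->
    fs_mem H g;
  hilbert_mem0 : fs_mem H (fun=> 0);
  hilbert_memD : forall (a : R[i]) f g, fs_mem H f -> fs_mem H g ->
    fs_mem H (fun u => a * f u + g u);
  hilbert_dotD : forall (a : R[i]) f g h,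
    fs_mem H f -> fs_mem H g -> fs_mem H h ->
    fs_dot H (fun u => a * f u + g u) h = a * fs_dot H f h + fs_dot H g h;
  hilbert_dotC : forall f g, fs_mem H f -> fs_mem H g ->
    fs_dot H g f = Num.conj (fs_dot H f g);
  hilbert_ge0 : forall f, fs_mem H f -> 0 <= fs_dot H f f;
  hilbert_eq0 : forall f, fs_mem H f ->
    (fs_dot H f f = 0 <-> forall u, G u -> f u = 0);
  hilbert_complete : forall f_ : nat -> 'rV[R[i]]_n -> R[i],
    (forall k, fs_mem H (f_ k)) ->
    (forall e : R[i], 0 < e -> exists N, forall k l, (N <= k)%N -> (N <= l)%N ->
       fs_sqdist H (f_ k) (f_ l) < e) ->
    exists2 f, fs_mem H f & forall e : R[i], 0 < e ->
      exists N, forall k, (N <= k)%N -> fs_sqdist H (f_ k) f < e }.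

Definition reproducing_kernel G (H : fun_space)
    (B : 'rV[R[i]]_n -> 'rV[R[i]]_n -> R[i]) :=
  (forall w, G w -> fs_mem H (fun u => B u w)) /\
  (forall f w, fs_mem H f -> G w -> f w = fs_dot H f (fun u => B u w)).

Definition normalized_kernel (B : 'rV[R[i]]_n -> 'rV[R[i]]_n -> R[i])
    (s t : 'rV[R[i]]_n) : R[i] := B s t / B 0 0.

End function_spaces.

Section bergman.
Variables (R : realType) (n : nat) (mu : R).
Implicit Types f g : 'rV[R[i]]_n -> R[i].

Local Notation X := (sf_sort (sf_pow (sf_polar R) n)).

Definition radius (x : X) (i : 'I_n) : R := (tnth (sf_tuple x) i).1.
Definition angle (x : X) (i : 'I_n) : R := (tnth (sf_tuple x) i).2.

(* polar coordinates on the polydisc *)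
Definition polar_box : set X :=
  [set x | forall i, 0 <= radius x i < 1 /\ 0 <= angle x i < 2 * pi].

Definition polar_point (x : X) : 'rV[R[i]]_n :=
  \row_i ((radius x i * cos (angle x i)) +i* (radius x i * sin (angle x i))).

(* density of dV^(mu) with respect to prod_i dr_i dtheta_i *)
Definition polar_density (x : X) : R :=
  ((mu - 1) / pi) ^+ n *
  \prod_i ((1 - radius x i ^+ 2) `^ (mu - 2) * radius x i).

(* integrals over the polydisc against dV^(mu) *)
Definition dV_integral_ge0 (F : 'rV[R[i]]_n -> R) : \bar R :=
  (\int[sf_measure (sf_pow (sf_polar R) n)]_(x in polar_box)
     (F (polar_point x) * polar_density x)%:E)%E.

Definition dV_Rintegral (F : 'rV[R[i]]_n -> R) : R :=
  \int[sf_measure (sf_pow (sf_polar R) n)]_(x in polar_box)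
     (F (polar_point x) * polar_density x).

Definition dV_integral (F : 'rV[R[i]]_n -> R[i]) : R[i] :=
  dV_Rintegral (fun z => complex.Re (F z)) +i*
  dV_Rintegral (fun z => complex.Im (F z)).

Definition bergman_sqnorm f : \bar R :=
  ((n`!%:R^-1)%:E *
   dV_integral_ge0 (fun z => complex.Re
     (`|f (symmetrization z)| ^+ 2 * `|peval (vandermonde R n) z| ^+ 2)%R))%E.

Definition bergman_dot f g : R[i] :=
  n`!%:R^-1 * dV_integral (fun z =>
     f (symmetrization z) * Num.conj (g (symmetrization z)) *
     `|peval (vandermonde R n) z| ^+ 2).

Definition bergman_space : fun_space R n :=
  FunSpace [set f | holomorphic_on (@sym_polydisc R n) f /\
                    (bergman_sqnorm f < +oo)%E]
           bergman_dot.

(* B(s(z), s(w)) = sum_p gamma_p^2 S_p(z) conj(S_p(w)), as an unconditionally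
   convergent sum over [n] *)
Definition schur_kernel (B : 'rV[R[i]]_n -> 'rV[R[i]]_n -> R[i]) :=
  forall z w, @polydisc R n z -> @polydisc R n w ->
  partial_sum (fun p : npart n => (gamma mu p ^+ 2)%:C *
      peval (schur R p) z * Num.conj (peval (schur R p) w)) @ totally
    --> B (symmetrization z) (symmetrization w).

(* H is the space A^(mu)(G_n): the weighted Bergman space if mu > 1, and the
   Hilbert space of holomorphic functions with reproducing kernel
   [schur_kernel] if mu <= 1. *)
Definition is_weighted_space (H : fun_space R n) : Prop :=
  (1 < mu -> H = bergman_space) /\
  (mu <= 1 ->
    [/\ hilbert_on (@sym_polydisc R n) H,
        forall f, fs_mem H f -> holomorphic_on (@sym_polydisc R n) f &
        exists2 B, schur_kernel B &
          reproducing_kernel (@sym_polydisc R n) H B]).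

End bergman.

(* Main.v *)
Require Import Defs.
From HB Require Import structures.
From mathcomp Require Import all_boot all_order all_algebra finmap complex.
From mathcomp Require mpoly.
Import -(notations) mpoly.
From mathcomp Require Import all_classical all_reals all_analysis.
From mathcomp Require Import measurable_realfun summability.
From mathcomp Require Import fingroup perm zify ring lra.
Set Implicit Arguments.
Unset Strict Implicit.
Unset Printing Implicit Defensive.
Import Order.TTheory GRing.Theory Num.Theory.
Import numFieldNormedType.Exports.
Local Open Scope classical_set_scope.
Local Open Scope ring_scope.
Local Open Scope complex_scope.
Import ComplexField.Normc.

(* Up to sign, det (z_i ^ (p_j + n - j)) factors as Delta(z) times the determinant e_p built from the
   conjugate partition (dual Jacobi-Trudi), so the Schur kernel is the sum of gamma_p^2 e_p(s) conj(e_p(t)).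
   For mu <= 1 the formula then follows from uniqueness of reproducing kernels.  For mu > 1 the Bergman
   space is not known a priori to be complete, nor the polynomials to be dense in it; dilations replace
   both facts.  For f in the space and 0 < rho < 1, the dilate f^rho is a uniform limit of combinations of
   the e_p (Runge on the polydisc, then antisymmetrization of f(s(z)) Delta(z)), hence it is the sum of its
   orthogonal expansion, in norm and therefore pointwise.  Homogeneity gives
   <f^rho, e_p> = rho^|p| <f, e_p>, which for f = B(., t) equals rho^|p| conj(e_p(t)); every point of G_n is
   the dilate of another one, so the expansion of B(., t) holds everywhere without letting rho tend to 1. *)

(** Signs are not tracked: each [e_p] is met together with its own conjugate, so it is enough that
    the sign relating it to S_p depends on p alone; hence [b] stands before the points in the
    evaluated identities. Delta vanishes on the diagonals and is therefore never divided out of an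
    estimate: approximations and norms concern f(s(z)) Delta(z) as a whole. For mu > 1 the obstacle
    is that a function of the space may be unbounded near the boundary, where uniform approximation
    then controls no norm. A dilate is bounded on the closed polydisc, and the inner products of f
    itself are reached as limits of those over smaller polydiscs, where orthogonality persists
    because the weight is invariant under rotation of each coordinate. Convergence along all finite
    sets of partitions comes from best approximation: once a finite set contains the indices of one
    good combination, its Fourier sum is at least as good. Besides giving the coefficients, the
    kernel supplies the bound on point evaluations. *)

(* With V the Vandermonde-type matrix of powers and W the coefficients of the multiples X^b q, W V = 0.
   Completing V by the unit columns g and W by the first n unit rows, the unitriangular matrix Q turns a
   permuted block matrix into a block triangular one; comparing determinants relates the two minors. *)
Lemma complementary_minors (K : comNzRingType) (n r : nat) (q : {poly K})
    (y : 'I_n -> K) (f : 'I_n -> nat) (g : 'I_r -> nat) :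
  q \is monic -> size q = n.+1 -> (forall i, q.[y i] = 0) ->
  injective f -> injective g -> (forall i j, f i != g j) ->
  (forall i, (f i < n + r)%N) -> (forall j, (g j < n + r)%N) ->
  exists b : bool,
    \det (\matrix_(i < n, j < n) y i ^+ f j) =
    (-1) ^+ b * \det (\matrix_(i < n, j < n) y i ^+ j) *
    \det (\matrix_(i < r, j < r) ('X^j * q)`_(g i)).
Proof.
move=> qmon qsz qy finj ginj fg fn gn.
have splitl i : fintype.split (lshift r i) = inl i := unsplitK (inl i).
have splitr j : fintype.split (rshift n j) = inr j := unsplitK (inr j).
(* [h] lists the values of f, then those of g; being an injective self-map of a finite type it is a
   permutation, and its parity is the [b] sought. *)
pose h (a : 'I_(n + r)) : 'I_(n + r) :=
  match fintype.split a with inl i => Ordinal (fn i) | inr j => Ordinal (gn j) end.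
have hl i : h (lshift r i) = Ordinal (fn i).
  by rewrite /h splitl.
have hr i : h (rshift n i) = Ordinal (gn i).
  by rewrite /h splitr.
have hinj : injective h.
  move=> a b; rewrite -(splitK a) -(splitK b).
  case: (fintype.split a) => i; case: (fintype.split b) => j /=; rewrite ?hl ?hr => /(congr1 val) /=.
  - by move/finj ->.
  - by move/eqP; rewrite (negbTE (fg _ _)).
  - by move/esym/eqP; rewrite (negbTE (fg _ _)).
  - by move/ginj ->.
pose s := perm hinj.
pose V : 'M[K]_(n + r, n) := \matrix_(a, i) y i ^+ a.
pose S : 'M[K]_(n + r, r) := \matrix_(a, j) (val a == g j)%:R.
pose W : 'M[K]_(r, n + r) := \matrix_(b, a) ('X^b * q)`_a.
pose Q := col_mx (row_mx 1%:M 0) W.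
have WV : W *m V = 0.
  apply/matrixP => b i; rewrite [RHS]mxE.
  have sz : (size ('X^b * q)%R <= n + r)%N.
    by rewrite (size_monicM (monicXn _ _)) -?size_poly_gt0 ?qsz// size_polyXn;
      have := ltn_ord b; lia.
  transitivity ('X^b * q).[y i]; last first.
    by rewrite hornerM_comm ?qy ?mulr0//; exact: mulrC.
  by rewrite (horner_coef_wide _ sz) mxE; apply: eq_bigr => a _; rewrite !mxE.
(* ['X^b * q] is monic of degree n + b, so the last r columns of W form a unitriangular block. *)
have detQ : \det Q = 1.
  rewrite /Q -[W]hsubmxK -/(block_mx _ _ _ _) det_lblock det1 mul1r det_trig.
    apply: big1 => i _; rewrite !mxE /= coefXnM ltnNge leq_addl /= addnK.
    by have := monicP qmon; rewrite lead_coefE qsz.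
  apply/is_trig_mxP => i j ij; rewrite !mxE coefXnM /=.
  case: ifP => // _; apply: nth_default; rewrite qsz.
  by rewrite -ltnS; lia.
have QU : Q *m row_mx V S = block_mx (row_mx 1%:M 0 *m V) (row_mx 1%:M 0 *m S)
   0 (W *m S).
  by rewrite mul_col_row WV.
have detU : \det (row_perm s (row_mx V S)) = \det (\matrix_(i < n, j < n) y i ^+ f j).
  rewrite -[row_perm s _]submxK.
  have -> : ursubmx (row_perm s (row_mx V S)) = 0.
    apply/matrixP => i j; rewrite !mxE permE hl splitr !mxE /=.
    by rewrite (negbTE (fg _ _)).
  have -> : drsubmx (row_perm s (row_mx V S)) = 1%:M.
    apply/matrixP => i j; rewrite !mxE permE hr splitr !mxE /=.
    by rewrite (inj_eq ginj).
  rewrite det_lblock det1 mulr1 -det_tr; congr (\det _).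
  by apply/matrixP => i j; rewrite !mxE permE hl splitl !mxE.
have := congr1 determinant QU.
rewrite det_mulmx detQ mul1r det_ublock => eU.
exists (s : bool); rewrite -detU row_permE det_mulmx det_perm eU mulrA; congr (_ * _ * _).
  rewrite -det_tr; congr (\det _); apply/matrixP => i j; rewrite !mxE.
  rewrite big_split_ord /= [X in _ + X]big1 ?addr0; last first.
    by move=> a _; rewrite !mxE splitr !mxE mul0r.
  rewrite (bigD1 j)//= !mxE splitl !mxE eqxx mul1r big1 ?addr0// => a aj.
  by rewrite !mxE splitl !mxE eq_sym (negbTE aj) mul0r.
rewrite -det_tr; congr (\det _); apply/matrixP => i j; rewrite !mxE.
rewrite (bigD1 (Ordinal (gn i)))//= !mxE eqxx mulr1 big1 ?addr0// => a ai.
by rewrite !mxE; case: eqP => [e|]; rewrite ?mulr0//; case/eqP: ai; apply: val_inj.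
Qed.

(** Vieta's formulas, free of signs because the roots are the - x_i; in the expansion, J is the set
    of factors that contribute their constant term. *)
Lemma coef_prod_XD (K : comNzRingType) (n : nat) (x : 'I_n -> K) (k : nat) :
  (k <= n)%N ->
  (\prod_(i < n) ('X + (x i)%:P))`_(n - k) =
  \sum_(h : {set 'I_n} | #|h| == k) \prod_(i in h) x i.
Proof.
move=> kn.
rewrite (eq_bigr (fun i => (x i)%:P + 'X)); last by move=> i _; rewrite addrC.
rewrite bigA_distr /= coef_sum [RHS]big_mkcond /=; apply: eq_bigr => J _.
rewrite (bigID (mem J)) /=.
rewrite (eq_bigr (fun i => (x i)%:P)); last by move=> i ->.
rewrite [X in _ * X](eq_bigr (fun _ => 'X)); last by move=> i /negbTE ->.
rewrite prodr_const -rmorph_prod /= mulrC coefMC coefXn.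
have Jn : (#|J| <= n)%N by rewrite -[X in (_ <= X)%N](card_ord n) max_card.
have -> : #|[pred i | i \notin J]| = (n - #|J|)%N.
  apply: (@addnI #|J|); rewrite subnKC//.
  exact: etrans (cardC (mem J)) (card_ord n).
have -> : ((n - k)%N == (n - #|J|)%N) = (#|J| == k) by lia.
by case: eqP => _; rewrite ?mul1r ?mul0r.
Qed.

Lemma det_scale_col (K : comNzRingType) (n : nat) (A : 'I_n -> 'I_n -> K)
    (d : 'I_n -> K) :
  \det (\matrix_(i < n, j < n) (A i j * d j)) =
  \det (\matrix_(i < n, j < n) A i j) * \prod_j d j.
Proof.
have -> : \prod_j d j = \det (diag_mx (\row_j d j)).
  by rewrite det_diag; apply: eq_bigr => j _; rewrite mxE.
rewrite -det_mulmx; congr (\det _); apply/matrixP => i j; rewrite !mxE.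
rewrite (bigD1 j)//= !mxE eqxx mulr1n big1 ?addr0// => k kj.
by rewrite !mxE (negbTE kj) mulr0n mulr0.
Qed.

Lemma prod_signr (K : comNzRingType) (I : finType) (f : I -> nat) :
  exists b : bool, \prod_i (-1) ^+ f i = (-1) ^+ b :> K.
Proof.
by exists (odd (\sum_i f i)%N); rewrite signr_odd -expr_sum.
Qed.

(** * Jacobi-Trudi *)

Section partitions.
Variable n : nat.
Implicit Type p : npart n.

Lemma part_nonincreasing p (i j : 'I_n) : (i <= j)%N -> (part p j <= part p i)%N.
Proof.
move=> ij; rewrite /part !(tnth_nth 0%N).
have := @sorted_leq_nth _ geq (fun a b c ab bc => leq_trans bc ab) leqnn 0%N
  (val p) (valP p) i j; rewrite !inE size_tuple; exact.
Qed.

Lemma part_le_part1 p (i : 'I_n) : (part p i <= part1 p)%N.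
Proof.
have n0 : (0 < n)%N by apply: leq_ltn_trans (ltn_ord i).
have := @part_nonincreasing p (Ordinal n0) i (leq0n _).
by rewrite [X in (_ <= X)%N -> _]/part (tnth_nth 0%N) /part1 -nth0.
Qed.

Lemma card_ord_lt (m : nat) : (m <= n)%N -> #|[pred k : 'I_n | (k < m)%N]| = m.
Proof.
move=> mn; rewrite -sum1_card -(big_ord_widen _ (fun _ => 1%N)) //=.
by rewrite sum1_card card_ord.
Qed.

Lemma conj_partE p i : conj_part p i = #|[pred j : 'I_n | (i < part p j)%N]|.
Proof. by apply: eq_card => j; apply/idP/idP => [/set_mem|] //= h; exact: mem_set. Qed.

(** The parts decrease, so the rows meeting column i form an initial segment of ['I_n], and an
    initial segment contains j exactly when its length exceeds j. *)
Lemma conj_partP p (i : nat) (j : 'I_n) :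
  (j < conj_part p i)%N = (i < part p j)%N.
Proof.
rewrite conj_partE; case: (ltnP i (part p j)) => ij.
  rewrite -{1}(card_ord_lt (ltn_ord j)).
  apply: subset_leq_card; apply/fintype.subsetP => k; rewrite !inE ltnS => kj.
  exact: leq_trans ij (part_nonincreasing _ kj).
apply/negbTE; rewrite -leqNgt -[X in (_ <= X)%N](card_ord_lt (ltnW (ltn_ord j))).
apply: subset_leq_card; apply/fintype.subsetP => k; rewrite !inE ltnNge => ik.
rewrite ltnNge; apply: contra ik => jk.
exact: leq_trans (part_nonincreasing _ jk) ij.
Qed.

Lemma conj_part_le p i : (conj_part p i <= n)%N.
Proof. by rewrite conj_partE -[X in (_ <= X)%N](card_ord n) max_card. Qed.

Lemma conj_part_nonincreasing p i j :
  (i <= j)%N -> (conj_part p j <= conj_part p i)%N.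
Proof.
rewrite !conj_partE => ij; apply: subset_leq_card; apply/fintype.subsetP => k; rewrite !inE.
exact: leq_ltn_trans.
Qed.

(** Adding [delta] makes the weakly decreasing parts strictly decreasing, so an alternant has
    distinct exponents. *)
Lemma part_delta_lt p (i j : 'I_n) :
  (i < j)%N -> (part p j + delta j < part p i + delta i)%N.
Proof.
move=> ij; have := part_nonincreasing p (ltnW ij); rewrite /delta.
by have := ltn_ord j; lia.
Qed.

Lemma part_delta_inj p : injective (fun j => part p j + delta j)%N.
Proof.
move=> i j /= e; have [ij|ij|/ord_inj//] := ltngtP i j;
  by have := part_delta_lt p ij; rewrite e ltnn.
Qed.

(** Repeated exponents give two equal columns. Distinct ones are sorted by a column permutation, and
    removing [delta] from a strictly decreasing sequence leaves a partition. This is what turns an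
    antisymmetrized monomial into a multiple of some alternant of the theory. *)
Lemma det_sort_exponents (K : comNzRingType) (x : 'I_n -> K) (m : 'I_n -> nat) :
  \det (\matrix_(i < n, j < n) x i ^+ m j) = 0 \/
  exists (b : bool) p, \det (\matrix_(i < n, j < n) x i ^+ m j) =
    (-1) ^+ b * \det (\matrix_(i < n, j < n) x i ^+ (part p j + delta j)).
Proof.
case: (pselect (injective m)) => [minj|]; last first.
  move=> /injectiveP; rewrite /injectiveb => /dinjectivePn[i _ [j /andP[ji _] mij]].
  left; rewrite -det_tr; apply: (determinant_alternate (i1 := i) (i2 := j)).
    by rewrite eq_sym.
  by move=> k; rewrite !mxE mij.
right.
pose t := [tuple of sort geq [tuple m j | j < n]].
have geqT : total geq by move=> a b; exact: leq_total.
have geqtr : transitive geq by move=> a b c ab bc; exact: leq_trans bc ab.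
have tsort : sorted geq t by exact: sort_sorted.
have tuniq : uniq t.
  by rewrite sort_uniq map_inj_uniq ?enum_uniq.
have /tuple_permP[s ts] : perm_eq t [tuple m j | j < n] by rewrite perm_sort.
have tE j : tnth t j = m (s j).
  rewrite (tnth_nth 0%N) ts -tnth_nth.
  by rewrite !tnth_mktuple.
have tlt (i j : 'I_n) : (i < j)%N -> (m (s j) < m (s i))%N.
  move=> ij; rewrite ltn_neqAle; apply/andP; split.
    by rewrite (inj_eq minj) (inj_eq perm_inj) -val_eqE gtn_eqF.
  rewrite -!tE !(tnth_nth 0%N).
  have := @sorted_leq_nth _ geq geqtr leqnn 0%N t tsort i j.
  by rewrite !inE size_tuple; apply => //; exact: ltnW.
(* Induction on the distance k from j to the last index: a strictly decreasing sequence of naturals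
   dominates [delta]. *)
have dle (k : nat) (j : 'I_n) : (k + j.+1)%N = n -> (k <= m (s j))%N.
  elim: k j => // k ih j kj.
  have jn : (j.+1 < n)%N by lia.
  have := tlt j (Ordinal jn) (leqnn _).
  have := ih (Ordinal jn); rewrite /= => /(_ _); lia.
have dle' j : (delta j <= m (s j))%N.
  by apply: dle; rewrite /delta subnK.
pose u := [tuple (m (s j) - delta j)%N | j < n].
have usort : sorted geq u.
  apply/(sortedP 0%N) => i; rewrite size_tuple => iSn.
  have iln : (i < n)%N by exact: ltnW.
  rewrite -(tnth_nth 0%N u (Ordinal iSn)) -(tnth_nth 0%N u (Ordinal iln)).
  rewrite !tnth_mktuple /=.
  have := tlt (Ordinal iln) (Ordinal iSn) (leqnn _); rewrite /delta /=.
  by have := dle' (Ordinal iSn); rewrite /delta /=; lia.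
exists (s : bool), (exist _ u usort).
have -> : \matrix_(i < n, j < n) x i ^+ (part (exist _ u usort) j + delta j) =
    col_perm s (\matrix_(i < n, j < n) x i ^+ m j).
  apply/matrixP => i j; rewrite !mxE /part /= tnth_mktuple subnK//.
rewrite col_permE det_mulmx det_perm odd_permV mulrCA.
by rewrite -signr_addb addbb mulr1.
Qed.

End partitions.

Section generic_jacobi_trudi.
Variables (K : comNzRingType) (n : nat) (x : 'I_n -> K).
Implicit Type p : npart n.

(** The index is an [int] because p'_i + j - i may be negative; the ring is arbitrary so that the
    [x i] can be the variables of [mpoly]. *)
Definition elemz (k : int) : K :=
  if k is Posz k' then \sum_(h : {set 'I_n} | #|h| == k') \prod_(i in h) x i
  else 0.

Let q : {poly K} := \prod_(i < n) ('X + (x i)%:P).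

Let qE : q = \prod_(i < n) ('X - (- x i)%:P).
Proof. by apply: eq_bigr => i _; rewrite polyCN opprK. Qed.

Let qsz : size q = n.+1.
Proof. by rewrite qE size_prod_XsubC /index_enum -enumT size_enum_ord. Qed.

(** The coefficient of q that is read has index g - j = n - (c + j - k). If c + j - k > n, it lies
    below ['X^j] and no subset is that large; if c + j - k < 0, it lies above the degree of q. *)
Let coefXq (k j g c : nat) : (c <= n)%N -> (g + c = n + k)%N ->
  ('X^j * q)`_g = elemz (c%:Z + j%:Z - k%:Z).
Proof.
move=> cn gc; rewrite coefXnM; case: ltnP => gj.
  case e : (c%:Z + j%:Z - k%:Z) => [m|//] /=; rewrite big1// => h /eqP hm.
  have : (#|h| <= n)%N by rewrite -[X in (_ <= X)%N](card_ord n) max_card.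
  by rewrite hm; lia.
case e : (c%:Z + j%:Z - k%:Z) => [m|m] /=; last first.
  by apply: nth_default; rewrite qsz; lia.
have mn : (m <= n)%N by lia.
have -> : (g - j = n - m)%N by lia.
exact: coef_prod_XD.
Qed.

(** The exponents p_j + [delta] j and the numbers n + i - p'_i with i < p_1, counted from 0,
    partition {0, ..., n + p_1 - 1}, so the alternant and the determinant of elementary symmetric
    functions are complementary minors. The points used are the roots - x_i of q, and the signs
    (-1)^(p_j + [delta] j) that this creates are absorbed in [b]. *)
Lemma dual_jacobi_trudi p : exists b : bool,
  \det (\matrix_(i < n, j < n) x i ^+ (part p j + delta j)) =
  (-1) ^+ b * (\prod_(i < n) \prod_(j < n | (i < j)%N) (x i - x j)) *
  \det (\matrix_(i < part1 p, j < part1 p)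
          elemz ((conj_part p i)%:Z + j%:Z - i%:Z)).
Proof.
have qmon : q \is monic by rewrite qE monic_prod_XsubC.
have qy i : q.[- x i] = 0.
  by rewrite qE horner_prod (bigD1 i)//= hornerXsubC subrr mul0r.
have [||||b] := @complementary_minors _ n (part1 p) q (fun i => - x i)
  (fun j => part p j + delta j)%N (fun i => n + i - conj_part p i)%N
  qmon qsz qy (@part_delta_inj n p).
- move=> i j /= e; have [ij|ij|/ord_inj//] := ltngtP i j.
    have := conj_part_nonincreasing p (ltnW ij).
    have := conj_part_le p i; lia.
  have := conj_part_nonincreasing p (ltnW ij).
  have := conj_part_le p j; lia.
(* If p_i > j then p'_j > i and the second number is the smaller one; otherwise both inequalities
   are reversed and it is the larger one. *)
- move=> i j /=; have := conj_partP p j i.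
  have := conj_part_le p j; have := ltn_ord i; rewrite /delta.
  case: ltnP; case: ltnP => //; lia.
- move=> i; have := part_le_part1 p i; have := ltn_ord i; rewrite /delta; lia.
- move=> i; have := conj_part_le p i; have := ltn_ord i.
  lia.
(* At the points - x_i the Vandermonde factor (- x_j) - (- x_i) is x_i - x_j, so no sign arises
   here. *)
have -> : \det (\matrix_(i < n, j < n) (- x i) ^+ j) =
    \prod_(i < n) \prod_(j < n | (i < j)%N) (x i - x j).
  rewrite -det_tr.
  have -> : (\matrix_(i < n, j < n) (- x i) ^+ j)^T =
      Vandermonde n (\row_i (- x i)).
    by apply/matrixP => i j; rewrite !mxE.
  rewrite det_Vandermonde; apply: eq_bigr => i _; apply: eq_bigr => j _.
  by rewrite !mxE opprK addrC.
have -> : \matrix_(i < part1 p, j < part1 p) ('X^j * q)`_(n + i - conj_part p i) =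
    \matrix_(i < part1 p, j < part1 p) elemz ((conj_part p i)%:Z + j%:Z - i%:Z).
  apply/matrixP => i j; rewrite !mxE; apply: coefXq.
    exact: conj_part_le.
  by have := conj_part_le p i; lia.
have -> : \matrix_(i < n, j < n) (- x i) ^+ (part p j + delta j) =
    \matrix_(i < n, j < n) (x i ^+ (part p j + delta j) *
       (-1) ^+ (part p j + delta j)).
  by apply/matrixP => i j; rewrite [LHS]mxE [RHS]mxE [LHS]exprNn [LHS]mulrC.
rewrite det_scale_col.
have [c ->] := prod_signr K (fun j => part p j + delta j)%N.
move=> e; exists (c (+) b); rewrite signr_addb -2!(mulrA ((-1) ^+ c)) -e.
by rewrite mulrCA -signr_addb addbb mulr1.
Qed.

End generic_jacobi_trudi.

Section jacobi_trudi.
Variables (R : realType) (n : nat).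
Implicit Type p : npart n.

Definition mesymz (k : int) : mpoly n R[i] := elemz (@mvar R n) k.

Definition conj_poly p : mpoly n R[i] :=
  \det (\matrix_(i < part1 p, j < part1 p)
          mesymz ((conj_part p i)%:Z + j%:Z - i%:Z)).

Lemma conj_jacobi_trudi p : exists b : bool,
  \det (\matrix_(i < n, j < n) (mvar R i ^+ (part p j + delta j))) =
  (-1) ^+ b * vandermonde R n * conj_poly p.
Proof. exact: dual_jacobi_trudi. Qed.

Lemma vandermonde_neq0 : vandermonde R n != 0.
Proof.
apply/prodf_neq0 => i _; apply/prodf_neq0 => j ij.
rewrite subr_eq0; apply/eqP => /(congr1 (mcoeff (mnm1 i))).
rewrite !mcoeffXU eqxx; have -> : (j == i) = false.
  by rewrite -val_eqE gtn_eqF.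
by move/eqP; rewrite oner_eq0.
Qed.

Lemma peval_mesymz k (z : 'rV[R[i]]_n) :
  peval (mesymz k) z = ecoord (symmetrization z) k.
Proof.
case: k => [[|k]|k] /=; rewrite /peval.
- by rewrite -[X in meval _ X]/(mesym n R[i] 0) mesym0E meval1.
- rewrite -[X in meval _ X]/(mesym n R[i] k.+1); case: insubP => [u uk uE|]; first by rewrite mxE uE.
  by rewrite -leqNgt => nk; rewrite mesym_geqnE// meval0.
- by rewrite meval0.
Qed.

Lemma peval_conj_poly p (z : 'rV[R[i]]_n) :
  peval (conj_poly p) z = conj_det p (symmetrization z).
Proof.
rewrite /peval /conj_poly -det_map_mx; congr (\det _).
by apply/matrixP => i j; rewrite !mxE -peval_mesymz.
Qed.

Definition alt_det (m : 'I_n -> nat) (z : 'rV[R[i]]_n) : R[i] :=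
  \det (\matrix_(i < n, j < n) (z 0 i ^+ m j)).

Definition vdm (z : 'rV[R[i]]_n) : R[i] := peval (vandermonde R n) z.

Lemma alt_det_conj_det p : exists b : bool, forall z,
  alt_det (fun j => part p j + delta j)%N z =
  (-1) ^+ b * (conj_det p (symmetrization z) * vdm z).
Proof.
have [b e] := conj_jacobi_trudi p; exists b => z.
move/(congr1 (fun P => peval P z)): e; rewrite /peval !mevalM.
rewrite -/(peval (conj_poly p) z) peval_conj_poly.
rewrite -[meval _ (vandermonde R n)]/(vdm z).
rewrite rmorph_sign -det_map_mx.
rewrite -mulrA [vdm z * _]mulrC => <-.
congr (\det _); apply/matrixP => i j.
by rewrite !mxE rmorphXn /= mevalXU.
Qed.

(** [schur] is some polynomial selected by [xget]. The dual Jacobi-Trudi identity exhibits one, and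
    cancelling the nonzero Vandermonde polynomial identifies the selected one with it. *)
Lemma peval_schur p : exists b : bool, forall z,
  peval (schur R p) z = (-1) ^+ b * conj_det p (symmetrization z).
Proof.
have [b e] := conj_jacobi_trudi p; exists b => z.
have ex : exists P, [set P | P * vandermonde R n =
    \det (\matrix_(i < n, j < n) (mvar R i ^+ (part p j + delta j)%N))] P.
  by exists ((-1) ^+ b * conj_poly p); rewrite /= mulrAC; exact/esym.
have := xgetPex 0 ex; rewrite -/(schur R p) /=.
rewrite e mulrAC => /(mulIf vandermonde_neq0) ->.
by rewrite /peval mevalM rmorph_sign -[meval _ (conj_poly p)]/(peval _ _) peval_conj_poly.
Qed.

Lemma schur_term p (z w : 'rV[R[i]]_n) (c : R[i]) :
  c * peval (schur R p) z * Num.conj (peval (schur R p) w) =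
  c * (conj_det p (symmetrization z) * Num.conj (conj_det p (symmetrization w))).
Proof.
have [b e] := peval_schur p; rewrite !e rmorphM rmorph_sign /=.
rewrite -mulrA mulrACA -signr_addb addbb mul1r //.
Qed.

End jacobi_trudi.

#[local] Existing Instance totally_filter.

(** * Expansion of the kernel *)

Section conclusion.
Variables (R : realType) (n : nat) (mu : R).
Implicit Types (p : npart n) (s t : 'rV[R[i]]_n).
Implicit Types (H : fun_space R n) (B : 'rV[R[i]]_n -> 'rV[R[i]]_n -> R[i]).

Definition kernel_term s t p : R[i] :=
  (gamma mu p ^+ 2)%:C * (conj_det p s * Num.conj (conj_det p t)).

Definition kernel_expansion B := forall s t,
  @sym_polydisc R n s -> @sym_polydisc R n t ->
  partial_sum (kernel_term s t) @ totally --> B s t.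

Lemma schur_kernel_expansion B : schur_kernel mu B -> kernel_expansion B.
Proof.
move=> kB _ _ [z Dz <-] [w Dw <-].
have -> : kernel_term (symmetrization z) (symmetrization w) = fun p =>
    (gamma mu p ^+ 2)%:C * peval (schur R p) z * Num.conj (peval (schur R p) w).
  by apply/funext => p; rewrite schur_term.
exact: kB.
Qed.

(** Pair B(., w) with B'(., u) and evaluate the product with the reproducing property of either
    kernel; Hermitian symmetry identifies the results. *)
Lemma reproducing_kernel_unique G H B B' : hilbert_on G H ->
  reproducing_kernel G H B -> reproducing_kernel G H B' ->
  forall u w, G u -> G w -> B u w = B' u w.
Proof.
move=> hH [mB rB] [mB' rB'] u w Gu Gw.
rewrite (rB' _ u (mB w Gw) Gu) (hilbert_dotC hH (mB' u Gu) (mB w Gw)).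
rewrite -(rB _ w (mB' u Gu) Gw).
rewrite (rB' _ w (mB' u Gu) Gw) -(hilbert_dotC hH)//; try exact: mB'.
by rewrite -(rB' _ u (mB' w Gw) Gu).
Qed.

Lemma part1_eq0 p : part1 p = 0%N -> forall j, part p j = 0%N.
Proof.
by move=> p0 j; apply/eqP; rewrite -leqn0 -p0 part_le_part1.
Qed.

Lemma npart0_subproof : sorted geq (nseq_tuple n 0%N).
Proof.
apply/(sortedP 0%N) => i; rewrite size_tuple => ?.
by rewrite !nth_nseq !if_same.
Qed.

Definition npart0 : npart n := exist _ (nseq_tuple n 0%N) npart0_subproof.

Lemma part_npart0 j : part npart0 j = 0%N.
Proof. by rewrite /part (tnth_nth 0%N) nth_nseq if_same. Qed.

Lemma npart_inj p q : part p =1 part q -> p = q.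
Proof.
by move=> pq; apply/val_inj/eq_from_tnth => j; exact: pq.
Qed.

(** For p nonzero the first column of the diagram is nonempty, so the first row of the determinant
    contains only s_k with k > 0, which vanish at the origin; for p = 0 the determinant is empty.
    Hence B(0, 0) reduces to its term at p = 0. *)
Lemma conj_det_at0 p : conj_det p (0 : 'rV[R[i]]_n) = (p == npart0)%:R.
Proof.
case: eqP => [->|/eqP p0].
  rewrite /conj_det.
  have -> : part1 npart0 = 0%N by rewrite /part1 /=; case: (n).
  by rewrite det_mx00.
have p1 : (0 < part1 p)%N.
  rewrite lt0n; apply: contra p0 => /eqP/part1_eq0 pj0.
  by apply/eqP/npart_inj => j; rewrite pj0 part_npart0.
rewrite /conj_det (expand_det_row _ (Ordinal p1)) big1// => j _.
have n0 : (0 < n)%N.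
  by move: p1; rewrite /part1; case: (p) => -[[|? ?]]//= /eqP <-.
have := conj_partP p 0 (Ordinal n0); rewrite /part (tnth_nth 0%N) nth0 -/(part1 p) p1.
rewrite mxE /= addn0; case: (conj_part p 0) => [//|c] _; rewrite addSn /=.
by case: insubP => [k _ _|_]; rewrite ?mxE mul0r.
Qed.

Lemma pochhammer_gt0 k : 0 < mu -> 0 < pochhammer mu k.
Proof.
by move=> mu0; apply: prodr_gt0 => i _; rewrite ltr_wpDr// ler0n.
Qed.

Lemma mpochhammer_gt0 (m : 'I_n -> nat) : 0 < mu -> 0 < mpochhammer mu m.
Proof. by move=> mu0; apply: prodr_gt0 => i _; exact: pochhammer_gt0. Qed.

Lemma mfact_gt0 (m : 'I_n -> nat) : (0 < mfact m)%N.
Proof. by apply: prodn_gt0 => i; exact: fact_gt0. Qed.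

Lemma sqr_gamma p : 0 < mu -> gamma mu p ^+ 2 =
  mpochhammer mu (fun j => part p j + delta j)%N /
  (mfact (fun j => part p j + delta j)%N)%:R.
Proof.
move=> mu0; rewrite sqr_sqrtr// divr_ge0 ?ler0n// ltW//.
exact: mpochhammer_gt0.
Qed.

Lemma sym_polydisc0 : @sym_polydisc R n 0.
Proof.
exists 0 => [i|]; first by rewrite mxE normr0.
apply/rowP => k; rewrite !mxE /peval /mesym rmorph_sum big1//= => h /eqP hk.
rewrite rmorph_prod /=; have /card_gt0P[j jh] : (0 < #|h|)%N by rewrite hk.
by rewrite (bigD1 j)//= mevalXU mxE mul0r.
Qed.

Lemma kernel_at0 B : 0 < mu -> kernel_expansion B ->
  B 0 0 = (mpochhammer mu (@delta n) / (mfact (@delta n))%:R)%:C.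
Proof.
move=> mu0 kB.
have := kB 0 0 sym_polydisc0 sym_polydisc0.
have g0 : gamma mu npart0 ^+ 2 = mpochhammer mu (@delta n) / (mfact (@delta n))%:R.
  rewrite sqr_gamma//; have -> // : (fun j => part npart0 j + delta j)%N = @delta n.
  by apply/funext => j; rewrite part_npart0.
rewrite -g0 => cB.
have c0 : partial_sum (kernel_term (0 : 'rV[R[i]]_n) 0) @ totally -->
    ((gamma mu npart0 ^+ 2)%:C : R[i]).
  apply: cvg_near_cst.
  exists [fset npart0]%fset => // A /= /fsubsetP /(_ npart0 (fset11 _)) A0.
  rewrite /partial_sum (bigD1 (FSetSub A0))//= /kernel_term conj_det_at0 eqxx.
  rewrite mulr1n conjC1 !mulr1 big1 ?addr0// => p pA.
  rewrite conj_det_at0; have -> : (fsval p == npart0) = false.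
    by apply/negbTE; apply: contra pA => /eqP pE; apply/eqP/val_inj.
  by rewrite !mul0r mulr0.
exact: (@cvg_unique _ (@norm_hausdorff _ _) _ _ _ _ cB c0).
Qed.

Lemma kernel_expansion_normalized B s t : 0 < mu -> kernel_expansion B ->
  sym_polydisc s -> sym_polydisc t ->
  cvg (partial_sum (kernel_term s t) @ totally) /\
  normalized_kernel B s t =
    ((mfact (@delta n))%:R / mpochhammer mu (@delta n))%:C * sum (kernel_term s t).
Proof.
move=> mu0 kB Gs Gt; have cB := kB s t Gs Gt.
split; first by apply/cvg_ex; exists (B s t).
rewrite /sum (cvg_lim (@norm_hausdorff _ _) cB) /normalized_kernel kernel_at0//.
by rewrite -fmorphV /= invf_div mulrC.
Qed.

End conclusion.

(** * Complex integrals *)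

Section complex_basics.
Variable R : realType.
Local Notation C := R[i].
Implicit Types (z w : C) (x y : R).

Lemma normrcE z : `|z| = (normc z)%:C.
Proof. by []. Qed.

(** Estimates are carried out with the real-valued [normc]: the modulus written with bars lies in
    [R[i]], whose order is only partial. *)
Lemma normc_ge0 z : 0 <= normc z.
Proof. by rewrite -ler0c -normrcE. Qed.

Lemma gt0_complexP (e : C) : 0 < e -> exists2 x : R, 0 < x & e = x%:C.
Proof.
move=> e0; have /complex_realP[x ex] := gtr0_real e0.
by exists x => //; move: e0; rewrite ex ltcR.
Qed.

Lemma normc_real x : normc (x%:C : C) = `|x|.
Proof. by rewrite /= expr0n addr0 sqrtr_sqr. Qed.

Lemma normcB z w : normc (z - w) = normc (w - z).
Proof. by rewrite -normcN opprB. Qed.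

Lemma normcX z k : normc (z ^+ k) = normc z ^+ k.
Proof.
by elim: k => [|k ih]; rewrite ?expr0 ?normc1// !exprS normcM ih.
Qed.

Lemma normc_sum (I : Type) (r : seq I) (P : pred I) (f : I -> C) :
  normc (\sum_(i <- r | P i) f i) <= \sum_(i <- r | P i) normc (f i).
Proof.
elim/big_ind2 : _ => [|a b c d ab cd|//]; first by rewrite normc0.
exact: le_trans (le_normcD _ _) (lerD ab cd).
Qed.

Lemma Re_le_normc z : `|complex.Re z| <= normc z.
Proof.
case: z => a b /=; rewrite -sqrtr_sqr ler_wsqrtr// lerDl sqr_ge0//.
Qed.

Lemma Im_le_normc z : `|complex.Im z| <= normc z.
Proof.
case: z => a b /=; rewrite -sqrtr_sqr ler_wsqrtr// lerDr sqr_ge0//.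
Qed.

Lemma normc_le_ReIm z : normc z <= `|complex.Re z| + `|complex.Im z|.
Proof.
case: z => a b /=; rewrite -(ler_pXn2r (n := 2))// ?nnegrE ?sqrtr_ge0 ?addr_ge0//.
rewrite sqr_sqrtr ?addr_ge0 ?sqr_ge0// sqrrD !real_normK ?num_real//.
by rewrite lerD2r lerDl mulrn_wge0// mulr_ge0.
Qed.

Lemma cvg_complexP (T : Type) (F : set_system T) (FF : Filter F) (f : T -> C) z :
  f @ F --> z <-> forall e : R, 0 < e -> \forall t \near F, normc (f t - z) < e.
Proof.
split=> [/cvgrPdist_lt fz e e0|fz].
  have e0' : (0 : C) < e%:C by rewrite ltcR.
  have := fz _ e0'; apply: filterS => t; rewrite normrcE ltcR.
  by rewrite normcB.
apply/cvgrPdist_lt => e /gt0_complexP[x x0 ->].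
by have := fz _ x0; apply: filterS => t; rewrite normrcE ltcR normcB.
Qed.

Lemma cvg_complexE (T : Type) (F : set_system T) (FF : Filter F) (f g : T -> R) x y :
  f @ F --> x -> g @ F --> y -> (fun t => f t +i* g t) @ F --> (x +i* y : C).
Proof.
move=> fx gy; apply/cvg_complexP => e e0.
have e2 : 0 < e / 2 by rewrite divr_gt0.
move/cvgrPdist_lt/(_ _ e2) : fx; move/cvgrPdist_lt/(_ _ e2) : gy.
apply: filterS2 => t gt ft.
apply: le_lt_trans (normc_le_ReIm _) _ => /=.
by rewrite (splitr e) ltrD// distrC.
Qed.

Lemma cvg_Re (T : Type) (F : set_system T) (FF : Filter F) (f : T -> C) z :
  f @ F --> z -> (fun t => complex.Re (f t)) @ F --> complex.Re z.
Proof.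
move=> /cvg_complexP fz; apply/cvgrPdist_lt => e /fz; apply: filterS => t.
by apply: le_lt_trans; rewrite distrC -raddfB Re_le_normc.
Qed.

Lemma cvg_Im (T : Type) (F : set_system T) (FF : Filter F) (f : T -> C) z :
  f @ F --> z -> (fun t => complex.Im (f t)) @ F --> complex.Im z.
Proof.
move=> /cvg_complexP fz; apply/cvgrPdist_lt => e /fz; apply: filterS => t.
by apply: le_lt_trans; rewrite distrC -raddfB Im_le_normc.
Qed.

Lemma ReM z w : complex.Re (z * w) =
  complex.Re z * complex.Re w - complex.Im z * complex.Im w.
Proof. by case: z; case: w. Qed.

Lemma ImM z w : complex.Im (z * w) =
  complex.Re z * complex.Im w + complex.Im z * complex.Re w.
Proof. by case: z; case: w. Qed.

Lemma ReD z w : complex.Re (z + w) = complex.Re z + complex.Re w.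
Proof. by case: z; case: w. Qed.

Lemma ImD z w : complex.Im (z + w) = complex.Im z + complex.Im w.
Proof. by case: z; case: w. Qed.

Lemma ReB z w : complex.Re (z - w) = complex.Re z - complex.Re w.
Proof. by case: z; case: w. Qed.

Lemma ImB z w : complex.Im (z - w) = complex.Im z - complex.Im w.
Proof. by case: z; case: w. Qed.

Lemma complex_eq z w :
  complex.Re z = complex.Re w -> complex.Im z = complex.Im w -> z = w.
Proof. by case: z; case: w => a b c d /= -> ->. Qed.

Definition cis x : C := cos x +i* sin x.

Lemma normc_cis x : normc (cis x) = 1.
Proof. by rewrite /= cos2Dsin2 sqrtr1. Qed.

Lemma cis0 : cis 0 = 1.
Proof. by rewrite /cis cos0 sin0. Qed.

Lemma cisD x y : cis (x + y) = cis x * cis y.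
Proof. by apply: complex_eq => /=; rewrite ?cosD ?sinD//; ring. Qed.

Lemma cis2pi : cis (2 * pi) = 1.
Proof.
rewrite mulr_natl mulr2n cisD; have -> : cis pi = -1.
  by rewrite /cis cospi sinpi; apply: complex_eq => /=; rewrite ?oppr0.
by rewrite mulrNN mulr1.
Qed.

Lemma cisX x k : cis x ^+ k = cis (k%:R * x).
Proof.
elim: k => [|k ih]; first by rewrite mul0r cis0.
by rewrite exprS ih -cisD -[X in X + _]mul1r -mulrDl -natr1 addrC.
Qed.

Lemma conj_cis x : Num.conj (cis x) = cis (- x).
Proof. by rewrite /cis cosN sinN. Qed.

Lemma continuous_cis : continuous cis.
Proof. by move=> x; apply: cvg_complexE; [exact: continuous_cos|exact: continuous_sin]. Qed.

End complex_basics.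

Section complex_integral.
Context d (T : measurableType d) (R : realType).
Variables (mu : {measure set T -> \bar R}) (D : set T).
Hypothesis mD : measurable D.
Local Notation C := R[i].
Implicit Types (f g : T -> C) (c : C).

Definition cintegral f : C :=
  (\int[mu]_(x in D) complex.Re (f x)) +i* (\int[mu]_(x in D) complex.Im (f x)).

Definition cintegrable f :=
  mu.-integrable D (EFin \o (fun x => complex.Re (f x))) /\
  mu.-integrable D (EFin \o (fun x => complex.Im (f x))).

Let integrableD_EFin (f g : T -> R) : mu.-integrable D (EFin \o f) ->
  mu.-integrable D (EFin \o g) -> mu.-integrable D (EFin \o (fun x => f x + g x)).
Proof. by move=> fi gi; have := integrableD mD fi gi. Qed.

Let integrableZ_EFin (f : T -> R) r : mu.-integrable D (EFin \o f) ->
  mu.-integrable D (EFin \o (fun x => r * f x)).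
Proof. by move=> fi; have := integrableZl mD r fi. Qed.

Let integrableB_EFin (f g : T -> R) : mu.-integrable D (EFin \o f) ->
  mu.-integrable D (EFin \o g) -> mu.-integrable D (EFin \o (fun x => f x - g x)).
Proof. by move=> fi gi; have := integrableB mD fi gi. Qed.

Lemma eq_cintegrable f g : (forall x, D x -> f x = g x) -> cintegrable f -> cintegrable g.
Proof.
move=> fg [fi gi]; split.
  by apply: eq_integrable fi => // x /set_mem Dx; rewrite /= fg.
by apply: eq_integrable gi => // x /set_mem Dx; rewrite /= fg.
Qed.

Lemma eq_cintegral f g : (forall x, D x -> f x = g x) -> cintegral f = cintegral g.
Proof.
move=> fg; congr (_ +i* _); apply: eq_Rintegral => x /set_mem Dx; by rewrite fg.
Qed.

Lemma cintegrableD f g : cintegrable f -> cintegrable g ->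
  cintegrable (fun x => f x + g x).
Proof.
move=> [fr fi] [gr gi]; split.
  apply: eq_integrable (integrableD_EFin fr gr) => // x _ /=; by rewrite ReD.
apply: eq_integrable (integrableD_EFin fi gi) => // x _ /=; by rewrite ImD.
Qed.

Lemma cintegrableZ c f : cintegrable f -> cintegrable (fun x => c * f x).
Proof.
move=> [fr fi]; split.
  apply: eq_integrable (integrableB_EFin (integrableZ_EFin (complex.Re c) fr)
    (integrableZ_EFin (complex.Im c) fi)) => // x _ /=; by rewrite ReM.
apply: eq_integrable (integrableD_EFin (integrableZ_EFin (complex.Re c) fi)
    (integrableZ_EFin (complex.Im c) fr)) => // x _ /=; by rewrite ImM.
Qed.

Lemma cintegralD f g : cintegrable f -> cintegrable g ->
  cintegral (fun x => f x + g x) = cintegral f + cintegral g.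
Proof.
move=> [fr fi] [gr gi]; apply: complex_eq; rewrite ?ReD ?ImD /=.
  by under eq_Rintegral do rewrite ReD; rewrite RintegralD.
by under eq_Rintegral do rewrite ImD; rewrite RintegralD.
Qed.

Lemma cintegralZ c f : cintegrable f -> cintegral (fun x => c * f x) = c * cintegral f.
Proof.
move=> [fr fi]; apply: complex_eq.
  rewrite ReM /=; under eq_Rintegral do rewrite ReM.
  by rewrite RintegralB ?RintegralZl//; exact: integrableZ_EFin.
rewrite ImM /=; under eq_Rintegral do rewrite ImM.
by rewrite RintegralD ?RintegralZl//; exact: integrableZ_EFin.
Qed.

Lemma cintegrableN f : cintegrable f -> cintegrable (fun x => - f x).
Proof.
move=> /(cintegrableZ (-1)); apply: eq_cintegrable => x _; by rewrite mulN1r.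
Qed.

Lemma cintegralN f : cintegrable f -> cintegral (fun x => - f x) = - cintegral f.
Proof.
move=> fi; rewrite -mulN1r -cintegralZ//; apply: eq_cintegral => x _.
by rewrite mulN1r.
Qed.

Lemma cintegrableB f g : cintegrable f -> cintegrable g ->
  cintegrable (fun x => f x - g x).
Proof. by move=> fi gi; apply: cintegrableD => //; exact: cintegrableN. Qed.

Lemma cintegralB f g : cintegrable f -> cintegrable g ->
  cintegral (fun x => f x - g x) = cintegral f - cintegral g.
Proof.
by move=> fi gi; rewrite cintegralD ?cintegralN//; exact: cintegrableN.
Qed.

Lemma cintegrable0 : cintegrable (fun=> 0).
Proof. by split; exact: integrable0. Qed.

Lemma cintegral0 : cintegral (fun=> 0) = 0.
Proof. by rewrite /cintegral /Rintegral /= !integral0. Qed.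

Lemma cintegrable_sum (I : Type) (r : seq I) (F : I -> T -> C) :
  (forall i, cintegrable (F i)) -> cintegrable (fun x => \sum_(i <- r) F i x).
Proof.
move=> Fi; elim: r => [|i r ih].
  by apply: eq_cintegrable cintegrable0 => x _; rewrite big_nil.
by apply: eq_cintegrable (cintegrableD (Fi i) ih) => x _; rewrite big_cons.
Qed.

Lemma cintegral_sum (I : Type) (r : seq I) (F : I -> T -> C) :
  (forall i, cintegrable (F i)) ->
  cintegral (fun x => \sum_(i <- r) F i x) = \sum_(i <- r) cintegral (F i).
Proof.
move=> Fi; elim: r => [|i r ih].
  rewrite big_nil; apply: etrans cintegral0.
  by apply: eq_cintegral => x _; rewrite big_nil.
rewrite big_cons -ih -cintegralD//; last exact: cintegrable_sum.
by apply: eq_cintegral => x _; rewrite big_cons.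
Qed.

Lemma conj_cintegral f : cintegrable f ->
  cintegral (fun x => Num.conj (f x)) = Num.conj (cintegral f).
Proof.
move=> [fr fi]; apply: complex_eq => /=.
  by apply: eq_Rintegral => x _; case: (f x).
rewrite -mulN1r -RintegralZl//; apply: eq_Rintegral => x _.
by case: (f x) => ? ? /=; rewrite mulN1r.
Qed.

(** The factor 2 is the price of bounding real and imaginary parts separately; it reappears in the
    constants of the estimates built on this one. *)
Lemma normc_cintegral f (g : T -> R) : cintegrable f ->
  mu.-integrable D (EFin \o g) -> (forall x, D x -> normc (f x) <= g x) ->
  normc (cintegral f) <= 2 * \int[mu]_(x in D) g x.
Proof.
move=> [fr fi] gi fg; apply: le_trans (normc_le_ReIm _) _ => /=.
rewrite mulr_natl mulr2n lerD//; apply: le_trans (le_normr_Rintegral _ _) _ => //.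
  apply: le_Rintegral => //; first exact: integrable_abse fr.
  by move=> x Dx; exact: le_trans (Re_le_normc _) (fg x Dx).
apply: le_Rintegral => //; first exact: integrable_abse fi.
by move=> x Dx; exact: le_trans (Im_le_normc _) (fg x Dx).
Qed.

End complex_integral.

(** * Integrals of complex functions over a real interval *)

Section interval_integral.
Variable R : realType.
Local Notation C := R[i].
Local Notation leb := (@lebesgue_measure R).
Implicit Types (a b c : R) (f g : R -> C).

Definition icontinuous a b f := {within `[a, b], continuous f}.

Definition itvint a b f : C := cintegral leb `[a, b] f.

Lemma icontinuous_integrable a b f : icontinuous a b f ->
  cintegrable leb `[a, b] f.
Proof.
move=> fc; split; apply: continuous_compact_integrable; try exact: segment_compact.
- by move=> x; apply: cvg_Re; exact: fc.
- by move=> x; apply: cvg_Im; exact: fc.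
Qed.

Lemma continuous_icontinuous a b f : continuous f -> icontinuous a b f.
Proof. by move=> fc; exact: continuous_subspaceT. Qed.

Lemma icontinuousM a b f g : icontinuous a b f -> icontinuous a b g ->
  icontinuous a b (fun x => f x * g x).
Proof. by move=> fc gc x; apply: cvgM; [exact: fc|exact: gc]. Qed.

Lemma icontinuousB a b f g : icontinuous a b f -> icontinuous a b g ->
  icontinuous a b (fun x => f x - g x).
Proof. by move=> fc gc x; apply: cvgB; [exact: fc|exact: gc]. Qed.

Lemma icontinuous_cst a b (z : C) : icontinuous a b (fun=> z).
Proof. by move=> x; exact: cvg_cst. Qed.

Lemma itvint_cat a b c f : a <= c -> c <= b -> icontinuous a b f ->
  itvint a b f = itvint a c f + itvint c b f.
Proof.
move=> ac cb fc; have [fr fi] := icontinuous_integrable fc.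
have cut (h : R -> R) : leb.-integrable `[a, b] (EFin \o h) ->
    \int[leb]_(x in `[a, b]) h x =
    \int[leb]_(x in `[a, c]) h x + \int[leb]_(x in `[c, b]) h x.
  move=> hi; rewrite -(@Rintegral_itv_obnd_cbnd _ c (BRight b)).
    rewrite -(@Rintegral_itvB _ _ (BLeft a) (BRight b) c hi) ?bnd_simp//.
    by rewrite addrC subrK.
  apply: integrableS hi => //.
  by apply: subset_itv; rewrite bnd_simp.
by apply: complex_eq => /=; rewrite (cut _ _).
Qed.

Lemma itvint_bound a b f (M : R) : a <= b -> icontinuous a b f ->
  (forall x, a <= x <= b -> normc (f x) <= M) ->
  normc (itvint a b f) <= 2 * (M * (b - a)).
Proof.
move=> ab fc fM.
have -> : M * (b - a) = \int[leb]_(x in `[a, b]) M.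
  by rewrite Rintegral_cst//= lebesgue_measure_itv/= lte_fin; case: ltgtP ab => // ->;
     rewrite subrr.
apply: normc_cintegral => //.
- exact: icontinuous_integrable.
- apply: continuous_compact_integrable; first exact: segment_compact.
  by move=> x; exact: cvg_cst.
Qed.

Lemma itvint_cst a b (z : C) : a <= b -> itvint a b (fun=> z) = (b - a)%:C * z.
Proof.
move=> ab; rewrite /itvint /cintegral !Rintegral_cst//= !lebesgue_measure_itv/= lte_fin.
have -> : fine (if a < b then (b%:E - a%:E)%E else 0%E) = b - a.
  by case: ltgtP ab => // ->; rewrite subrr.
by case: z => u v; apply: complex_eq; rewrite /= ?mul0r ?subr0 ?addr0 mulrC.
Qed.

Lemma itvint_FTC a b (F f : R -> C) : a <= b -> continuous f ->
  (forall x : R, is_derive x (1 : R) (fun t => complex.Re (F t)) (complex.Re (f x))) ->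
  (forall x : R, is_derive x (1 : R) (fun t => complex.Im (F t)) (complex.Im (f x))) ->
  itvint a b f = F b - F a.
Proof.
rewrite le_eqVlt => /predU1P[->|ab] fc dR dI.
  rewrite subrr /itvint /cintegral /Rintegral !set_itv1.
  by rewrite !integral_set1.
have ftc (G g : R -> R) : continuous g -> (forall x : R, is_derive x (1 : R) G (g x)) ->
    \int[leb]_(x in `[a, b]) g x = G b - G a.
  move=> gc dG; rewrite /Rintegral (@continuous_FTC2 _ _ G)//.
  - exact: continuous_subspaceT.
  - have Gc : continuous G.
      by move=> x; apply/differentiable_continuous/derivable1_diffP/(@ex_derive _ _ _ _ _ _ _ (dG x)).
    split.
    + by move=> x _; exact: (@ex_derive _ _ _ _ _ _ _ (dG x)).
    + by apply: cvg_at_right_filter; exact: Gc.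
    + by apply: cvg_at_left_filter; exact: Gc.
  - by move=> x _; rewrite derive1E (@derive_val _ _ _ _ _ _ _ (dG x)).
apply: complex_eq; rewrite ?ReB ?ImB /=; apply: ftc => // x.
  by apply: cvg_Re; exact: fc.
by apply: cvg_Im; exact: fc.
Qed.

Lemma is_derive_cis (k x : R) :
  is_derive x (1 : R) (fun t => complex.Re (cis (k * t))) (complex.Re ('i * k%:C * cis (k * x))) /\
  is_derive x (1 : R) (fun t => complex.Im (cis (k * t))) (complex.Im ('i * k%:C * cis (k * x))).
Proof.
split; rewrite /cis /=.
  apply: is_derive_eq; rewrite /GRing.scale /=; ring.
apply: is_derive_eq; rewrite /GRing.scale /=; ring.
Qed.

Lemma continuous_cisM (k : R) : continuous (fun x => cis (k * x)).
Proof.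
move=> x; apply: (@continuous_comp _ _ _ (fun x => k * x) (@cis R)).
  by apply: cvgM; [exact: cvg_cst|exact: cvg_id].
exact: continuous_cis.
Qed.

Lemma itvint_cis a b (k : R) : a <= b ->
  itvint a b (fun x => 'i * k%:C * cis (k * x)) = cis (k * b) - cis (k * a).
Proof.
move=> ab; apply: (itvint_FTC (F := fun x => cis (k * x))) => //.
- by move=> x; apply: cvgM; [exact: cvg_cst|exact: continuous_cisM].
- by move=> x; case: (is_derive_cis k x).
- by move=> x; case: (is_derive_cis k x).
Qed.

Lemma itvintZ a b (z : C) f : icontinuous a b f ->
  itvint a b (fun x => z * f x) = z * itvint a b f.
Proof. by move=> /icontinuous_integrable fi; exact: cintegralZ. Qed.

Lemma itvintD a b f g : icontinuous a b f -> icontinuous a b g ->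
  itvint a b (fun x => f x + g x) = itvint a b f + itvint a b g.
Proof.
by move=> /icontinuous_integrable fi /icontinuous_integrable gi; exact: cintegralD.
Qed.

Lemma itvintB a b f g : icontinuous a b f -> icontinuous a b g ->
  itvint a b (fun x => f x - g x) = itvint a b f - itvint a b g.
Proof.
by move=> /icontinuous_integrable fi /icontinuous_integrable gi; exact: cintegralB.
Qed.

Lemma eq_itvint a b f g : (forall x, a <= x <= b -> f x = g x) ->
  itvint a b f = itvint a b g.
Proof. by move=> fg; apply: eq_cintegral => x /=; rewrite in_itv/=; exact: fg. Qed.

(** The difference is the integral of the derivative of [cis], of modulus 1; the constant 2 is that
    of [itvint_bound]. *)
Lemma normc_cisB (x y : R) : normc (cis x - cis y) <= 2 * `|x - y|.
Proof.
wlog xy : x y / y <= x => [th|].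
  by case: (leP y x) => [/th//|/ltW/th]; rewrite normcB distrC.
have := @itvint_cis y x 1 xy; rewrite !mul1r => <-.
rewrite ger0_norm ?subr_ge0//.
have := @itvint_bound y x (fun t => 'i * 1%:C * cis (1 * t)) 1 xy.
rewrite mul1r; apply.
  apply: continuous_icontinuous => t.
  by apply: cvgM; [exact: cvg_cst|exact: continuous_cisM].
move=> t _; rewrite 2!normcM normc_cis normc_real normr1 !mulr1.
by rewrite /= !expr2 mulr0 mulr1 add0r sqrtr1.
Qed.

(** For k nonzero, multiplying by i k produces an exact derivative whose boundary terms agree by
    periodicity. *)
Lemma itvint_cis_period (k : int) :
  itvint 0 (2 * pi) (fun x => cis (k%:~R * x)) = if k == 0 then (2 * pi)%:C else 0.
Proof.
have pi2 : 0 <= 2 * pi :> R by rewrite mulr_ge0// pi_ge0.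
case: eqP => [->|/eqP k0].
  rewrite (eq_itvint (g := fun=> 1)) ?itvint_cst ?subr0 ?mulr1// => x _.
  by rewrite mul0r cis0.
have cisk : cis (k%:~R * (2 * pi)) = 1 :> C.
  case: (intP k) => [|m|m]; first by rewrite mul0r cis0.
    by rewrite -cisX cis2pi expr1n.
  rewrite mulrNz mulNr -conj_cis -cisX cis2pi expr1n; exact: conjC1.
have := itvint_cis k%:~R pi2; rewrite mulr0 cis0 cisk subrr itvintZ; last first.
  by apply: continuous_icontinuous; exact: continuous_cisM.
move=> /eqP; rewrite mulf_eq0 => /orP[|/eqP//]; rewrite mulf_eq0 => /orP[|].
  by rewrite eq_complex /= oner_eq0 andbF.
by rewrite eq_complex /= eqxx andbT intr_eq0 (negbTE k0).
Qed.

End interval_integral.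

(** * Cauchy formula and Runge approximation *)

Section bisection.
Variables (R : realType) (I : R -> R -> R -> R -> R[i]) (a b c d : R).
Hypotheses (ab : a <= b) (cd : c <= d).
Hypothesis Ix : forall a' m b' c' d', a <= a' -> a' <= m -> m <= b' -> b' <= b ->
  c <= c' -> c' <= d' -> d' <= d -> I a' b' c' d' = I a' m c' d' + I m b' c' d'.
Hypothesis Iy : forall a' b' c' m d', a <= a' -> a' <= b' -> b' <= b ->
  c <= c' -> c' <= m -> m <= d' -> d' <= d -> I a' b' c' d' = I a' b' c' m + I a' b' m d'.
Hypothesis I_small : forall x y, a <= x <= b -> c <= y <= d ->
  forall e : R, 0 < e -> exists2 t : R, 0 < t & forall a' b' c' d',
    a <= a' <= x -> x <= b' <= b -> c <= c' <= y -> y <= d' <= d ->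
    b' - a' < t -> d' - c' < t ->
    normc (I a' b' c' d') <= e * (b' - a' + (d' - c')) ^+ 2.

Let A n := (b - a) / 2 ^+ n.
Let C n := (d - c) / 2 ^+ n.

Let AS n : A n = A n.+1 + A n.+1.
Proof. by rewrite /A exprS; field; rewrite expf_neq0. Qed.

Let CS n : C n = C n.+1 + C n.+1.
Proof. by rewrite /C exprS; field; rewrite expf_neq0. Qed.

Let A_ge0 n : 0 <= A n.
Proof. by rewrite divr_ge0 ?subr_ge0// exprn_ge0. Qed.

Let C_ge0 n : 0 <= C n.
Proof. by rewrite divr_ge0 ?subr_ge0// exprn_ge0. Qed.

Let J n (s : R * R) := normc (I s.1 (s.1 + A n) s.2 (s.2 + C n)).

Let inside n (s : R * R) :=
  [/\ a <= s.1, s.1 + A n <= b, c <= s.2 & s.2 + C n <= d].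

(** If each of the four quarters had less than a fourth of the modulus, additivity and the triangle
    inequality would contradict the value on the whole rectangle. *)
Let quarter n s : inside n s -> exists s', [/\
  s.1 <= s'.1, s'.1 + A n.+1 <= s.1 + A n,
  s.2 <= s'.2, s'.2 + C n.+1 <= s.2 + C n & J n s <= 4 * J n.+1 s'].
Proof.
case: s => u v [/= au ub cv vd].
have An := AS n; have Cn := CS n; have A0 := A_ge0 n.+1; have C0 := C_ge0 n.+1.
have e : I u (u + A n) v (v + C n) =
    I u (u + A n.+1) v (v + C n.+1) + I u (u + A n.+1) (v + C n.+1) (v + C n)
  + (I (u + A n.+1) (u + A n) v (v + C n.+1) +
     I (u + A n.+1) (u + A n) (v + C n.+1) (v + C n)).
  rewrite (@Ix u (u + A n.+1)); [|lra..].
  rewrite (@Iy u _ v (v + C n.+1)); [|lra..].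
  by rewrite (@Iy (u + A n.+1) _ v (v + C n.+1)); [|lra..].
apply: contrapT => /forallNP H.
have H4 u' v' : u <= u' -> u' + A n.+1 <= u + A n -> v <= v' ->
    v' + C n.+1 <= v + C n ->
    normc (I u' (u' + A n.+1) v' (v' + C n.+1)) <
    normc (I u (u + A n) v (v + C n)) / 4.
  move=> h1 h2 h3 h4; rewrite ltNge; apply/negP => h; apply: (H (u', v')); split => //.
  by rewrite /J /=; lra.
have h1 := H4 u v; have h2 := H4 u (v + C n.+1).
have h3 := H4 (u + A n.+1) v; have h4 := H4 (u + A n.+1) (v + C n.+1).
have := le_normcD (I u (u + A n.+1) v (v + C n.+1) + I u (u + A n.+1) (v + C n.+1) (v + C n))
  (I (u + A n.+1) (u + A n) v (v + C n.+1) +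
     I (u + A n.+1) (u + A n) (v + C n.+1) (v + C n)).
have := le_normcD (I u (u + A n.+1) v (v + C n.+1)) (I u (u + A n.+1) (v + C n.+1) (v + C n)).
have := le_normcD (I (u + A n.+1) (u + A n) v (v + C n.+1))
     (I (u + A n.+1) (u + A n) (v + C n.+1) (v + C n)).
rewrite -e.
have Ae : u + A n = u + A n.+1 + A n.+1 by lra.
have Ce : v + C n = v + C n.+1 + C n.+1 by lra.
rewrite Ae Ce in h1 h2 h3 h4 *.
have {}h1 : _ := h1 _ _ _ _; have {}h2 : _ := h2 _ _ _ _.
have {}h3 : _ := h3 _ _ _ _; have {}h4 : _ := h4 _ _ _ _.
move=> g1 g2 g3.
have {}h1 := h1 (lexx _) ltac:(lra) (lexx _) ltac:(lra).
have {}h2 := h2 (lexx _) ltac:(lra) ltac:(lra) ltac:(lra).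
have {}h3 := h3 ltac:(lra) ltac:(lra) (lexx _) ltac:(lra).
have {}h4 := h4 ltac:(lra) ltac:(lra) ltac:(lra) ltac:(lra).
lra.
Qed.

(* Goursat's bisection argument, for an abstract additive function I of rectangles [x, x'] x [y, y']. *)
Lemma rectangle_bisection : I a b c d = 0.
Proof.
(* The selection is made total, returning s itself when the rectangle is not inside, so that it can
   be iterated. *)
have /choice[next nextP] : forall p : nat * (R * R), exists s' : R * R,
    inside p.1 p.2 -> [/\ p.2.1 <= s'.1,
      s'.1 + A p.1.+1 <= p.2.1 + A p.1, p.2.2 <= s'.2,
      s'.2 + C p.1.+1 <= p.2.2 + C p.1 & J p.1 p.2 <= 4 * J p.1.+1 s'].
  move=> [n s].
  case: (pselect (inside n s)) => [/quarter[s' ?]|ns]; first by exists s'.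
  by exists s.
pose s := fix s n := if n is n'.+1 then next (n', s n') else (a, c).
have s_inside n : inside n (s n).
  elim: n => [|n ih]; first by split; rewrite /= ?/A ?/C ?expr0 ?divr1 ?subrKC.
  have [/= h1 h2 h3 h4 _] := nextP (n, s n) ih; have [g1 g2 g3 g4] := ih.
  by split; [exact: le_trans h1|exact: le_trans g2|exact: le_trans h3|exact: le_trans g4].
have sS n := nextP (n, s n) (s_inside n).
have Jn n : normc (I a b c d) <= 4 ^+ n * J n (s n).
  elim: n => [|n ih]; first by rewrite mul1r /J /= /A /C !expr0 !divr1 !subrKC.
  apply: le_trans ih _; rewrite exprSr -mulrA ler_wpM2l ?exprn_ge0//.
  by case: (sS n).
have mono m k : [/\ (s m).1 <= (s (m + k)%N).1, (s (m + k)%N).1 + A (m + k)%N <= (s m).1 + A m,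
    (s m).2 <= (s (m + k)%N).2 & (s (m + k)%N).2 + C (m + k)%N <= (s m).2 + C m].
  elim: k => [|k [h1 h2 h3 h4]]; first by rewrite addn0.
  rewrite addnS; have [/= g1 g2 g3 g4 _] := sS (m + k)%N.
  by split; [exact: le_trans g1|exact: le_trans h2|exact: le_trans g3|exact: le_trans h4].
(* Every lower corner lies below every upper corner, whatever the two levels; this is what makes the
   supremum of the lower corners a common point. *)
have cross m k : (s m).1 <= (s k).1 + A k /\ (s m).2 <= (s k).2 + C k.
  case: (leqP m k) => mk.
    have [h1 _ h3 _] := mono m (k - m)%N; rewrite subnKC// in h1 h3.
    by split; rewrite ler_wpDr.
  have [_ h2 _ h4] := mono k (m - k)%N; rewrite subnKC ?(ltnW mk)// in h2 h4.
  by split; [apply: le_trans h2|apply: le_trans h4]; rewrite lerDl.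
have point (f w : nat -> R) : (forall m k, f m <= f k + w k) ->
    exists x, forall k, f k <= x <= f k + w k.
  move=> fw; exists (sup (range f)) => k; apply/andP; split.
    apply: ub_le_sup; last by exists k.
    by exists (f 0%N + w 0%N) => _ [m _ <-]; exact: fw.
  apply: ge_sup; first by exists (f 0%N), 0%N.
  by move=> _ [m _ <-]; exact: fw.
have [x xP] := point (fun n => (s n).1) A (fun m k => (cross m k).1).
have [y yP] := point (fun n => (s n).2) C (fun m k => (cross m k).2).
apply: eq0_normc; apply/eqP; rewrite eq_le normc_ge0 andbT.
apply/ler_addgt0Pl => e e0; rewrite addr0.
set L := (b - a) + (d - c).
have L0 : 0 <= L by rewrite addr_ge0 ?subr_ge0.
(* Dividing by L^2 + 1 rather than by L^2 covers the degenerate rectangle with L = 0. *)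
have e'0 : 0 < e / (L ^+ 2 + 1) by rewrite divr_gt0// ltr_wpDl// sqr_ge0.
have xab : a <= x <= b.
  by have := xP 0%N; rewrite /= /A expr0 divr1 subrKC.
have ycd : c <= y <= d.
  by have := yP 0%N; rewrite /= /C expr0 divr1 subrKC.
have [t t0 tP] := I_small xab ycd e'0.
have [n nt] : exists n, L / 2 ^+ n < t.
  exists (Num.truncn (L / t)).+1; rewrite ltr_pdivrMr ?exprn_gt0// -ltr_pdivrMl//.
  rewrite mulrC; apply: lt_trans (truncnS_gt _) _.
  by rewrite -natrX ltr_nat ltn_expl.
have LE : A n + C n = L / 2 ^+ n by rewrite /A /C -mulrDl.
have [i1 i2 i3 i4] := s_inside n.
have /andP[x1 x2] := xP n; have /andP[y1 y2] := yP n.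
have A0 := A_ge0 n; have C0 := C_ge0 n.
have := tP (s n).1 ((s n).1 + A n) (s n).2 ((s n).2 + C n).
rewrite ![_ + _ - _]addrAC !subrr !add0r LE i1 i2 i3 i4 x1 x2 y1 y2 /=.
move=> /(_ isT isT isT isT _ _) h.
have {}h : J n (s n) <= e / (L ^+ 2 + 1) * (L / 2 ^+ n) ^+ 2.
  by apply: h; apply: le_lt_trans nt; rewrite -LE; lra.
apply: le_trans (Jn n) _.
apply: (@le_trans _ _ (4 ^+ n * (e / (L ^+ 2 + 1) * (L / 2 ^+ n) ^+ 2))).
  by rewrite ler_wpM2l// exprn_ge0.
(* The loss 4^n of n bisections is compensated exactly by the square of the size L / 2^n. *)
have -> : 4 ^+ n * (e / (L ^+ 2 + 1) * (L / 2 ^+ n) ^+ 2) = e * (L ^+ 2 / (L ^+ 2 + 1)).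
  have -> : (4 : R) ^+ n = 2 ^+ n * 2 ^+ n by rewrite -exprMn -natrM.
  by field; rewrite expf_neq0//= gt_eqF// ltr_wpDl// sqr_ge0.
by rewrite ger_pMr// ler_pdivrMr ?mul1r ?lerDl// ltr_wpDl// sqr_ge0.
Qed.

End bisection.

(** Written with real e and [normc] to match the smallness condition of the bisection; the
    derivative stays existential because only the affine approximation matters. *)
Definition complex_diff_at (R : realType) (f : R[i] -> R[i]) (z : R[i]) :=
  exists c : R[i], forall e : R, 0 < e -> exists2 t : R, 0 < t &
    forall x, normc (x - z) < t -> normc (f x - f z - c * (x - z)) <= e * normc (x - z).

(** * Cauchy's formula on a circle, by contraction to the point *)

Section cauchy.
Variables (R : realType) (f : R[i] -> R[i]) (r : R) (w : R[i]).
Local Notation C := R[i].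
Hypotheses (wr : normc w < r).
Hypothesis f_cont : forall z, normc z <= r -> {for z, continuous f}.
Hypothesis f_diff : forall z, normc z <= r -> complex_diff_at f z.

Let r0 : 0 < r. Proof. exact: le_lt_trans (normc_ge0 _) wr. Qed.

(* phi contracts the circle to w; with zeta = phi x y, d zeta / (zeta - w) = dx / x + i kap(y) dy. *)
Let phi (x y : R) : C := w + x%:C * (r%:C * cis y - w).
Let kap (y : R) : C := r%:C * cis y / (r%:C * cis y - w).
Let K := r / (r - normc w).

Let K0 : 0 < K. Proof. by rewrite divr_gt0// subr_gt0. Qed.

Let den_ge y : r - normc w <= normc (r%:C * cis y - w).
Proof.
have -> : r - normc w = normc (r%:C * cis y) - normc w.
  by rewrite normcM normc_cis normc_real mulr1 gtr0_norm.
by rewrite lerBlDr; apply: le_trans (le_normcD _ _); rewrite subrK.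
Qed.

Let den_neq0 y : r%:C * cis y - w != 0.
Proof.
apply/eqP => h; have := den_ge y; rewrite h normc0 leNgt subr_gt0 wr.
by [].
Qed.

Let kap_le y : normc (kap y) <= K.
Proof.
rewrite /kap normcM normcM normc_cis normc_real mulr1 gtr0_norm// normcV.
have h : 0 < normc (r%:C * cis y - w).
  by apply: (@lt_le_trans _ _ (r - normc w)); rewrite ?subr_gt0// den_ge.
rewrite ler_pM2l// lef_pV2 ?posrE ?subr_gt0//; exact: den_ge.
Qed.

Let kap_cont : continuous kap.
Proof.
move=> y; have c1 : {for y, continuous (fun y => r%:C * cis y)}.
  by apply: cvgM; [exact: cvg_cst|exact: continuous_cis].
have c2 : {for y, continuous (fun y => (r%:C * cis y - w)^-1)}.
  by apply: cvgV; [exact: den_neq0|apply: cvgB; [exact: c1|exact: cvg_cst]].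
exact: (cvgM c1 c2).
Qed.

Let phi_le (x y : R) : 0 <= x <= 1 -> normc (phi x y) <= r.
Proof.
move=> /andP[x0 x1].
have -> : phi x y = (1 - x)%:C * w + x%:C * (r%:C * cis y).
  by rewrite /phi rmorphB /= rmorph1; ring.
apply: le_trans (le_normcD _ _) _.
rewrite !normcM !normc_real normc_cis mulr1 (gtr0_norm r0) !ger0_norm ?subr_ge0//.
have := ler_wpM2l (_ : 0 <= 1 - x) (ltW wr); rewrite subr_ge0 => /(_ x1); lra.
Qed.

Let phi_contx y : continuous (fun x => phi x y).
Proof.
move=> x; apply: cvgD; first exact: cvg_cst.
apply: cvgM; last exact: cvg_cst.
by apply: cvg_complexE; [exact: cvg_id|exact: cvg_cst].
Qed.

Let phi_conty x : continuous (phi x).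
Proof.
move=> y; apply: cvgD; first exact: cvg_cst.
apply: cvgM; first exact: cvg_cst.
apply: cvgB; last exact: cvg_cst.
by apply: cvgM; [exact: cvg_cst|exact: continuous_cis].
Qed.

Let fphi_contx (a b y : R) : 0 <= a -> b <= 1 -> icontinuous a b (fun x => f (phi x y)).
Proof.
move=> a0 b1; apply: continuous_in_subspaceT => x /set_mem /=.
rewrite in_itv/= => /andP[ax xb].
apply: (@continuous_comp _ _ _ (fun x => phi x y) f); first exact: phi_contx.
by apply: f_cont; rewrite phi_le// (le_trans a0 ax) (le_trans xb b1).
Qed.

Let fphi_conty (a b x : R) : 0 <= x <= 1 -> icontinuous a b (fun y => f (phi x y)).
Proof.
move=> x01; apply: continuous_icontinuous => y.
apply: (@continuous_comp _ _ _ (phi x) f); first exact: phi_conty.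
by apply: f_cont; exact: phi_le.
Qed.

Let inv_cont (a b : R) : 0 < a -> icontinuous a b (fun x => x%:C^-1).
Proof.
move=> a0; apply: continuous_in_subspaceT => x /set_mem /=.
rewrite in_itv/= => /andP[ax xb]; apply: cvgV; last first.
  by apply: cvg_complexE; [exact: cvg_id|exact: cvg_cst].
by rewrite eq_complex /= eqxx andbT gt_eqF// (lt_le_trans a0).
Qed.

Let phi_dist (x y x' y' : R) : 0 <= x' <= 1 ->
  normc (phi x y - phi x' y') <= 2 * r * (`|x - x'| + `|y - y'|).
Proof.
move=> /andP[x0 x1].
have -> : phi x y - phi x' y' = (x - x')%:C * (r%:C * cis y - w) +
    x'%:C * (r%:C * (cis y - cis y')).
  by rewrite /phi rmorphB /=; ring.
apply: le_trans (le_normcD _ _) _.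
rewrite !normcM !normc_real (gtr0_norm r0) (ger0_norm x0) mulrDr.
apply: lerD.
  rewrite mulrC ler_wpM2r//; apply: le_trans (le_normcD _ _) _.
  rewrite normcM normc_real normc_cis mulr1 normcN (gtr0_norm r0).
  by rewrite mulr_natl mulr2n lerD2l ltW.
have h := normc_cisB y y'.
apply: (@le_trans _ _ (r * normc (cis y - cis y'))).
  by apply: ler_piMl => //; rewrite mulr_ge0 ?normc_ge0 ?(ltW r0).
by rewrite (mulrC 2) -mulrA ler_pM2l.
Qed.

Section closed_form.
Variable tau : R.
Hypothesis tau0 : 0 < tau.

(* The integral of g d zeta / (zeta - w) along the boundary of [a, b] x [c, d]; x >= tau > 0 keeps 1 / x finite. *)
Let I (g : R -> R -> C) (a b c d : R) : C :=
  itvint a b (fun x => (g x c - g x d) * x%:C^-1) +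
  itvint c d (fun y => (g b y - g a y) * ('i * kap y)).

Let good (g : R -> R -> C) := (forall a b y : R, tau <= a -> b <= 1 -> icontinuous a b (fun x => g x y)) /\
  (forall a b x : R, tau <= x <= 1 -> icontinuous a b (g x)).

Let good1 g (a b c d : R) : good g -> tau <= a -> b <= 1 ->
  icontinuous a b (fun x => (g x c - g x d) * x%:C^-1).
Proof.
move=> [gx _] ta b1; apply: icontinuousM; last by apply: inv_cont; exact: lt_le_trans ta.
by apply: icontinuousB; exact: gx.
Qed.

Let good2 g (a b c d : R) : good g -> tau <= a <= 1 -> tau <= b <= 1 ->
  icontinuous c d (fun y => (g b y - g a y) * ('i * kap y)).
Proof.
move=> [_ gy] ta tb; apply: icontinuousM.
  by apply: icontinuousB; exact: gy.
apply: continuous_icontinuous => y; apply: cvgM; [exact: cvg_cst|exact: kap_cont].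
Qed.

Let ID g h (a b c d : R) : good g -> good h -> tau <= a -> a <= b -> b <= 1 ->
  I (fun x y => g x y + h x y) a b c d = I g a b c d + I h a b c d.
Proof.
move=> gg gh ta ab b1; have a1 := le_trans ab b1; have tb := le_trans ta ab.
rewrite /I addrACA -!itvintD; [| | |exact: good1..].
- by congr (_ + _); apply: eq_itvint => x _; ring.
- by apply: good2; rewrite ?ta ?tb.
- by apply: good2; rewrite ?ta ?tb.
Qed.

(** Opposite sides are paired in [I], so [al] cancels; in the linear part the factors 1 / x and
    [kap] simplify, and the two remaining integrals are explicit and opposite. This replaces a
    primitive in Goursat's argument. *)
Let I_affine al be (a b c d : R) : tau <= a -> a <= b -> c <= d ->
  I (fun x y => al + be * (x%:C * (r%:C * cis y - w))) a b c d = 0.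
Proof.
move=> ta ab cd; rewrite /I.
have xn0 (x : R) : a <= x <= b -> x%:C != 0 :> C.
  move=> /andP[ax _]; rewrite eq_complex /= eqxx andbT gt_eqF//.
  exact: lt_le_trans tau0 (le_trans ta ax).
rewrite (eq_itvint (g := fun=> be * r%:C * (cis c - cis d))); last first.
  by move=> x xab; field; exact: xn0.
rewrite itvint_cst//.
rewrite [X in _ + X](eq_itvint (g := fun y => be * (b - a)%:C * r%:C * ('i * 1%:C * cis (1 * y)))).
  rewrite itvintZ; last first.
    apply: continuous_icontinuous => y.
    by apply: cvgM; [exact: cvg_cst|exact: continuous_cisM].
  rewrite itvint_cis; last exact: cd.
  by rewrite !mul1r rmorphB /=; ring.
move=> y _; rewrite /kap mul1r rmorphB /= rmorph1; field.
exact: den_neq0.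
Qed.

(** The factor 4 is 2 for a difference of two values of g times 2 from [itvint_bound]; 1 / tau
    bounds 1 / x and K bounds [kap]. *)
Let I_bound g (a b c d M : R) : good g -> tau <= a -> a <= b -> b <= 1 -> c <= d ->
  (forall x y : R, a <= x <= b -> c <= y <= d -> normc (g x y) <= M) ->
  normc (I g a b c d) <= 4 * M * (tau^-1 + K) * ((b - a) + (d - c)).
Proof.
move=> gg ta ab b1 cd gM; have a1 := le_trans ab b1; have tb := le_trans ta ab.
have M0 : 0 <= M by apply: le_trans (gM a c _ _); rewrite ?normc_ge0 ?lexx.
have gB (x y x' y' : R) : a <= x <= b -> c <= y <= d -> a <= x' <= b -> c <= y' <= d ->
    normc (g x y - g x' y') <= 2 * M.
  move=> h1 h2 h3 h4; apply: le_trans (le_normcD _ _) _.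
  by rewrite normcN mulr_natl mulr2n lerD// gM.
have ti0 : 0 <= tau^-1 by rewrite invr_ge0 ltW.
have i1 : normc (itvint a b (fun x => (g x c - g x d) * x%:C^-1)) <=
    2 * (2 * M * tau^-1 * (b - a)).
  apply: itvint_bound; [exact: ab|exact: good1|].
  move=> x /andP[ax xb]; rewrite normcM normcV normc_real.
  apply: ler_pM; rewrite ?normc_ge0 ?invr_ge0//.
    by apply: gB; rewrite ?ax ?xb ?lexx ?cd.
  have tx := le_trans ta ax; have x0 := lt_le_trans tau0 tx.
  by rewrite gtr0_norm// lef_pV2.
have i2 : normc (itvint c d (fun y => (g b y - g a y) * ('i * kap y))) <=
    2 * (2 * M * K * (d - c)).
  apply: itvint_bound; [exact: cd|by apply: good2; rewrite ?ta ?tb|].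
  move=> y ycd; rewrite 2!normcM.
  apply: ler_pM; rewrite ?normc_ge0 ?mulr_ge0 ?normc_ge0//.
    by apply: gB; rewrite ?lexx ?ab.
  have -> : normc 'i = 1 :> R by rewrite /= !expr2 mulr0 mulr1 add0r sqrtr1.
  by rewrite mul1r.
apply: le_trans (le_normcD _ _) _; apply: le_trans (lerD i1 i2) _.
have h1 : 0 <= M * tau^-1 * (d - c) by rewrite !mulr_ge0 ?subr_ge0.
have h2 : 0 <= M * K * (b - a) by apply: mulr_ge0; [exact: mulr_ge0 M0 (ltW K0)|rewrite subr_ge0].
rewrite -subr_ge0.
have -> : 4 * M * (tau^-1 + K) * (b - a + (d - c)) -
  (2 * (2 * M / tau * (b - a)) + 2 * (2 * M * K * (d - c))) =
  4 * (M * tau^-1 * (d - c)) + 4 * (M * K * (b - a)) by ring.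
exact: addr_ge0 (mulr_ge0 (ler0n _ 4) h1) (mulr_ge0 (ler0n _ 4) h2).
Qed.

Let F x y := f (phi x y).

Let goodF : good F.
Proof.
split => [a b y ta b1|a b x /andP[tx x1]].
  by apply: fphi_contx => //; exact: le_trans (ltW tau0) ta.
by apply: fphi_conty; rewrite x1 andbT (le_trans (ltW tau0)).
Qed.

(** Near each point F is affine in [phi] up to an error small compared with the size of the
    rectangle. The affine part contributes 0 and the error is integrated over sides of that size,
    whence the quadratic estimate. *)
Let I_eq0 : tau <= 1 -> I F tau 1 0 (2 * pi) = 0.
Proof.
move=> tau1; have pi2 : 0 <= 2 * pi :> R by rewrite mulr_ge0// pi_ge0.
apply: rectangle_bisection => //.
- move=> a' m b' c' d' h1 h2 h3 h4 h5 h6 h7.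
  have tm := le_trans h1 h2; have m1 := le_trans h3 h4.
  have a1 := le_trans h2 m1; have tb := le_trans tm h3.
  rewrite /I (itvint_cat h2 h3); last exact: good1.
  rewrite [RHS]addrACA; congr (_ + _).
  rewrite -itvintD; [|by apply: good2 => //; rewrite ?h1 ?tm ?m1 ?tb ?a1..].
  by apply: eq_itvint => y _; ring.
- move=> a' b' c' m d' h1 h2 h3 h4 h5 h6 h7.
  have tb := le_trans h1 h2; have a1 := le_trans h2 h3.
  rewrite /I (itvint_cat h5 h6); last by apply: good2; rewrite ?h1 ?tb ?a1.
  rewrite [RHS]addrACA; congr (_ + _).
  rewrite -itvintD; [|exact: good1..].
  by apply: eq_itvint => y _; ring.
move=> x0 y0 /andP[tx0 x01] y0P e e0.
have x0P : 0 <= x0 <= 1 by rewrite x01 andbT (le_trans (ltW tau0)).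
set z0 := phi x0 y0.
have [f1 f1P] := f_diff (phi_le y0 x0P).
(* S is the product of the constants 4 (1 / tau + K) of [I_bound] and 2 r of [phi_dist]. *)
set S := 8 * r * (tau^-1 + K).
have S0 : 0 < S by rewrite !mulr_gt0// addr_gt0// invr_gt0.
have [t t0 tP] := f1P (e / S) (divr_gt0 e0 S0).
(* With both sides below t / (4 r), [phi_dist] keeps the values of [phi] within 2 r (t / (4 r) + t /
   (4 r)) = t of z0. *)
exists (t / (4 * r)); first by rewrite divr_gt0// mulr_gt0.
move=> a b c d /andP[ta ax0] /andP[x0b b1] /andP[c0 cy0] /andP[y0d d2] bt dt.
have ab := le_trans ax0 x0b; have cd := le_trans cy0 y0d.
(* Chosen so that A is the first-order expansion of f at z0, rewritten around w as [I_affine]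
   requires. *)
pose al := f z0 - f1 * (z0 - w).
pose A x y := al + f1 * (x%:C * (r%:C * cis y - w)).
pose E x y := F x y - A x y.
have Acont : good A.
  split => [a' b' y _ _|a' b' x _]; apply: continuous_icontinuous => u;
    apply: cvgD; try exact: cvg_cst; apply: cvgM; try exact: cvg_cst;
    apply: cvgM; try exact: cvg_cst.
    by apply: cvg_complexE; [exact: cvg_id|exact: cvg_cst].
  apply: cvgB; last exact: cvg_cst.
  by apply: cvgM; [exact: cvg_cst|exact: continuous_cis].
have goodE : good E.
  split => [a' b' y h1 h2|a' b' x h]; apply: icontinuousB.
  - exact: goodF.1.
  - exact: Acont.1.
  - exact: goodF.2.
  - exact: Acont.2.
have -> : I F a b c d = I E a b c d.
  have -> : F = (fun x y => E x y + A x y).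
    by apply/funext => u; apply/funext => v; rewrite /E subrK.
  by rewrite (ID c d goodE Acont ta ab b1) (I_affine al f1 ta ab cd) addr0.
apply: le_trans (I_bound (M := e / S * (2 * r * ((b - a) + (d - c)))) goodE ta ab b1 cd _) _.
  move=> x y /andP[ax xb] /andP[cy yd].
  have -> : E x y = f (phi x y) - f z0 - f1 * (phi x y - z0).
    by rewrite /E /F /A /al /phi; ring.
  have h : normc (phi x y - z0) <= 2 * r * (b - a + (d - c)).
    apply: le_trans (phi_dist x y y0 x0P) _; rewrite ler_wpM2l ?mulr_ge0 ?(ltW r0)//.
    by apply: lerD; rewrite ler_norml; apply/andP; split; lra.
  apply: le_trans (tP _ _) _.
    apply: le_lt_trans h _.
    have -> : t = 2 * r * (t / (4 * r) + t / (4 * r)) by field; rewrite gt_eqF.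
    by rewrite ltr_pM2l ?mulr_gt0// ltrD.
  by rewrite ler_wpM2l// ltW// divr_gt0.
rewrite le_eqVlt; apply/orP; left; apply/eqP.
rewrite /S; field; rewrite !gt_eqF//=.
by apply: ltr_wpDr; [exact: mulr_ge0 (ltW K0) (ltW tau0)|exact: ltr01].
Qed.

(** The sides y = 0 and y = 2 pi carry the same values and cancel; the sides x = 1 and x = tau are
    the circle and its contraction towards w. *)
Lemma circle_contract : tau <= 1 ->
  itvint 0 (2 * pi) (fun y => (f (r%:C * cis y) - f (phi tau y)) * kap y) = 0.
Proof.
move=> tau1; have := I_eq0 tau1; rewrite /I.
rewrite (eq_itvint (g := fun=> 0)); last first.
  by move=> x _; rewrite /F /phi cis0 cis2pi subrr mul0r.
rewrite itvint_cst// mulr0 add0r.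
rewrite (eq_itvint (g := fun y => 'i * ((f (r%:C * cis y) - f (phi tau y)) * kap y))).
  rewrite itvintZ; last first.
    apply: icontinuousM; last by apply: continuous_icontinuous; exact: kap_cont.
    apply: icontinuousB; last by apply: fphi_conty; rewrite tau1 ltW.
    have -> : (fun y => f (r%:C * cis y)) = (fun y => f (phi 1 y)).
      by apply/funext => y; rewrite /phi mul1r addrC subrK.
    by apply: fphi_conty; rewrite ler01 lexx.
  move/eqP; rewrite mulf_eq0 => /orP[|/eqP//].
  by rewrite eq_complex /= oner_eq0 andbF.
by move=> y _; rewrite /F /phi mul1r (addrC w) subrK; ring.
Qed.

End closed_form.

(** As tau tends to 0 the contracted curve shrinks to w, where f is continuous. Keeping f(w)
    subtracted spares the computation of the integral of [kap]. *)
Lemma cauchy_integral :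
  itvint 0 (2 * pi) (fun y => (f (r%:C * cis y) - f w) * kap y) = 0.
Proof.
have pi0 : 0 <= 2 * pi :> R by rewrite mulr_ge0// pi_ge0.
apply: eq0_normc; apply/eqP; rewrite eq_le normc_ge0 andbT.
apply/ler_addgt0Pl => e e0; rewrite addr0.
(* 4 pi K is the factor 2 of [itvint_bound] times the length 2 pi and the bound K; adding 1 makes
   the final inequality a comparison with e. *)
have D0 : 0 < 4 * pi * K + 1 
  by apply: ltr_wpDl; [exact: mulr_ge0 (mulr_ge0 (ler0n _ 4) (pi_ge0 _)) (ltW K0)|exact: ltr01].
have e'0 : 0 < e / (4 * pi * K + 1) by rewrite divr_gt0.
have /cvg_complexP := f_cont (ltW wr) => /(_ _ e'0).
move=> /nbhs_ballP[d d0 dP].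
have [t t0 dt] := gt0_complexP d0.
(* The contracted curve stays within 2 r tau of w, and this is at most t / 2. *)
pose tau := Num.min 1 (t / (4 * r)).
have tau0 : 0 < tau by rewrite lt_min ltr01 divr_gt0// mulr_gt0.
have tau1 : tau <= 1 by rewrite ge_min lexx.
have fcirc : icontinuous 0 (2 * pi) (fun y => f (r%:C * cis y)).
  have -> : (fun y => f (r%:C * cis y)) = (fun y => f (phi 1 y)).
    by apply/funext => y; rewrite /phi mul1r addrC subrK.
  by apply: fphi_conty; rewrite ler01 lexx.
have ftau : icontinuous 0 (2 * pi) (fun y => f (phi tau y)).
  by apply: fphi_conty; rewrite tau1 ltW.
have kc : icontinuous 0 (2 * pi) kap by apply: continuous_icontinuous; exact: kap_cont.
have -> : itvint 0 (2 * pi) (fun y => (f (r%:C * cis y) - f w) * kap y) =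
    itvint 0 (2 * pi) (fun y => (f (phi tau y) - f w) * kap y).
  rewrite -[RHS]add0r -(circle_contract tau0 tau1) -itvintD.
  - by apply: eq_itvint => y _; ring.
  - by apply: icontinuousM; [apply: icontinuousB; [exact: fcirc|exact: ftau]|exact: kc].
  - by apply: icontinuousM; [apply: icontinuousB; [exact: ftau|exact: icontinuous_cst]|exact: kc].
have : normc (itvint 0 (2 * pi) (fun y => (f (phi tau y) - f w) * kap y)) <=
    2 * (e / (4 * pi * K + 1) * K * (2 * pi - 0)).
  apply: itvint_bound; first exact: pi0.
    by apply: icontinuousM; [apply: icontinuousB; [exact: ftau|exact: icontinuous_cst]|exact: kc].
  move=> y _; rewrite normcM; apply: ler_pM; rewrite ?normc_ge0//.
  apply/ltW/dP; rewrite -ball_normE /= dt normrcE ltcR normcB.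
  rewrite /phi addrC addKr normcM normc_real gtr0_norm//.
  apply: (@le_lt_trans _ _ (tau * (2 * r))).
    rewrite ler_wpM2l ?(ltW tau0)//; apply: le_trans (le_normcD _ _) _.
    rewrite normcM normc_real normc_cis normcN mulr1 gtr0_norm//.
    by rewrite mulr_natl mulr2n lerD2l ltW.
  have : tau <= t / (4 * r) by rewrite ge_min lexx orbT.
  rewrite ler_pdivlMr ?mulr_gt0//; have := mulr_gt0 tau0 r0; lra.
move=> /le_trans; apply.
have aux (k : R) : 0 < 4 * pi * k + 1 ->
    2 * (e / (4 * pi * k + 1) * k * (2 * pi - 0)) <= e.
  move=> k0; have -> : 2 * (e / (4 * pi * k + 1) * k * (2 * pi - 0)) =
      e * ((4 * pi * k) / (4 * pi * k + 1)) by move: (4 * pi * k + 1)^-1 => v; ring.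
  by rewrite ger_pMr// ler_pdivrMr ?mul1r ?lerDl.
exact: aux.
Qed.

End cauchy.

(** * Compactness and uniform continuity on closed polydiscs *)

Section polydisc_topology.
Variables (R : realType) (n : nat).
Local Notation C := R[i].
Implicit Types (z : 'rV[C]_n) (F : 'rV[C]_n -> C).

Definition cpolydisc (r : R) : set 'rV[C]_n := [set z | forall i, normc (z 0 i) <= r].

Lemma nbhs_rVP z (U : set 'rV[C]_n) : nbhs z U <-> exists2 t : R, 0 < t &
  forall y : 'rV[C]_n, (forall i, normc (y 0 i - z 0 i) < t) -> U y.
Proof.
split=> [/nbhs_ballP[d d0 dU]|[t t0 tU]].
  have [t t0 dt] := gt0_complexP d0; exists t => // y yz; apply: dU.
  split=> // i j; rewrite -ball_normE /= dt normrcE ltcR normcB.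
  by rewrite (ord1 i).
apply/nbhs_ballP; exists t%:C; first by rewrite /= ltcR.
move=> y [_ yz]; apply: tU => i; have := yz 0 i.
by rewrite -ball_normE /= normrcE ltcR normcB.
Qed.

Lemma cvg_normc (T : Type) (F : set_system T) (FF : Filter F) (f : T -> C) (z : C) :
  f @ F --> z -> (fun t => normc (f t)) @ F --> normc z.
Proof.
move=> /cvg_complexP fz; apply/cvgrPdist_lt => e /fz; apply: filterS => t.
apply: le_lt_trans; rewrite ler_norml; apply/andP; split.
  by rewrite lerNl opprB lerBlDl; apply: le_trans (le_normcD _ _); rewrite subrKC.
by rewrite normcB lerBlDl; apply: le_trans (le_normcD _ _); rewrite subrKC.
Qed.

Lemma continuous_normc : continuous (@normc R).
Proof. by move=> z; exact: (@cvg_normc C (nbhs z) (nbhs_filter z) id z cvg_id). Qed.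

(** The disc is a closed part of the continuous image of the compact square [-r, r]^2. *)
Lemma compact_cdisc (r : R) : compact [set z : C | normc z <= r].
Proof.
pose g (u : 'rV[R]_2) : C := u 0 0 +i* u 0 1.
have gc : continuous g.
  move=> u; exact: (@cvg_complexE R _ (nbhs u) (nbhs_filter u) _ _ _ _
    (@coord_continuous _ _ _ 0 0 u) (@coord_continuous _ _ _ 0 1 u)).
have cK : compact [set u : 'rV[R]_2 | forall i, u 0 i \in `[(- r), r]].
  by apply: (@rV_compact _ 2 (fun=> `[(- r), r]%classic)) => i; exact: segment_compact.
have := continuous_compact (continuous_subspaceT gc) cK.
move=> /(compact_closedI)/(_ (closed_comp (fun _ _ => @continuous_normc _) (@closed_le R r))).
congr compact; apply/seteqP; split => [z /= [_]//|z /= zr]; split => //.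
have h (x : R) : `|x| <= normc z -> x \in `[(- r), r].
  by move=> /le_trans /(_ zr); rewrite ler_norml in_itv.
exists (\row_(k < 2) if k == 0 then complex.Re z else complex.Im z).
  by move=> k; rewrite mxE; case: ifP => _; apply: h; rewrite ?Re_le_normc ?Im_le_normc.
by rewrite /g !mxE /=; case: (z).
Qed.

Lemma compact_cpolydisc r : compact (cpolydisc r).
Proof. by apply: (@rV_compact _ n (fun=> [set z : C | normc z <= r])) => i; exact: compact_cdisc. Qed.

(** Heine-Cantor: the near-covering form of compactness supplies one t valid for all centres at
    once. *)
Lemma cpolydisc_unif_continuous F r :
  (forall z, cpolydisc r z -> {for z, continuous F}) ->
  forall e : R, 0 < e -> exists2 t : R, 0 < t & forall z z' : 'rV[C]_n, cpolydisc r z ->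
    cpolydisc r z' -> (forall i, normc (z' 0 i - z 0 i) < t) -> normc (F z' - F z) < e.
Proof.
move=> Fc e e0.
have /compact_near_coveringP cK := @compact_cpolydisc r.
have := cK R (at_right (0:R)) (fun t z => forall z' : 'rV[C]_n, (forall i, normc (z' 0 i - z 0 i) < t) ->
  normc (F z' - F z) < e) _ _.
have : forall z, cpolydisc r z -> \forall z' \near z & t \near (at_right (0 : R)),
    forall z'' : 'rV[C]_n, (forall i, normc (z'' 0 i - (z' : 'rV[C]_n) 0 i) < t) -> normc (F z'' - F z') < e.
  move=> z Kz; have /cvg_complexP/(_ (e / 2)) := Fc z Kz.
  rewrite divr_gt0// => /(_ isT) /nbhs_rVP[t t0 tF].
  exists ([set z' : 'rV[C]_n | forall i, normc (z' 0 i - z 0 i) < t / 2], [set s | s < t / 2]).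
    split; first by apply/nbhs_rVP; exists (t / 2); rewrite ?divr_gt0.
    by apply: nbhs_right_lt; rewrite divr_gt0.
  move=> [z' s] [/= zz' st] z'' z'z''.
  have -> : F z'' - F z' = (F z'' - F z) - (F z' - F z) by ring.
  apply: le_lt_trans (le_normcD _ _) _; rewrite normcN (splitr e) ltrD//; apply: tF => i.
    have -> : z'' 0 i - z 0 i = (z'' 0 i - z' 0 i) + (z' 0 i - z 0 i) by ring.
    apply: le_lt_trans (le_normcD _ _) _; rewrite (splitr t) ltrD//.
    exact: lt_trans (z'z'' i) st.
  by apply: lt_trans (zz' i) _; rewrite ltr_pdivrMr// ltr_pMr// ltr1n.
move=> h /(_ _ h) [t /= t0 tP].
exists (t / 2) => [|z z' Kz Kz' zz']; first by rewrite divr_gt0.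
apply: (tP (t / 2) _ _ z Kz) => //=; last by rewrite divr_gt0.
rewrite sub0r normrN gtr0_norm ?divr_gt0//.
by rewrite ltr_pdivrMr// ltr_pMr// ltr1n.
Qed.

Lemma cpolydisc_bounded F r :
  (forall z, cpolydisc r z -> {for z, continuous F}) ->
  exists2 M : R, 0 <= M & forall z, cpolydisc r z -> normc (F z) <= M.
Proof.
move=> Fc; case: (pselect (cpolydisc r !=set0)) => [K0|K0]; last first.
  by exists 0 => // z Kz; exfalso; apply: K0; exists z.
have Fc' : {within cpolydisc r, continuous (fun z => normc (F z))}.
  apply: continuous_in_subspaceT => z /set_mem Kz.
  by apply: (@continuous_comp _ _ _ F (@normc R)); [exact: Fc|exact: continuous_normc].
have [c _ cM] := compact_EVT_max K0 (@compact_cpolydisc r) Fc'.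
exists (normc (F c)); first exact: normc_ge0.
by move=> z Kz; apply: cM; exact: mem_set.
Qed.

End polydisc_topology.

(** * Cauchy's formula with a truncated geometric series *)

Section truncated_cauchy.
Variables (R : realType) (f : R[i] -> R[i]) (r rho M : R) (w : R[i]) (N : nat).
Local Notation C := R[i].
Hypotheses (rho0 : 0 <= rho) (rhor : rho < r) (wrho : normc w <= rho) (N0 : (0 < N)%N).
Hypothesis f_cont : forall z, normc z <= r -> {for z, continuous f}.
Hypothesis f_diff : forall z, normc z <= r -> complex_diff_at f z.
Hypothesis f_bound : forall z, normc z <= r -> normc (f z) <= M.

(** The first N terms of zeta / (zeta - w) = sum_k (w / zeta)^k for zeta = r [cis y] and u = w / r.
    In each term w and y are separated, which makes the approximation polynomial in w. *)
Definition geom_kernel (u : C) (y : R) : C := \sum_(k < N) u ^+ k * cis (- k%:R * y).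

Lemma continuous_geom_kernel u : continuous (geom_kernel u).
Proof.
rewrite /geom_kernel; elim: (index_enum _) => [|k s ih] y; rewrite /continuous_at.
  by under eq_fun do rewrite big_nil; rewrite big_nil; exact: cvg_cst.
under eq_fun do rewrite big_cons; rewrite big_cons.
apply: cvgD; last exact: ih.
by apply: cvgM; [exact: cvg_cst|exact: continuous_cisM].
Qed.

Lemma itvint_geom_kernel u : itvint 0 (2 * pi) (geom_kernel u) = (2 * pi)%:C.
Proof.
rewrite /itvint /geom_kernel cintegral_sum//; last first.
  move=> k; apply: icontinuous_integrable; apply: continuous_icontinuous => y.
  by apply: cvgM; [exact: cvg_cst|exact: continuous_cisM].
rewrite (bigD1 (Ordinal N0))//= big1 ?addr0.
  rewrite -[LHS]/(itvint _ _ _) (eq_itvint (g := fun y => cis (0%:~R * y))).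
    by rewrite itvint_cis_period.
  by move=> y _; rewrite expr0 mul1r oppr0.
move=> k k0; rewrite -[LHS]/(itvint _ _ _).
rewrite (eq_itvint (g := fun y => u ^+ k * cis ((- k%:Z)%:~R * y))); last first.
  by move=> y _; rewrite rmorphN.
rewrite itvintZ; last by apply: continuous_icontinuous; exact: continuous_cisM.
rewrite itvint_cis_period oppr_eq0; have -> : (k%:Z == 0) = false.
  by apply/negbTE; apply: contra k0 => /eqP[k0]; apply/eqP/val_inj.
by rewrite mulr0.
Qed.

Lemma normc_geom_kernel u y : normc u <= 1 -> normc (geom_kernel u y) <= N%:R.
Proof.
move=> u1; apply: le_trans (normc_sum _ _ _) _.
rewrite -[X in _ <= X%:R]card_ord -sum1_card natr_sum; apply: ler_sum => k _.
by rewrite normcM normc_cis mulr1 normcX exprn_ile1 ?normc_ge0.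
Qed.

Let r0 : 0 < r. Proof. exact: le_lt_trans rhor. Qed.

Lemma continuous_circle : continuous (fun y => f (r%:C * cis y)).
Proof.
move=> y; apply: (@continuous_comp _ _ _ (fun y => r%:C * cis y) f).
  by apply: cvgM; [exact: cvg_cst|exact: continuous_cis].
by apply: f_cont; rewrite normcM normc_cis normc_real mulr1 gtr0_norm.
Qed.

(** The truncated kernel has integral 2 pi, since only k = 0 survives, so the error is the integral
    of f(zeta) - f(w) against the kernel; by Cauchy's formula that is minus its integral against the
    geometric tail. The constant 8 pi M is 2 (from [itvint_bound]) times 2 M times 2 pi. *)
Lemma truncated_cauchy :
  normc ((2 * pi)%:C * f w -
    itvint 0 (2 * pi) (fun y => f (r%:C * cis y) * geom_kernel (w / r%:C) y)) <=
  8 * pi * M * (rho / r) ^+ N / (1 - rho / r).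
Proof.
have wr : normc w < r by exact: le_lt_trans wrho rhor.
have pi0 : 0 <= 2 * pi :> R by rewrite mulr_ge0// pi_ge0.
have rC0 : r%:C != 0 :> C by rewrite eq_complex /= eqxx andbT gt_eqF.
have cisn0 y : cis y != 0 :> C.
  by apply/eqP => h; have := normc_cis y; rewrite h normc0 => /eqP; rewrite eq_sym oner_eq0.
have q1 : rho / r < 1 by rewrite ltr_pdivrMr ?mul1r.
have M0 : 0 <= M.
  by apply: le_trans (f_bound (_ : normc 0 <= r)); rewrite ?normc_ge0 ?normc0 ?ltW.
set u := w / r%:C.
have un : normc u <= rho / r.
  by rewrite /u normcM normcV normc_real gtr0_norm// ler_pM2r ?invr_gt0.
pose v y := u * cis (- y).
have vn y : normc (v y) <= rho / r by rewrite normcM normc_cis mulr1.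
have v1 y : 1 - v y != 0.
  apply/eqP => h; have := vn y.
  have -> : v y = 1 by apply/eqP; rewrite eq_sym -subr_eq0 h.
  by rewrite normc1 leNgt q1.
have cisNV y : cis (- y) * cis y = 1 :> C by rewrite -cisD addNr cis0.
have kE y : r%:C * cis y / (r%:C * cis y - w) = (1 - v y)^-1.
  have -> : r%:C * cis y - w = r%:C * cis y * (1 - v y).
    rewrite mulrBr mulr1 /v; congr (_ - _).
    have -> : r%:C * cis y * (u * cis (- y)) = (r%:C * u) * (cis (- y) * cis y) by ring.
    by rewrite cisNV mulr1 /u mulrC divfK.
  by rewrite invfM mulrA divff ?mul1r// mulf_neq0.
have gE y : geom_kernel u y = (1 - v y ^+ N) / (1 - v y).
  apply: (mulIf (v1 y)); rewrite divfK// mulrC.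
  have h := subrXX (1 : C) (v y) N; rewrite expr1n in h; rewrite h.
  congr (_ * _); apply: eq_bigr => k _.
  rewrite expr1n mul1r.
  apply: (@etrans _ _ (u ^+ k * cis (- y) ^+ k)); last exact/esym/exprMn.
  by rewrite cisX mulrN mulNr.
have vc : continuous v.
  move=> y; apply: cvgM; first exact: cvg_cst.
  by have := @continuous_cisM R (-1) y; rewrite /continuous_at mulN1r;
    under eq_fun do rewrite mulN1r.
have rc : continuous (fun y => v y ^+ N / (1 - v y)).
  have vk (k : nat) : continuous (fun y => v y ^+ k).
    elim: k => [|k ih] y; first exact: cvg_cst.
    have -> : (fun y => v y ^+ k.+1) = (fun y => v y * v y ^+ k).
      by apply/funext => x; rewrite exprS.
    exact: (cvgM (vc y) (ih y)).
  move=> y; apply: cvgM; first exact: vk.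
  by apply: cvgV; [exact: v1|apply: cvgB; [exact: cvg_cst|exact: vc]].
have dc : continuous (fun y => f (r%:C * cis y) - f w).
  by move=> y; apply: cvgB; [exact: continuous_circle|exact: cvg_cst].
have c1 : icontinuous 0 (2 * pi) (fun y => (f (r%:C * cis y) - f w) * geom_kernel u y).
  by apply: icontinuousM; apply: continuous_icontinuous; [exact: dc|exact: continuous_geom_kernel].
have c2 : icontinuous 0 (2 * pi) (fun y => (f (r%:C * cis y) - f w) * (v y ^+ N / (1 - v y))).
  by apply: icontinuousM; apply: continuous_icontinuous; [exact: dc|exact: rc].
have c3 : icontinuous 0 (2 * pi) (fun y => f (r%:C * cis y) * geom_kernel u y).
  by apply: icontinuousM; apply: continuous_icontinuous; [exact: continuous_circle|exact: continuous_geom_kernel].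
have e1 : itvint 0 (2 * pi) (fun y => (f (r%:C * cis y) - f w) * geom_kernel u y) =
    itvint 0 (2 * pi) (fun y => f (r%:C * cis y) * geom_kernel u y) - (2 * pi)%:C * f w.
  rewrite -(itvint_geom_kernel u) [X in _ - X]mulrC -itvintZ; last first.
    by apply: continuous_icontinuous; exact: continuous_geom_kernel.
  rewrite -itvintB; [|exact: c3|].
    by apply: eq_itvint => y _; rewrite mulrBl.
  apply: icontinuousM; first exact: icontinuous_cst.
  by apply: continuous_icontinuous; exact: continuous_geom_kernel.
(* The full kernel is the truncated one plus the tail v^N / (1 - v), so the two integrals add up to
   that of Cauchy's formula. *)
have e2 : itvint 0 (2 * pi) (fun y => (f (r%:C * cis y) - f w) * geom_kernel u y) +
    itvint 0 (2 * pi) (fun y => (f (r%:C * cis y) - f w) * (v y ^+ N / (1 - v y))) = 0.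
  rewrite -(cauchy_integral wr f_cont f_diff) -itvintD; [|exact: c1|exact: c2].
  apply: eq_itvint => y _; rewrite kE gE -mulrDr; congr (_ * _).
  by rewrite -mulrDl subrK mul1r.
rewrite -opprB -e1 normcN.
have -> : itvint 0 (2 * pi) (fun y => (f (r%:C * cis y) - f w) * geom_kernel u y) =
   - itvint 0 (2 * pi) (fun y => (f (r%:C * cis y) - f w) * (v y ^+ N / (1 - v y))).
  by apply/eqP; rewrite -addr_eq0 e2.
rewrite normcN.
have -> : 8 * pi * M * (rho / r) ^+ N / (1 - rho / r) =
  2 * (2 * M * ((rho / r) ^+ N / (1 - rho / r)) * (2 * pi - 0)) :> R.
  by move: (1 - rho / r)^-1 => t; ring.
apply: itvint_bound; [exact: pi0|exact: c2|move=> y _].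
rewrite normcM; apply: ler_pM; rewrite ?normc_ge0//.
  apply: le_trans (le_normcD _ _) _; rewrite normcN mulr_natl mulr2n lerD// f_bound//.
    by rewrite normcM normc_cis normc_real mulr1 gtr0_norm.
  exact: ltW.
rewrite normcM normcX normcV; apply: ler_pM; rewrite ?exprn_ge0 ?normc_ge0 ?invr_ge0 ?normc_ge0//.
  by rewrite lerXn2r// ?nnegrE ?normc_ge0 ?divr_ge0 ?(ltW r0).
have h : 1 - rho / r <= normc (1 - v y).
  rewrite lerBlDr; have := le_normcD (1 - v y) (v y); rewrite subrK normc1.
  by move/le_trans; apply; rewrite lerD2l.
by rewrite lef_pV2 ?posrE// ?subr_gt0//; apply: lt_le_trans h; rewrite subr_gt0.
Qed.

End truncated_cauchy.

(** * Polynomial approximation on polydiscs *)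

Section runge.
Variables (R : realType) (n : nat).
Local Notation C := R[i].
Implicit Types (z : 'rV[C]_n) (j : 'I_n).

Definition set_coord z j (x : C) : 'rV[C]_n := \row_k (if k == j then x else z 0 k).

Lemma set_coord_id z j : set_coord z j (z 0 j) = z.
Proof. by apply/rowP => k; rewrite mxE; case: eqP => [->|]. Qed.

Lemma cpolydisc_set_coord r z j x :
  cpolydisc r z -> normc x <= r -> cpolydisc r (set_coord z j x).
Proof. by move=> zr xr k; rewrite mxE; case: ifP. Qed.

Variables (F : 'rV[C]_n -> C) (r : R).
Hypothesis r0 : 0 < r.
Hypothesis F_cont : forall z, cpolydisc r z -> {for z, continuous F}.
Hypothesis F_diff : forall z j, cpolydisc r z ->
  complex_diff_at (fun x => F (set_coord z j x)) (z 0 j).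

Let slice_cont z j x : cpolydisc r z -> normc x <= r ->
  {for x, continuous (fun x => F (set_coord z j x))}.
Proof.
move=> zr xr; apply/(@cvg_complexP R C (nbhs x) (nbhs_filter x)) => e e0.
have /cvg_complexP/(_ _ e0)/nbhs_rVP[t t0 tF] := F_cont (cpolydisc_set_coord j zr xr).
have := (@cvg_complexP R C (nbhs x) (nbhs_filter x) id x).1 cvg_id t t0.
apply: filterS => y /= yx; apply: tF => k; rewrite !mxE.
by case: ifP => _ //; rewrite subrr normc0.
Qed.

Let slice_diff z j x : cpolydisc r z -> normc x <= r ->
  complex_diff_at (fun x => F (set_coord z j x)) x.
Proof.
move=> zr xr; have := F_diff j (cpolydisc_set_coord j zr xr).
rewrite !mxE eqxx; congr complex_diff_at; apply/funext => y; congr F.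
by apply/rowP => k; rewrite !mxE; case: eqP.
Qed.

Let itvint_arcs (h : R) (L : nat) (g : R -> C) : 0 <= h -> continuous g ->
  itvint 0 (L%:R * h) g = \sum_(l < L) itvint (l%:R * h) (l.+1%:R * h) g.
Proof.
move=> h0 gc; elim: L => [|L ih].
  rewrite big_ord0 mul0r /itvint /cintegral /Rintegral !set_itv1.
  by rewrite !integral_set1.
rewrite big_ord_recr /= -ih; apply: itvint_cat.
- by rewrite mulr_ge0.
- by rewrite ler_wpM2r// ler_nat.
- exact: continuous_icontinuous.
Qed.

(* The Cauchy integral over the circle is cut into arcs on which F is almost constant in the j-th variable,
   uniformly in the others; s lists the (coefficient, exponent, sample point) triples. *)
Lemma one_variable_step (rho : R) j : 0 <= rho -> rho < r ->
  forall e : R, 0 < e -> exists s : seq (C * nat * C),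
    (forall x, x \in s -> normc x.2 <= r) /\
    forall z, cpolydisc r z -> normc (z 0 j) <= rho ->
      normc (F z - \sum_(x <- s) x.1.1 * z 0 j ^+ x.1.2 * F (set_coord z j x.2)) <= e.
Proof.
move=> rho0 rhor e e0; have [M M0 FM] := cpolydisc_bounded F_cont.
have p0 : 0 < pi :> R by exact: pi_gt0.
have q0 : 0 <= rho / r by rewrite divr_ge0// ltW.
have q1 : rho / r < 1 by rewrite ltr_pdivrMr ?mul1r.
(* The estimate is made on 2 pi F(z), with total error 2 pi e: half of it goes to the truncation and
   half to the arcs. *)
have [N N0 NP] : exists2 N, (0 < N)%N &
    8 * pi * M * (rho / r) ^+ N / (1 - rho / r) <= e * pi.
  have : 8 * pi * M * (rho / r) ^+ N / (1 - rho / r) @[N --> \oo] -->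
      8 * pi * M * 0 / (1 - rho / r).
    apply: cvgM; last exact: cvg_cst.
    apply: cvgM; first exact: cvg_cst.
    by apply: cvg_expr; rewrite ger0_norm.
  rewrite mulr0 mul0r => /cvgr0Pnorm_lt/(_ (e * pi)); rewrite mulr_gt0// => /(_ isT) [N _ NP].
  exists N.+1 => //; apply: le_trans (ler_norm _) (ltW _).
  by apply: NP => /=.
(* The kernel is at most N in modulus, so an oscillation e / (4 N) on each arc contributes 2 (e / 4)
   2 pi = e pi after summation. *)
have eta0 : 0 < e / (4 * N%:R) by rewrite divr_gt0// mulr_gt0// ltr0n.
have [t t0 tF] := cpolydisc_unif_continuous F_cont eta0.
(* So many arcs that two points of the circle on the same arc, at most 2 r h apart, differ by less
   than t. *)
pose L := (Num.truncn (4 * pi * r / t)).+1.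
pose h := 2 * pi / L%:R : R.
have h0 : 0 < h by rewrite divr_gt0 ?mulr_gt0// ltr0n.
have Lh : L%:R * h = 2 * pi by rewrite /h mulrCA divff ?mulr1// pnatr_eq0.
have ht : 2 * r * h < t.
  rewrite /h; have -> : 2 * r * (2 * pi / L%:R) = 4 * pi * r / L%:R by ring.
  rewrite ltr_pdivrMr ?ltr0n// -ltr_pdivrMl// mulrC; exact: truncnS_gt.
pose c (k l : nat) : C := (2 * pi)%:C^-1 * (r%:C^-1) ^+ k *
  itvint (l%:R * h) (l.+1%:R * h) (fun y => cis (- k%:R * y)).
pose node (l : nat) : C := r%:C * cis (l%:R * h).
have node_r (x : R) : normc (r%:C * cis x) = r.
  by rewrite normcM normc_cis normc_real mulr1 gtr0_norm.
exists [seq (c k l, k, node l) | k <- iota 0 N, l <- iota 0 L]; split.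
  move=> _ /allpairsP[[k l] [_ _ ->]]; suff : normc (node l) <= r by [].
  by rewrite /node node_r.
move=> z zr zj; pose f x := F (set_coord z j x).
pose u := z 0 j / r%:C.
have un : normc u <= 1.
  rewrite normcM normcV normc_real gtr0_norm//.
  by rewrite ler_pdivrMr// mul1r (le_trans zj)// ltW.
have fM x : normc x <= r -> normc (f x) <= M.
  by move=> xr; apply: FM; exact: cpolydisc_set_coord.
have fz : f (z 0 j) = F z by rewrite /f set_coord_id.
have fc x : normc x <= r -> {for x, continuous f} by exact: slice_cont.
have := truncated_cauchy rho0 rhor zj N0 fc (fun x => @slice_diff z j x zr) fM.
rewrite fz -/u => /le_trans/(_ NP) h1.
have gc : continuous (fun y => f (r%:C * cis y) * geom_kernel N u y).
  move=> y; apply: cvgM; last exact: continuous_geom_kernel.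
  exact: (@continuous_circle _ f r rho rho0 rhor fc).
have kc : continuous (geom_kernel N u) by exact: continuous_geom_kernel.
have eS : \sum_(x <- [seq (c k l, k, node l) | k <- iota 0 N, l <- iota 0 L])
    x.1.1 * z 0 j ^+ x.1.2 * F (set_coord z j x.2) =
  (2 * pi)%:C^-1 * \sum_(l < L) f (node l) *
    itvint (l%:R * h) (l.+1%:R * h) (geom_kernel N u).
  rewrite big_allpairs_dep /= mulr_sumr exchange_big /=.
  rewrite -(big_mkord xpredT (fun l => (2 * pi)%:C^-1 * (f (node l) *
    itvint (l%:R * h) (l.+1%:R * h) (geom_kernel N u)))) /index_iota subn0.
  apply: eq_bigr => l _; rewrite /geom_kernel /itvint cintegral_sum//; last first.
    move=> k; apply: icontinuous_integrable; apply: continuous_icontinuous => y.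
    by apply: cvgM; [exact: cvg_cst|exact: continuous_cisM].
  rewrite mulr_sumr mulr_sumr -[in LHS](subn0 N) -/(index_iota 0 N) big_mkord.
  apply: eq_bigr => k _; rewrite /c /f cintegralZ//; last first.
    by apply: icontinuous_integrable; apply: continuous_icontinuous; exact: continuous_cisM.
  by rewrite /u expr_div_n exprVn /itvint; ring.
have h2 : normc (itvint 0 (2 * pi) (fun y => f (r%:C * cis y) * geom_kernel N u y) -
    \sum_(l < L) f (node l) * itvint (l%:R * h) (l.+1%:R * h) (geom_kernel N u)) <= e * pi.
  rewrite -Lh (itvint_arcs L (ltW h0) gc).
  rewrite -sumrB; apply: le_trans (normc_sum _ _ _) _.
  apply: (@le_trans _ _ (\sum_(l < L) (2 * (e / (4 * N%:R) * N%:R * h)))).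
    apply: ler_sum => l _; rewrite -itvintZ; last by apply: continuous_icontinuous; exact: kc.
    have lh : l%:R * h <= l.+1%:R * h by rewrite ler_wpM2r ?(ltW h0)// ler_nat.
    rewrite -itvintB; [|apply: continuous_icontinuous; exact: gc|]; last first.
      by apply: icontinuousM; [exact: icontinuous_cst|apply: continuous_icontinuous; exact: kc].
    have -> : e / (4 * N%:R) * N%:R * h = e / (4 * N%:R) * N%:R * (l.+1%:R * h - l%:R * h).
      by congr (_ * _); rewrite -mulrBl -natrB// subSnn mul1r.
    apply: itvint_bound; first exact: lh.
      apply: icontinuousB; first by apply: continuous_icontinuous; exact: gc.
      by apply: icontinuousM; [exact: icontinuous_cst|apply: continuous_icontinuous; exact: kc].
    move=> y /andP[y1 y2]; rewrite -mulrBl normcM.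
    apply: ler_pM; rewrite ?normc_ge0//; last exact: normc_geom_kernel.
    apply/ltW/tF; try (by apply: cpolydisc_set_coord => //; rewrite node_r).
    move=> k; rewrite !mxE; case: ifP => _; last by rewrite subrr normc0.
    rewrite /node -mulrBr normcM normc_real gtr0_norm//.
    apply: le_lt_trans ht; rewrite (mulrC 2) -mulrA ler_pM2l//.
    apply: le_trans (normc_cisB _ _) _; rewrite ler_pM2l// ger0_norm ?subr_ge0//.
    by rewrite lerBlDr; apply: le_trans y2 _; rewrite -natr1 mulrDl mul1r addrC.
  rewrite sumr_const card_ord -[X in X <= _]mulr_natr.
  have fe (x y k p : R) : k != 0 -> p != 0 ->
      2 * (e / (4 * k) * k * x) * y = e * p * (2 * x * y / (4 * p)).
    by move=> k0 p1; field; rewrite k0 p1.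
  rewrite (fe _ _ _ pi) ?gt_eqF// ?ltr0n//.
  have -> : 2 * h * L%:R / (4 * pi) = 1.
    have -> : 2 * h * L%:R = 4 * pi by rewrite -mulrA (mulrC h) Lh; ring.
    by rewrite divff// gt_eqF// mulr_gt0.
  by rewrite mulr1.
rewrite eS.
have -> : F z = (2 * pi)%:C^-1 * ((2 * pi)%:C * F z).
  by rewrite mulKf// eq_complex /= eqxx andbT gt_eqF// mulr_gt0.
rewrite -mulrBr normcM normcV normc_real gtr0_norm ?mulr_gt0//.
rewrite ler_pdivrMl ?mulr_gt0//.
rewrite -(subrK (itvint 0 (2 * pi) (fun y => f (r%:C * cis y) * geom_kernel N u y)) ((2 * pi)%:C * F z)).
rewrite -addrA; apply: le_trans (le_normcD _ _) _; apply: le_trans (lerD h1 h2) _.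
by rewrite -mulr2n -mulr_natl; lra.
Qed.

Definition monosum (s : seq (C * {ffun 'I_n -> nat})) z : C :=
  \sum_(l <- s) l.1 * \prod_j z 0 j ^+ l.2 j.

Let mix (m : nat) (x z : 'rV[C]_n) : 'rV[C]_n :=
  \row_k (if (k < m)%N then x 0 k else z 0 k).

(** One variable at a time: after m steps F is evaluated with its first m coordinates frozen at
    sample points, and after n steps only constants are left. The bound [rho <= 1] keeps the
    monomials at most 1, so that they do not amplify errors. *)
Lemma runge_polydisc (rho : R) : 0 <= rho -> rho < r -> rho <= 1 ->
  forall e : R, 0 < e -> exists s, forall z, cpolydisc rho z ->
    normc (F z - monosum s z) <= e.
Proof.
move=> rho0 rhor rho1.
pose approx m (s : seq (C * {ffun 'I_n -> nat} * 'rV[C]_n)) z :=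
  \sum_(x <- s) x.1.1 * \prod_j z 0 j ^+ x.1.2 j * F (mix m x.2 z).
have cS z : cpolydisc rho z -> cpolydisc r z.
  by move=> zr k; exact: le_trans (zr k) (ltW rhor).
have step m : (m <= n)%N -> forall e : R, 0 < e ->
    exists s, (forall x, x \in s -> cpolydisc r x.2) /\
      forall z, cpolydisc rho z -> normc (F z - approx m s z) <= e.
  elim: m => [_|m ih mn] e e0.
    exists [:: (1, [ffun=> 0%N], 0)]; split.
      by move=> x; rewrite inE => /eqP -> k; rewrite /= mxE normc0 ltW.
    move=> z zr; rewrite /approx big_seq1 /= big1 => [|k _]; last by rewrite ffunE.
    have -> : mix 0 0 z = z by apply/rowP => k; rewrite mxE.
    by rewrite !mul1r subrr normc0 ltW.
  have e2 : 0 < e / 2 by rewrite divr_gt0.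
  have [s [sr sP]] := ih (ltnW mn) _ e2.
  (* The error of the next step gets multiplied by the coefficients already present, of total
     modulus S. *)
  pose S := \sum_(x <- s) normc x.1.1.
  have S0 : 0 <= S by apply: sumr_ge0 => x _; exact: normc_ge0.
  have S1 : 0 < S + 1 by rewrite ltr_wpDl.
  pose j : 'I_n := Ordinal mn.
  have [t [tr tP]] := one_variable_step j rho0 rhor (divr_gt0 e2 S1).
  (* Combining two steps multiplies the coefficients, records the new exponent at j and freezes
     coordinate j at the new sample point. *)
  pose comb (x : C * {ffun 'I_n -> nat} * 'rV[C]_n) (y : C * nat * C) :
      C * {ffun 'I_n -> nat} * 'rV[C]_n :=
    (x.1.1 * y.1.1, [ffun k => (x.1.2 k + (k == j) * y.1.2)%N], set_coord x.2 j y.2).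
  exists [seq comb x y | x <- s, y <- t]; split.
    move=> _ /allpairsP[[x y] [xs yt ->]] /=.
    by apply: cpolydisc_set_coord; [exact: sr|exact: tr].
  move=> z zr; rewrite -(subrK (approx m s z) (F z)) -addrA.
  apply: le_trans (le_normcD _ _) _; rewrite (splitr e); apply: lerD; first exact: sP.
  have -> : approx m s z - approx m.+1 [seq comb x y | x <- s, y <- t] z =
      \sum_(x <- s) x.1.1 * \prod_k z 0 k ^+ x.1.2 k *
        (F (mix m x.2 z) - \sum_(y <- t) y.1.1 * mix m x.2 z 0 j ^+ y.1.2 *
          F (set_coord (mix m x.2 z) j y.2)).
    rewrite /approx big_allpairs_dep /= -sumrB; apply: eq_bigr => x _.
    rewrite mulrBr mulr_sumr; congr (_ - _); apply: eq_bigr => y _ /=.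
    have -> : mix m.+1 (set_coord x.2 j y.2) z = set_coord (mix m x.2 z) j y.2.
      apply/rowP => k; rewrite !mxE ltnS leq_eqVlt -(inj_eq val_inj) /=.
      by case: eqP => // ->; rewrite ltnn.
    have -> : mix m x.2 z 0 j = z 0 j by rewrite mxE ltnn.
    have -> : \prod_k z 0 k ^+ [ffun k0 => (x.1.2 k0 + (k0 == j) * y.1.2)%N] k =
        \prod_k z 0 k ^+ x.1.2 k * z 0 j ^+ y.1.2.
      under eq_bigr do rewrite ffunE exprD.
      rewrite big_split /=; congr (_ * _).
      rewrite (bigD1 j)//= eqxx mul1n big1 ?mulr1// => k /negbTE kj.
      by rewrite kj mul0n expr0.
    ring.
  apply: le_trans (normc_sum _ _ _) _.
  apply: (@le_trans _ _ (\sum_(x <- s) normc x.1.1 * (e / 2 / (S + 1)))); last first.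
    by rewrite -mulr_suml -/S mulrCA ger_pMr// ler_pdivrMr// mul1r lerDl ler01.
  rewrite big_seq [X in _ <= X]big_seq; apply: ler_sum => x xs.
  rewrite 2!normcM; apply: ler_pM; rewrite ?mulr_ge0 ?normc_ge0//.
    rewrite -[X in _ <= X]mulr1 ler_wpM2l ?normc_ge0//.
    have -> : normc (\prod_k z 0 k ^+ x.1.2 k) = \prod_k normc (z 0 k) ^+ x.1.2 k.
      rewrite (big_morph (@normc R) (@normcM R) (@normc1 R)).
      by apply: eq_bigr => k _; rewrite normcX.
    apply: prodr_ile1 => k _; rewrite exprn_ge0 ?normc_ge0//= exprn_ile1 ?normc_ge0//.
    exact: le_trans (zr k) rho1.
  apply: tP; last by rewrite mxE ltnn.
  by move=> k; rewrite mxE; case: ifP => _; [exact: sr|exact: cS].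
move=> e e0; have [s [_ sP]] := step n (leqnn n) e e0.
exists [seq (x.1.1 * F x.2, x.1.2) | x <- s] => z zr.
rewrite /monosum big_map; have := sP z zr; congr (normc (_ - _) <= _).
apply: eq_bigr => x _ /=.
have -> : mix n x.2 z = x.2 by apply/rowP => k; rewrite mxE ltn_ord.
ring.
Qed.

End runge.

(** * Holomorphic functions on the symmetrized polydisc *)

Section differentiability.
Variables (R : realType) (V : normedModType R[i]).
Local Notation C := R[i].
Implicit Types (f g : V -> C) (x : V).

Lemma differentiable_add f g x : differentiable f x -> differentiable g x ->
  differentiable (fun y => f y + g y : C) x.
Proof. by move=> df dg; exact: differentiableD. Qed.

Lemma differentiable_mul f g x : differentiable f x -> differentiable g x ->
  differentiable (fun y => f y * g y : C) x.
Proof. by move=> df dg; exact: differentiableM. Qed.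

Lemma differentiable_const (c : C) x : differentiable (fun=> c : C) x.
Proof. exact: differentiable_cst. Qed.

Lemma differentiable_bigsum (I : Type) (s : seq I) (P : pred I) (f : I -> V -> C) x :
  (forall i, P i -> differentiable (f i) x) ->
  differentiable (fun y => \sum_(i <- s | P i) f i y : C) x.
Proof.
move=> df; elim: s => [|i s ih].
  have -> : (fun y => \sum_(i <- [::] | P i) f i y : C) = (fun=> 0).
    by apply/funext => y; rewrite big_nil.
  exact: differentiable_const.
case Pi : (P i); last first.
  have -> // : (fun y => \sum_(j <- i :: s | P j) f j y : C) =
      (fun y => \sum_(j <- s | P j) f j y).
  by apply/funext => y; rewrite big_cons Pi.
have -> : (fun y => \sum_(j <- i :: s | P j) f j y : C) =
    (fun y => f i y + \sum_(j <- s | P j) f j y).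
  by apply/funext => y; rewrite big_cons Pi.
by apply: differentiable_add => //; exact: df.
Qed.

Lemma differentiable_bigprod (I : Type) (s : seq I) (P : pred I) (f : I -> V -> C) x :
  (forall i, P i -> differentiable (f i) x) ->
  differentiable (fun y => \prod_(i <- s | P i) f i y : C) x.
Proof.
move=> df; elim: s => [|i s ih].
  have -> : (fun y => \prod_(i <- [::] | P i) f i y : C) = (fun=> 1).
    by apply/funext => y; rewrite big_nil.
  exact: differentiable_const.
case Pi : (P i); last first.
  have -> // : (fun y => \prod_(j <- i :: s | P j) f j y : C) =
      (fun y => \prod_(j <- s | P j) f j y).
  by apply/funext => y; rewrite big_cons Pi.
have -> : (fun y => \prod_(j <- i :: s | P j) f j y : C) =
    (fun y => f i y * \prod_(j <- s | P j) f j y).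
  by apply/funext => y; rewrite big_cons Pi.
by apply: differentiable_mul => //; exact: df.
Qed.

Lemma differentiable_exp f (k : nat) x : differentiable f x ->
  differentiable (fun y => f y ^+ k : C) x.
Proof.
move=> df; have -> : (fun y => f y ^+ k : C) = (fun y => \prod_(i < k) f y).
  by apply/funext => y; rewrite prodr_const card_ord.
by apply: differentiable_bigprod => i _.
Qed.

Lemma differentiable_rV (n : nat) (f : 'I_n -> V -> C) x :
  (forall k, differentiable (f k) x) ->
  differentiable (fun y => \row_k f k y : 'rV[C]_n) x.
Proof.
move=> df.
have -> : (fun y => \row_k f k y : 'rV[C]_n) =
    \sum_(k < n) (fun y => f k y *: (delta_mx 0 k : 'rV[C]_n)).
  apply/funext => y; rewrite fct_sumE; apply/rowP => k.
  rewrite mxE summxE (bigD1 k)//= !mxE !eqxx mulr1 big1 ?addr0// => j /negbTE jk.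
  by rewrite !mxE eqxx eq_sym jk mulr0.
by apply: differentiable_sum => k; exact: differentiableZl.
Qed.

End differentiability.

Section holomorphic_pullback.
Variables (R : realType) (n : nat).
Local Notation C := R[i].
Implicit Types (z u : 'rV[C]_n) (f : 'rV[C]_n -> C).

Lemma differentiable_peval (P : mpoly n C) z : differentiable (fun z => peval P z) z.
Proof.
have -> : (fun z => peval P z) = (fun z => \sum_(m <- msupp P) mcoeff m P *
    \prod_i z 0 i ^+ m i).
  by apply/funext => y; rewrite /peval mevalE.
apply: differentiable_bigsum => m _; apply: differentiable_mul.
  exact: differentiable_const.
apply: differentiable_bigprod => i _; apply: differentiable_exp.
exact: differentiable_coord.
Qed.

Lemma differentiable_symmetrization z : differentiable (@symmetrization R n) z.
Proof. by apply: differentiable_rV => k; exact: differentiable_peval. Qed.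

Lemma differentiable_conj_det (p : npart n) u : differentiable (fun u => conj_det p u) u.
Proof.
rewrite /conj_det /determinant; apply: differentiable_bigsum => s _.
apply: differentiable_mul; first exact: differentiable_const.
apply: differentiable_bigprod => i _.
set k := (conj_part p i)%:Z + (s i)%:Z - i%:Z.
have -> : (fun u => (\matrix_(i0, j) ecoord u ((conj_part p i0)%:Z + j%:Z - i0%:Z)) i (s i)) =
    fun u => ecoord u k by apply/funext => v; rewrite mxE.
rewrite /ecoord; case: k => [[|k]|k].
- exact: differentiable_const.
- by case: insubP => [j _ _|_]; [exact: differentiable_coord|exact: differentiable_const].
- exact: differentiable_const.
Qed.

(** The scaling of z by rho as seen on G_n: the entry of index k is the elementary symmetric
    polynomial of degree k + 1. *)
Definition dilate_sym (rho : C) u : 'rV[C]_n := \row_k (rho ^+ k.+1 * u 0 k).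

Lemma symmetrization_scale (rho : C) z :
  symmetrization (rho *: z) = dilate_sym rho (symmetrization z).
Proof.
apply/rowP => k; rewrite !mxE /peval /mesym !rmorph_sum /= mulr_sumr.
apply: eq_bigr => h /eqP hk; rewrite !rmorph_prod /= -hk -prodr_const -big_split /=.
by apply: eq_bigr => i _; rewrite !mevalXU mxE.
Qed.

Lemma differentiable_dilate_sym rho u : differentiable (dilate_sym rho) u.
Proof.
apply: differentiable_rV => k; apply: differentiable_mul.
  exact: differentiable_const.
exact: differentiable_coord.
Qed.

Lemma polydiscP z : polydisc z <-> forall i, normc (z 0 i) < 1.
Proof.
by split=> h i; have := h i; rewrite normrcE -(rmorph1 (real_complex R)) ltcR.
Qed.

Lemma cpolydisc_polydisc (r : R) z : r < 1 -> cpolydisc r z -> polydisc z.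
Proof. by move=> r1 zr; apply/polydiscP => i; exact: le_lt_trans (zr i) r1. Qed.

Lemma complex_diff_slice (F : 'rV[C]_n -> C) z j : differentiable F z ->
  complex_diff_at (fun x => F (set_coord z j x)) (z 0 j).
Proof.
move=> dF.
pose D : 'rV[C]_n := delta_mx 0 j.
(* The norm of the basis vector is used only as some real number d; dividing e by d + 1 absorbs
   it. *)
have [d d0 dE] : exists2 d : R, 0 <= d & `|D| = d%:C.
  have h : 0 <= `|D| := normr_ge0 D.
  have /complex_realP[d dE] := ger0_real h.
  by exists d => //; move: h; rewrite dE lecR.
exists ('d F z D) => e e0.
have e'0 : 0 < e / (d + 1) by rewrite divr_gt0// ltr_wpDl.
have h := (eqaddoP _ _ _ _).1 (diff_locally dF).
have e'C : (0 : C) < (e / (d + 1))%:C by rewrite ltcR.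
have /nbhs_rVP[t t0 tF] := h _ e'C.
exists t => // x xt.
pose v : 'rV[C]_n := (x - z 0 j) *: D.
have vE k : v 0 k = if k == j then x - z 0 j else 0.
  by rewrite !mxE eqxx /=; case: eqP => _; rewrite ?mulr1 ?mulr0.
have zv : v + z = set_coord z j x.
  by apply/rowP => k; rewrite mxE vE mxE; case: eqP => [->|_]; rewrite ?subrK ?add0r.
have /tF : forall k, normc (v 0 k - (0 : 'rV[C]_n) 0 k) < t.
  by move=> k; rewrite vE mxE subr0; case: ifP => _ //; rewrite normc0.
rewrite /= !fctE /= zv linearZ /= set_coord_id.
rewrite [X in _ <= _ * X -> _]normrZ dE normrcE normrcE -!rmorphM lecR opprD addrA.
have -> : 'd F z D * (x - z 0 j) = (x - z 0 j) *: 'd F z D by rewrite mulrC.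
move=> /le_trans; apply.
rewrite mulrCA mulrC ler_wpM2r ?normc_ge0//.
by rewrite mulrAC ler_pdivrMr ?ltr_wpDl// ler_wpM2l ?(ltW e0)// lerDl.
Qed.

Variable f : 'rV[C]_n -> C.
Hypothesis f_hol : holomorphic_on (@sym_polydisc R n) f.

Let F z := f (symmetrization z).

Lemma differentiable_pullback z : polydisc z -> differentiable F z.
Proof.
move=> Dz; apply: (@differentiable_comp _ _ _ _ (@symmetrization R n) f).
  exact: differentiable_symmetrization.
by apply: f_hol; exists z.
Qed.

End holomorphic_pullback.

(** * Alternating functions and antisymmetrization *)

Section antisymmetrization.
Variables (R : realType) (n : nat).
Local Notation C := R[i].
Implicit Types (z : 'rV[C]_n) (f : 'rV[C]_n -> C) (p : npart n).

Definition permute_coords (s : 'S_n) z : 'rV[C]_n := \row_i z 0 (s i).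

(** The coordinates are coefficients of the product of the ['X + z_i], whose factors may be
    reordered. *)
Lemma symmetrization_permute s z :
  symmetrization (permute_coords s z) = symmetrization z.
Proof.
have e (y : 'rV[C]_n) (k : 'I_n) :
    symmetrization y 0 k = (\prod_(i < n) ('X + (y 0 i)%:P))`_(n - k.+1).
  rewrite coef_prod_XD// mxE /peval /mesym rmorph_sum /=; apply: eq_bigr => h _.
  by rewrite rmorph_prod /=; apply: eq_bigr => i _; rewrite mevalXU.
apply/rowP => k; rewrite !e; congr (_`_ _); congr polyseq.
rewrite [RHS](reindex_inj (@perm_inj _ s)) /=.
by apply: eq_bigr => i _; rewrite mxE.
Qed.

Lemma alt_det_permute m s z :
  alt_det m (permute_coords s z) = (-1) ^+ s * alt_det m z.
Proof.
have -> : alt_det m (permute_coords s z) =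
    \det (row_perm s (\matrix_(i < n, j < n) (z 0 i ^+ m j))).
  by congr (\det _); apply/matrixP => i j; rewrite !mxE.
by rewrite row_permE det_mulmx det_perm.
Qed.

Lemma alt_detE m z :
  alt_det m z = \sum_(s : 'S_n) (-1) ^+ s * \prod_j z 0 (s j) ^+ m j.
Proof.
rewrite /alt_det -det_tr /determinant; apply: eq_bigr => s _; congr (_ * _).
by apply: eq_bigr => j _; rewrite !mxE.
Qed.

Lemma vdmE : exists b : bool, forall z, vdm z = (-1) ^+ b * alt_det (@delta n) z.
Proof.
have [b e] := @alt_det_conj_det R n (npart0 n); exists b => z.
have -> : @delta n = (fun j => part (npart0 n) j + delta j)%N.
  by apply/funext => j; rewrite part_npart0.
rewrite e mulrA -signr_addb addbb mul1r.
have -> : conj_det (npart0 n) (symmetrization z) = 1; last by rewrite mul1r.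
rewrite /conj_det; have -> : part1 (npart0 n) = 0%N by rewrite /part1 /=; case: (n).
by rewrite det_mx00.
Qed.

Lemma vdm_permute s z : vdm (permute_coords s z) = (-1) ^+ s * vdm z.
Proof. by have [b e] := vdmE; rewrite !e alt_det_permute mulrCA. Qed.

Lemma alt_det_expand (m : 'I_n -> nat) : exists (c : C) p, forall z,
  alt_det m z = c * (conj_det p (symmetrization z) * vdm z).
Proof.
have ev z m' : alt_det m' z = peval (\det (\matrix_(i < n, j < n) (mvar R i ^+ m' j))) z.
  rewrite /peval -det_map_mx; congr (\det _); apply/matrixP => i j.
  by rewrite !mxE rmorphXn /= mevalXU.
have [m0|[b [p mp]]] := det_sort_exponents (@mvar R n) m.
  by exists 0, (npart0 n) => z; rewrite mul0r ev m0 /peval meval0.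
have [b' e] := @alt_det_conj_det R n p.
exists ((-1) ^+ b * (-1) ^+ b'), p => z.
by rewrite -mulrA -e !ev mp /peval mevalM rmorph_sign.
Qed.

Lemma cpolydisc_permute r s z : cpolydisc r z -> cpolydisc r (permute_coords s z).
Proof. by move=> zr i; rewrite mxE; exact: zr. Qed.

(** The function f(s(z)) Delta(z) is alternating, hence fixed by antisymmetrization, which sends the
    monomials of a Runge approximation to multiples of e_p(s(z)) Delta(z). As an average with signs
    over permutations of the same polydisc, antisymmetrization does not increase the uniform
    error. *)
Lemma holomorphic_approx f (rho : R) : holomorphic_on (@sym_polydisc R n) f ->
  0 <= rho -> rho < 1 -> forall e : R, 0 < e ->
  exists s : seq (C * npart n), forall z, cpolydisc rho z ->
    normc (f (symmetrization z) * vdm z -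
      \sum_(x <- s) x.1 * (conj_det x.2 (symmetrization z) * vdm z)) <= e.
Proof.
move=> fhol rho0 rho1 e e0.
pose H z := f (symmetrization z) * vdm z.
have dH z : polydisc z -> differentiable H z.
  move=> Dz; apply: differentiable_mul; first exact: differentiable_pullback.
  exact: differentiable_peval.
(* Runge approximation needs a radius strictly larger than rho on which the function is still
   holomorphic. *)
pose r := (rho + 1) / 2.
have r0 : 0 < r by rewrite divr_gt0// ltr_wpDl.
have r1 : r < 1 by rewrite ltr_pdivrMr// mul1r; lra.
have rhor : rho < r by rewrite ltr_pdivlMr//; lra.
have Hc z : cpolydisc r z -> {for z, continuous H}.
  by move=> /(cpolydisc_polydisc r1) Dz; apply: differentiable_continuous; exact: dH.
have Hd z j : cpolydisc r z -> complex_diff_at (fun x => H (set_coord z j x)) (z 0 j).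
  by move=> /(cpolydisc_polydisc r1) Dz; apply: complex_diff_slice; exact: dH.
have [s sP] := runge_polydisc r0 Hc Hd rho0 rhor (ltW rho1) e0.
have [g gP] := choice (fun m => alt_det_expand m).
have [h hP] := choice gP.
pose N : C := (#|{: 'S_n}|%:R)^-1.
have N0 : (#|{: 'S_n}|%:R : C) != 0 by rewrite pnatr_eq0 -lt0n; apply/card_gt0P; exists 1%g.
exists [seq (N * (x.1 * g x.2), h x.2) | x : C * {ffun 'I_n -> nat} <- s] => z zr.
have HE : H z = N * \sum_(t : 'S_n) (-1) ^+ t * H (permute_coords t z).
  rewrite (eq_bigr (fun=> H z)).
    by rewrite sumr_const -[H z *+ _]mulr_natl mulKf.
  move=> t _; rewrite /H symmetrization_permute vdm_permute mulrCA.
  by rewrite (mulrA ((-1) ^+ t)) -signr_addb addbb mul1r.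
have SE : \sum_(x <- [seq (N * (x.1 * g x.2), h x.2) | x : C * {ffun 'I_n -> nat} <- s])
      x.1 * (conj_det x.2 (symmetrization z) * vdm z) =
    N * \sum_(t : 'S_n) (-1) ^+ t * monosum s (permute_coords t z).
  rewrite big_map /= mulr_sumr /monosum.
  under [RHS]eq_bigr do rewrite mulr_sumr mulr_sumr.
  rewrite exchange_big /=; apply: eq_bigr => x _.
  rewrite -!mulrA -hP alt_detE mulr_sumr mulr_sumr; apply: eq_bigr => t _.
  congr (_ * _); rewrite mulrCA; congr (_ * (_ * _)).
  by apply: eq_bigr => j _; rewrite mxE.
rewrite -/(H z) HE SE -mulrBr -sumrB normcM.
have NN : normc N = #|{: 'S_n}|%:R^-1.
  by rewrite /N normcV -(rmorph_nat (real_complex R)) normc_real ger0_norm// ler0n.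
rewrite NN ler_pdivrMl; last first.
  by rewrite ltr0n; apply/card_gt0P; exists 1%g.
apply: le_trans (normc_sum _ _ _) _.
apply: (@le_trans _ _ (\sum_(t : 'S_n) e)); last by rewrite sumr_const mulr_natl.
apply: ler_sum => t _; rewrite -mulrBr normcM normcX normcN normc1 expr1n mul1r.
by apply: sP; exact: cpolydisc_permute.
Qed.

End antisymmetrization.

(** * Moments of the weight *)

Section product_integral.
Context d1 d2 (T1 : measurableType d1) (T2 : measurableType d2) (R : realType).
Variables (m1 : {sigma_finite_measure set T1 -> \bar R})
          (m2 : {sigma_finite_measure set T2 -> \bar R}).

Lemma Rintegral_prod (f : T1 -> R) (g : T2 -> R) :
  m1.-integrable setT (EFin \o f) -> m2.-integrable setT (EFin \o g) ->
  (m1 \x m2)%E.-integrable setT (EFin \o (fun x => f x.1 * g x.2)) /\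
  \int[(m1 \x m2)%E]_x (f x.1 * g x.2) = \int[m1]_x f x * \int[m2]_x g x.
Proof.
move=> fi gi.
have mf : measurable_fun setT f by apply/measurable_EFinP; exact: measurable_int fi.
have mg : measurable_fun setT g by apply/measurable_EFinP; exact: measurable_int gi.
have mfg : measurable_fun setT (fun x : T1 * T2 => f x.1 * g x.2).
  by apply: measurable_funM; apply: measurableT_comp.
have fgi : (m1 \x m2)%E.-integrable setT (EFin \o (fun x => f x.1 * g x.2)).
  apply/integrable12ltyP; first exact/measurable_EFinP.
  have -> : (\int[m1]_x \int[m2]_y `|((f x * g y)%R)%:E| =
      \int[m1]_x ((fine (\int[m2]_y `|(g y)%:E|))%:E * `|(f x)%:E|))%E.
    apply: eq_integral => x _ /=; rewrite muleC.
    have -> : (fine (\int[m2]_y `|g y|%:E)%E)%:E = (\int[m2]_y `|(g y)%:E|)%E.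
      rewrite fineK//; apply: integrable_fin_num => //; exact: integrable_abse gi.
    rewrite -ge0_integralZl//=.
    - by apply: eq_integral => y _; rewrite normrM EFinM.
    - by apply/measurable_EFinP; exact: measurableT_comp.
  rewrite ge0_integralZl//=.
  - apply: lte_mul_pinfty; rewrite ?lee_fin ?fine_ge0 ?integral_ge0//.
    by have /integrableP[] := fi.
  - by apply/measurable_EFinP; exact: measurableT_comp.
  - by rewrite lee_fin fine_ge0// integral_ge0.
split=> //; rewrite {1}/Rintegral -integral12_prod_meas1//=.
have gf : (\int[m2]_y (g y)%:E)%E = (\int[m2]_y g y)%:E.
  by rewrite /Rintegral fineK//; exact: integrable_fin_num gi.
rewrite (eq_integral (fun x => ((\int[m2]_y g y)%:E * (f x)%:E)%E)); last first.
  move=> x _; rewrite /fubini_F /=; under eq_integral do rewrite EFinM.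
  by rewrite integralZl// gf muleC.
rewrite integralZl// fineM//; last exact: integrable_fin_num fi.
by rewrite mulrC.
Qed.

Local Notation C := R[i].

Lemma cintegral_prod (f : T1 -> C) (g : T2 -> C) :
  cintegrable m1 setT f -> cintegrable m2 setT g ->
  cintegrable (m1 \x m2)%E setT (fun x => f x.1 * g x.2) /\
  cintegral (m1 \x m2)%E setT (fun x => f x.1 * g x.2) =
  cintegral m1 setT f * cintegral m2 setT g.
Proof.
move=> [fr fi] [gr gi].
have [h1 e1] := Rintegral_prod fr gr; have [h2 e2] := Rintegral_prod fi gi.
have [h3 e3] := Rintegral_prod fr gi; have [h4 e4] := Rintegral_prod fi gr.
have eR : (EFin \o (fun x : T1 * T2 => complex.Re (f x.1 * g x.2))) =
    ((EFin \o (fun x => (complex.Re (f x.1) * complex.Re (g x.2))%R)) \-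
     (EFin \o (fun x => (complex.Im (f x.1) * complex.Im (g x.2))%R)))%E.
  by apply/funext => x /=; rewrite ReM.
have eI : (EFin \o (fun x : T1 * T2 => complex.Im (f x.1 * g x.2))) =
    ((EFin \o (fun x => (complex.Re (f x.1) * complex.Im (g x.2))%R)) \+
     (EFin \o (fun x => (complex.Im (f x.1) * complex.Re (g x.2))%R)))%E.
  by apply/funext => x /=; rewrite ImM.
split; first by split; rewrite ?eR ?eI; [exact: integrableB|exact: integrableD].
apply: complex_eq; rewrite ?ReM ?ImM /= -?e1 -?e2 -?e3 -?e4.
  by rewrite -RintegralB//; apply: eq_Rintegral => x _; exact: ReM.
by rewrite -RintegralD//; apply: eq_Rintegral => x _; exact: ImM.
Qed.

End product_integral.

Section power_integral.
Variables (R : realType) (S : sfspace R).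
Local Notation C := R[i].

Lemma cintegral_pow n (phi : 'I_n -> sf_sort S -> C) :
  (forall i, cintegrable (sf_measure S) setT (phi i)) ->
  cintegrable (sf_measure (sf_pow S n)) setT
    (fun x => \prod_i phi i (tnth (sf_tuple x) i)) /\
  cintegral (sf_measure (sf_pow S n)) setT
    (fun x => \prod_i phi i (tnth (sf_tuple x) i)) =
  \prod_i cintegral (sf_measure S) setT (phi i).
Proof.
elim: n phi => [|n ih] phi phii.
  have e : (fun x : sf_sort (sf_pow S 0) => \prod_i phi i (tnth (sf_tuple x) i)) =
      (fun=> 1) by apply/funext => x; rewrite big_ord0.
  have i1 (r : R) : (\d_tt : {measure set unit -> \bar R}).-integrable setT
      (EFin \o (fun=> r)).
    by apply: finite_measure_integrable_cst.
  rewrite e big_ord0; split; first by split; exact: i1.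
  have m1 : sf_measure (sf_pow S 0) setT = 1%E by exact: diracT.
  apply: complex_eq => /=; rewrite Rintegral_cst// ?mul0r// mul1r.
  exact: (congr1 fine m1).
have e : (fun x : sf_sort (sf_pow S n.+1) => \prod_i phi i (tnth (sf_tuple x) i)) =
    (fun x => phi ord0 x.1 * \prod_i phi (lift ord0 i) (tnth (sf_tuple x.2) i)).
  apply/funext => -[x y] /=; rewrite big_ord_recl; congr (_ * _).
  by apply: eq_bigr => i _; rewrite tnthS.
have [h1 h2] := ih (fun i => phi (lift ord0 i)) (fun i => phii _).
have [h3 h4] := cintegral_prod (phii ord0) h1.
by rewrite e big_ord_recl -h2; split; [exact: h3|exact: h4].
Qed.

End power_integral.

Section improper_integral.
Variable R : realType.
Local Notation leb := (@lebesgue_measure R).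

Lemma bigcup_itv01 :
  \bigcup_k `[0, 1 - k.+1%:R^-1]%classic = `[0, 1[%classic :> set R.
Proof.
apply/seteqP; split=> [x [k _] /=|x /=]; rewrite !in_itv /= => /andP[x0 x1].
  by rewrite x0 (le_lt_trans x1)// ltrBlDr ltrDl invr_gt0.
have [k kx] : exists k : nat, k.+1%:R^-1 < 1 - x.
  have e0 : 0 < 1 - x by rewrite subr_gt0.
  have [k _ /(_ k (leqnn k)) kP] := @near_infty_natSinv_lt R (PosNum e0).
  by exists k.
exists k => //=; rewrite in_itv /= x0 /= lerBrDr -lerBrDl.
by move: kx => /ltW.
Qed.

(** The radial density blows up at 1 when mu < 2, so the usual theorem is applied on
    [0, 1 - 1/(k+1)] and followed by monotone convergence. Assumptions on ]-1, 1[ make 0 an interior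
    point. *)
Lemma improper_FTC (f F : R -> R) :
  (forall x : R, 0 <= x < 1 -> 0 <= f x) ->
  (forall x : R, -1 < x < 1 -> {for x, continuous f}) ->
  (forall x : R, -1 < x < 1 -> is_derive x (1 : R) F (f x)) ->
  F x @[x --> 1^'-] --> F 1 ->
  measurable_fun (`[0%R, 1%R[%classic : set R) f /\
  (\int[leb]_(x in `[0%R, 1%R[) (f x)%:E = (F 1 - F 0)%:E)%E.
Proof.
move=> f0 fc dF F1.
have mf : measurable_fun (`[0%R, 1%R[%classic : set R) f.
  apply: subspace_continuous_measurable_fun => //.
  apply: continuous_in_subspaceT => x /set_mem /=; rewrite in_itv /= => /andP[x0 x1].
  by apply: fc; rewrite x1 andbT (lt_le_trans _ x0)// ltrN10.
split=> //.
pose I (k : nat) : set R := `[0, 1 - k.+1%:R^-1]%classic.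
have k1 (k : nat) : 1 - k.+1%:R^-1 < 1 :> R by rewrite ltrBlDr ltrDl invr_gt0.
have IE k : (\int[leb]_(x in I k) (f x)%:E = (F (1 - k.+1%:R^-1) - F 0)%:E)%E.
  rewrite /I; case: k => [|k].
    (* For k = 0 the interval is the single point 0, to which the theorem for a < b does not
       apply. *)
    by rewrite invr1 subrr set_itv1 integral_set1 subrr.
  have xk0 : 0 < 1 - k.+2%:R^-1 :> R.
    by rewrite subr_gt0 invf_lt1 ?ltr1n// ltr0n.
  have xc (x : R) : x \in `[0, 1 - k.+2%:R^-1] -> -1 < x < 1.
    rewrite in_itv /= => /andP[x0 x1]; rewrite (lt_le_trans _ x0) ?ltrN10//=.
    exact: le_lt_trans x1 (k1 _).
  have Fc (x : R) : x \in `[0, 1 - k.+2%:R^-1] -> {for x, continuous F}.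
    move=> /xc h; apply/differentiable_continuous/derivable1_diffP.
    exact: (@ex_derive _ _ _ _ _ _ _ (dF x h)).
  rewrite (@continuous_FTC2 _ _ F) ?EFinB//.
  - by apply: continuous_in_subspaceT => x /set_mem /xc; exact: fc.
  - split.
    + by move=> x /subset_itv_oo_cc /xc h; exact: (@ex_derive _ _ _ _ _ _ _ (dF x h)).
    + by apply: cvg_at_right_filter; apply: Fc; rewrite in_itv /= lexx ltW.
    + by apply: cvg_at_left_filter; apply: Fc; rewrite in_itv /= lexx ltW.
  - by move=> x /subset_itv_oo_cc /xc h; rewrite derive1E (@derive_val _ _ _ _ _ _ _ (dF x h)).
have h1 : (\int[leb]_(x in I k) (f x)%:E @[k --> \oo] -->
    \int[leb]_(x in `[0%R, 1%R[) (f x)%:E)%E.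
  rewrite -bigcup_itv01; apply: ge0_nondecreasing_set_cvg_integral => //.
  - move=> k l kl; apply/subsetPset; apply: subset_itvl; rewrite bnd_simp.
    by rewrite lerB// lef_pV2 ?posrE ?ltr0n// ler_nat.
  - by move=> k; exact: measurable_itv.
  - move=> k; apply/measurable_EFinP; apply: measurable_funS mf => //.
    by rewrite -bigcup_itv01; exact: (@bigcup_sup _ _ k).
  - by move=> k x; rewrite /I /= in_itv /= => /andP[x0 xk]; rewrite lee_fin f0// x0 (le_lt_trans xk).
have h2 : (\int[leb]_(x in I k) (f x)%:E @[k --> \oo] --> (F 1 - F 0)%:E)%E.
  under eq_fun do rewrite IE.
  apply/cvg_EFin; first by near=> k.
  apply: cvgB; last exact: cvg_cst.
  have s1 : 1 - k.+1%:R^-1 @[k --> \oo] --> (1 : R).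
    rewrite -[X in _ --> X]subr0; apply: cvgB; first exact: cvg_cst.
    exact: cvg_harmonic.
  apply: (cvg_at_leftP F 1 (F 1)).1 => //.
exact: (cvg_unique (@ereal_hausdorff R) h1 h2).
Unshelve. all: by end_near. Qed.

End improper_integral.

(** * Beta integrals of the radial weight *)

Section radial_moments.
Variables (R : realType) (mu : R).
Hypothesis mu1 : 1 < mu.
Local Notation leb := (@lebesgue_measure R).

Definition radial_monomial (a : nat) (x : R) : R :=
  x ^+ a.*2.+1 * (1 - x ^+ 2) `^ (mu - 2).

Let G (a : nat) (x : R) : R := x ^+ a.*2 * (1 - x ^+ 2) `^ (mu - 1).

Let pos (x : R) : -1 < x < 1 -> 0 < 1 - x ^+ 2.
Proof. by move=> /andP[h1 h2]; nra. Qed.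

Let is_derive_pow (x : R) : -1 < x < 1 ->
  is_derive x (1 : R) (fun t : R => (1 - t ^+ 2) `^ (mu - 1))
    (- 2 * (mu - 1) * (x * (1 - x ^+ 2) `^ (mu - 2))).
Proof.
move=> hx; have h := is_derive1_powR (mu - 1) (pos hx).
have h2 : is_derive x (1 : R) (fun t : R => 1 - t ^+ 2) (- (2 * x)).
  by apply: is_derive_eq; rewrite /GRing.scale /=; ring.
have := @is_derive1_comp _ (fun t => t `^ (mu - 1)) (fun t : R => 1 - t ^+ 2) _ _ _ h h2.
congr (is_derive _ _ _ _); rewrite -addrA -opprD -natr1; ring.
Qed.

Let is_derive_G0 (x : R) : -1 < x < 1 ->
  is_derive x (1 : R) (G 0) (- 2 * (mu - 1) * radial_monomial 0 x).
Proof.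
move=> hx; have := is_derive_pow hx; rewrite /radial_monomial double0 expr1.
by congr (is_derive _ _ _ _); apply/funext => t; rewrite /G expr0 mul1r.
Qed.

(** Integration by parts in differential form: it links two consecutive monomials, while G vanishes
    at both ends of [0, 1], so the moments obey a recurrence with ratio (a + 1) / (mu + a). *)
Let is_derive_GS a (x : R) : -1 < x < 1 ->
  is_derive x (1 : R) (G a.+1) (2 * a.+1%:R * radial_monomial a x -
    2 * (a%:R + mu) * radial_monomial a.+1 x).
Proof.
move=> hx; have h := is_derive_pow hx.
have h2 : is_derive x (1 : R) (fun t : R => t ^+ a.+1.*2) (a.+1.*2%:R * x ^+ a.*2.+1).
  have := @is_deriveX _ _ (@id R) a.+1.*2 x 1 1 (is_derive_id x 1).
  rewrite exprfctE; congr (is_derive _ _ _ _).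
  by rewrite /GRing.scale /= mulr1.
have := @is_deriveM _ _ _ _ _ _ _ _ h2 h; congr (is_derive _ _ _ _).
have -> : (1 - x ^+ 2) `^ (mu - 1) = (1 - x ^+ 2) `^ (mu - 2) * (1 - x ^+ 2).
  rewrite -[X in _ = _ * X]powRr1 ?ltW ?pos// -powRD; last first.
    by rewrite (gt_eqF (pos hx)) implybT.
  by congr (_ `^ _); lra.
have -> : a.+1.*2%:R = 2 * (a%:R + 1) :> R by rewrite -muln2 natrM -natr1 mulrC.
rewrite /radial_monomial /GRing.scale /= doubleS !exprSr -natr1; ring.
Qed.

Let G_cvg1 a : G a x @[x --> 1^'-] --> G a 1.
Proof.
have -> : G a 1 = 1 ^+ a.*2 * 0.
  by rewrite /G !expr1n subrr powR0 ?mulr0// subr_eq0 gt_eqF.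
apply: cvgM.
  by apply: cvg_at_left_filter; exact: exprn_continuous.
have mu0 : 0 < mu - 1 by rewrite subr_gt0.
apply: (@cvg_comp _ _ _ (fun x : R => 1 - x ^+ 2) (fun y => y `^ (mu - 1))
  _ (0^'+)); last exact: powR_cvg0.
have c0 : 1 - x ^+ 2 @[x --> (1 : R)^'-] --> (0 : R).
  rewrite -[X in _ --> X](subrr (1 : R)); apply: cvgB; first exact: cvg_cst.
  rewrite -[X in _ --> X](expr1n R 2).
  by apply: cvg_at_left_filter; exact: exprn_continuous.
have h1 : \forall x \near (1 : R)^'-, -1 < x < 1.
  by near=> x; apply/andP; split.
move=> U U0; have h : \forall x \near (1 : R)^'-, 0 < 1 - x ^+ 2 -> U (1 - x ^+ 2) := c0 _ U0.
change (\forall x \near (1 : R)^'-, U (1 - x ^+ 2)).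
by apply: filterS2 h h1 => x hx xh; exact/hx/pos.
Unshelve. all: by end_near. Qed.

Lemma radial_primitive a : exists F : R -> R, [/\
  forall x : R, -1 < x < 1 -> is_derive x (1 : R) F (radial_monomial a x),
  F x @[x --> 1^'-] --> F 1 &
  F 1 - F 0 = a`!%:R / pochhammer mu a / (2 * (mu - 1))].
Proof.
have mu0 : 0 < mu - 1 by rewrite subr_gt0.
have GS1 b : G b 1 = 0 by rewrite /G !expr1n subrr powR0 ?mulr0// gt_eqF.
elim: a => [|a [F [dF F1 FE]]].
  exists (fun x => (- 2 * (mu - 1))^-1 * G 0 x); split.
  - move=> x hx; have := is_deriveZ (- 2 * (mu - 1))^-1 (is_derive_G0 hx).
    by congr (is_derive _ _ _ _); rewrite /GRing.scale /= mulKf// lt_eqF//; lra.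
  - by apply: cvgM; [exact: cvg_cst|exact: G_cvg1].
  - rewrite GS1 /G expr0 expr0n subr0 powR1 /pochhammer big_geq// fact0.
    by rewrite mulr0 add0r !mulr1 divr1 mul1r mulNr invrN opprK.
have c0 : 0 < 2 * (a%:R + mu) by have := ler0n R a; lra.
exists (fun x => (2 * (a%:R + mu))^-1 * (2 * a.+1%:R * F x - G a.+1 x)); split.
- move=> x hx.
  have h := is_deriveB (is_deriveZ (2 * a.+1%:R) (dF x hx)) (is_derive_GS a hx).
  have := is_deriveZ (2 * (a%:R + mu))^-1 h.
  congr (is_derive _ _ _ _); rewrite /GRing.scale /= opprB addrCA subrr addr0.
  by rewrite mulKf// gt_eqF.
- apply: cvgM; first exact: cvg_cst.
  apply: cvgB; last exact: G_cvg1.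
  by apply: cvgM; [exact: cvg_cst|exact: F1].
- rewrite GS1 [G _ 0]/G doubleS expr0n mul0r !subr0 -mulrBr -mulrBr FE.
  rewrite factS natrM /pochhammer big_nat_recr//=.
  have p0 : \prod_(0 <= j < a) (mu + j%:R) != 0 by rewrite gt_eqF// pochhammer_gt0; lra.
  have a0 : mu + a%:R != 0 by rewrite gt_eqF//; lra.
  have a1 : a%:R + mu != 0 by rewrite addrC.
  have a2 : mu - 1 != 0 by rewrite gt_eqF.
  by field; rewrite ?p0 ?a0 ?a1 ?a2.
Qed.

Lemma radial_monomial_ge0 a (x : R) : 0 <= x < 1 -> 0 <= radial_monomial a x.
Proof. by move=> /andP[x0 _]; rewrite mulr_ge0 ?exprn_ge0// powR_ge0. Qed.

Lemma radial_moment a : measurable_fun (`[0%R, 1%R[%classic : set R) (radial_monomial a) /\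
  (\int[leb]_(x in `[0%R, 1%R[) (radial_monomial a x)%:E =
   (a`!%:R / pochhammer mu a / (2 * (mu - 1)))%:E)%E.
Proof.
have [F [dF F1 <-]] := radial_primitive a; apply: improper_FTC => //.
  exact: radial_monomial_ge0.
move=> x hx.
have h := is_derive1_powR (mu - 2) (pos hx).
have c : {for x, continuous ((fun y : R => y `^ (mu - 2)) \o (fun t : R => 1 - t ^+ 2))}.
  apply: continuous_comp.
    by apply: cvgB; [exact: cvg_cst|exact: exprn_continuous].
  exact/differentiable_continuous/derivable1_diffP/(@ex_derive _ _ _ _ _ _ _ h).
by apply: cvgM; [exact: exprn_continuous|exact: c].
Qed.

End radial_moments.

Section polar_weight.
Variables (R : realType) (mu : R).
Hypothesis mu1 : 1 < mu.
Local Notation C := R[i].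
Local Notation leb := (@lebesgue_measure R).

(** Cut off at r, so that integrals over smaller polydiscs keep the same form, with r = 1 for the
    whole polydisc; extended by 0, so that product integrals run over the full space. *)
Definition radial_weight (r : R) : R -> R :=
  (fun t => (mu - 1) / pi * radial_monomial mu 0 t) \_ `[0, r[%classic.

Definition angular_weight : R -> R := (fun=> 1 : R) \_ `[0, 2 * pi[%classic.

Lemma radial_weightE r t : radial_weight r t =
  if 0 <= t < r then (mu - 1) / pi * radial_monomial mu 0 t else 0.
Proof. by rewrite /radial_weight patchE mem_setE in_itv. Qed.

Lemma angular_weightE t : angular_weight t = (0 <= t < 2 * pi)%R%:R.
Proof. by rewrite /angular_weight patchE mem_setE in_itv /=; case: ifP. Qed.

Lemma radial_weight_ge0 r t : r <= 1 -> 0 <= radial_weight r t.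
Proof.
move=> r1; rewrite radial_weightE; case: ifP => // /andP[t0 tr].
rewrite mulr_ge0 ?divr_ge0 ?subr_ge0 ?pi_ge0 ?(ltW mu1)//.
by apply: radial_monomial_ge0; rewrite t0 (lt_le_trans tr).
Qed.

Lemma angular_weight_ge0 t : 0 <= angular_weight t.
Proof. by rewrite angular_weightE ler0n. Qed.

Lemma measurable_radial_monomial a : measurable_fun setT (radial_monomial mu a).
Proof.
apply: measurable_funM; first exact: exprn_measurable.
apply: (measurableT_comp (measurable_powR _)).
by apply: measurable_funB => //; exact: exprn_measurable.
Qed.

Lemma measurable_radial_weight r : measurable_fun setT (radial_weight r).
Proof.
apply/(measurable_restrictT _ _).1 => //; apply: measurable_funTS.
by apply: measurable_funM => //; exact: measurable_radial_monomial.
Qed.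

Lemma measurable_angular_weight : measurable_fun setT angular_weight.
Proof. exact/(measurable_restrictT _ _).1. Qed.

Let int_monomial a : leb.-integrable `[0%R, 1%R[ (EFin \o radial_monomial mu a).
Proof.
apply/integrableP; split.
  by apply/measurable_EFinP; apply: measurable_funTS; exact: measurable_radial_monomial.
apply: le_lt_trans (ltry (a`!%:R / pochhammer mu a / (2 * (mu - 1)))).
rewrite -(radial_moment mu1 a).2 le_eqVlt; apply/orP; left; apply/eqP.
apply: eq_integral => t; rewrite mem_setE in_itv => ht /=; rewrite ger0_norm//.
exact: radial_monomial_ge0.
Qed.

Let weight1_monomial a : (fun t => t ^+ a.*2 * radial_weight 1 t) =
  (fun t => (mu - 1) / pi * radial_monomial mu a t) \_ `[0, 1[%classic.
Proof.
apply/funext => t; rewrite patchE mem_setE in_itv /= radial_weightE.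
case: ifP => _; rewrite ?mulr0// /radial_monomial double0 expr1 !exprSr; ring.
Qed.

Lemma radial_integrable r k : r <= 1 ->
  leb.-integrable setT (EFin \o (fun t => t ^+ k * radial_weight r t)).
Proof.
move=> r1.
have h : leb.-integrable setT (EFin \o (fun t => t ^+ 0 * radial_weight 1 t)).
  rewrite (weight1_monomial 0) -[EFin \o _]restrict_EFin; apply: (integrable_mkcond _ _).1 => //.
  by apply: eq_integrable (integrableZl _ ((mu - 1) / pi) (int_monomial 0)) => // t _ /=; rewrite EFinM.
apply: le_integrable h => //.
  apply/measurable_EFinP/measurable_funM; first exact: exprn_measurable.
  exact: measurable_radial_weight.
move=> t _; rewrite lee_fin expr0 mul1r normrM normrX.
rewrite (ger0_norm (radial_weight_ge0 t (lexx 1))) (ger0_norm (radial_weight_ge0 t r1)).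
have := radial_weight_ge0 t (lexx 1); rewrite !radial_weightE.
case: (boolP (0 <= t < r)) => [/andP[t0 tr]|_ ht]; last by rewrite mulr0.
have t1 := lt_le_trans tr r1; rewrite t0 t1 /= => ht.
by rewrite ger0_norm// ler_piMl// exprn_ile1// ltW.
Qed.

Lemma radial_weight_moment a : \int[leb]_t (t ^+ a.*2 * radial_weight 1 t) =
  a`!%:R / pochhammer mu a / (2 * pi).
Proof.
rewrite weight1_monomial -Rintegral_mkcond RintegralZl//.
rewrite /Rintegral (radial_moment mu1 a).2 /=.
have p0 : pochhammer mu a != 0 by rewrite gt_eqF// pochhammer_gt0// (lt_trans _ mu1).
have pi0 : (pi : R) != 0 by rewrite gt_eqF// pi_gt0.
have m0 : mu - 1 != 0 by rewrite subr_eq0 gt_eqF.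
move: (pi : R) pi0 => x x0; field; by rewrite ?p0 ?x0 ?m0.
Qed.

Lemma angular_cis (k : int) :
  cintegrable leb setT (fun t => (angular_weight t)%:C * cis (k%:~R * t)) /\
  cintegral leb setT (fun t => (angular_weight t)%:C * cis (k%:~R * t)) =
  if k == 0 then (2 * pi)%:C else 0.
Proof.
have pi0 : 0 <= 2 * pi :> R by rewrite mulr_ge0// pi_ge0.
have [hr hi] : cintegrable leb `[0, 2 * pi] (fun t => cis (k%:~R * t)).
  apply: icontinuous_integrable; apply: continuous_icontinuous.
  exact: continuous_cisM.
have {}hr : leb.-integrable `[0%R, (2 * pi)%R[ (EFin \o (fun t => complex.Re (cis (k%:~R * t)))).
  by apply: integrableS hr => //; apply: subset_itvl; rewrite bnd_simp.
have {}hi : leb.-integrable `[0%R, (2 * pi)%R[ (EFin \o (fun t => complex.Im (cis (k%:~R * t)))).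
  by apply: integrableS hi => //; apply: subset_itvl; rewrite bnd_simp.
have eR : (fun t => complex.Re ((angular_weight t)%:C * cis (k%:~R * t))) =
    (fun t => complex.Re (cis (k%:~R * t))) \_ `[0, 2 * pi[%classic.
  apply/funext => t; rewrite patchE mem_setE in_itv angular_weightE ReM /=.
  by case: ifP => _; rewrite ?mul1r ?mul0r ?subr0.
have eI : (fun t => complex.Im ((angular_weight t)%:C * cis (k%:~R * t))) =
    (fun t => complex.Im (cis (k%:~R * t))) \_ `[0, 2 * pi[%classic.
  apply/funext => t; rewrite patchE mem_setE in_itv angular_weightE ImM /=.
  by case: ifP => _; rewrite ?mul1r ?mul0r ?addr0.
split.
  split; rewrite ?eR ?eI -[EFin \o _]restrict_EFin; exact: (integrable_mkcond _ _).1.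
rewrite -itvint_cis_period; apply: complex_eq => /=.
  by rewrite eR -Rintegral_mkcond Rintegral_itv_bndo_bndc.
by rewrite eI -Rintegral_mkcond Rintegral_itv_bndo_bndc.
Qed.

Definition root_weight (r : R) (x : R * R) : R :=
  Num.sqrt (radial_weight r x.1 * angular_weight x.2).

Lemma sqr_root_weight r x : r <= 1 ->
  root_weight r x ^+ 2 = radial_weight r x.1 * angular_weight x.2.
Proof.
by move=> r1; rewrite sqr_sqrtr// mulr_ge0 ?radial_weight_ge0 ?angular_weight_ge0.
Qed.

Definition polar_coord (x : R * R) : C := x.1%:C * cis x.2.

(** The squared norm of z^a in one variable over the disc of radius r. *)
Definition radial_norm (r : R) (a : nat) : R :=
  2 * pi * \int[leb]_t (t ^+ a.*2 * radial_weight r t).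

Lemma radial_norm1 a : radial_norm 1 a = a`!%:R / pochhammer mu a.
Proof.
by rewrite /radial_norm radial_weight_moment mulrC divfK// mulf_neq0// gt_eqF// pi_gt0.
Qed.

(** The weight does not depend on the angle, so the angular factor is an integral of
    [cis ((a - b) t)] over a period. Hence monomials are orthogonal for every cutoff r, not only for
    r = 1. *)
Lemma polar_moment r a b : r <= 1 ->
  let F x := polar_coord x ^+ a * Num.conj (polar_coord x ^+ b) *
             (root_weight r x ^+ 2)%:C in
  cintegrable (sf_measure (sf_polar R)) setT F /\
  cintegral (sf_measure (sf_polar R)) setT F = (a == b)%:R * (radial_norm r a)%:C.
Proof.
move=> r1 F.
pose k : int := a%:Z - b%:Z.
have [h1 e1] := angular_cis k.
pose g (t : R) : C := (t ^+ (a + b) * radial_weight r t)%:C.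
have h2 : cintegrable leb setT g by split; [exact: radial_integrable|exact: integrable0].
have [h3 e3] := cintegral_prod h2 h1.
have FE : F = fun x => g x.1 * ((angular_weight x.2)%:C * cis (k%:~R * x.2)).
  apply/funext => x.
  have cE : Num.conj (polar_coord x ^+ b) = x.1%:C ^+ b * cis (b%:R * - x.2).
    have -> : x.1%:C ^+ b * cis (b%:R * - x.2) = Num.conj (polar_coord x) ^+ b.
      rewrite -cisX -exprMn; congr (_ ^+ _); apply: complex_eq => /=; rewrite ?cosN ?sinN; ring.
    exact: rmorphXn.
  rewrite /F /g sqr_root_weight// cE /polar_coord exprMn cisX.
  have -> : cis (k%:~R * x.2) = cis (a%:R * x.2) * cis (b%:R * - x.2).
    by rewrite -cisD mulrN -mulrBl /k rmorphB.
  rewrite !rmorphM !rmorphXn exprD; ring.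
rewrite FE; split; first exact: h3.
apply: etrans e3 _; rewrite e1.
have -> : cintegral leb setT g = (\int[leb]_t (t ^+ (a + b) * radial_weight r t))%:C.
  by apply: complex_eq => //=; rewrite /Rintegral /= integral0.
rewrite /k subr_eq0 eqz_nat; case: eqP => [<-|_]; last by rewrite mulr0 mul0r.
by rewrite mul1r -rmorphM addnn mulrC.
Qed.

End polar_weight.

(** * Square integrable functions *)

Section complex_measurability.
Context d (T : measurableType d) (R : realType).
Local Notation C := R[i].
Implicit Types F G : T -> C.

Definition cmeasurable F :=
  measurable_fun setT (fun x => complex.Re (F x)) /\
  measurable_fun setT (fun x => complex.Im (F x)).

Lemma eq_cmeasurable F G : F =1 G -> cmeasurable F -> cmeasurable G.
Proof. by move/funext ->. Qed.

Lemma cmeasurable_cst (z : C) : cmeasurable (fun=> z).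
Proof. by split; exact: measurable_cst. Qed.

Lemma cmeasurable_real (f : T -> R) : measurable_fun setT f ->
  cmeasurable (fun x => (f x)%:C).
Proof. by move=> mf; split=> //; exact: measurable_cst. Qed.

Lemma cmeasurableD F G : cmeasurable F -> cmeasurable G ->
  cmeasurable (fun x => F x + G x).
Proof.
move=> [fr fi] [gr gi]; split.
  by under eq_fun do rewrite ReD; exact: measurable_funD.
by under eq_fun do rewrite ImD; exact: measurable_funD.
Qed.

Lemma cmeasurableM F G : cmeasurable F -> cmeasurable G ->
  cmeasurable (fun x => F x * G x).
Proof.
move=> [fr fi] [gr gi]; split.
  under eq_fun do rewrite ReM.
  by apply: measurable_funB; exact: measurable_funM.
under eq_fun do rewrite ImM.
by apply: measurable_funD; exact: measurable_funM.
Qed.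

Lemma cmeasurable_conj F : cmeasurable F -> cmeasurable (fun x => Num.conj (F x)).
Proof.
move=> [fr fi]; split; first by apply: eq_measurable_fun fr => x _; case: (F x).
apply: (@eq_measurable_fun _ _ _ _ _ (fun x => - complex.Im (F x))).
  by move=> x _; case: (F x).
exact: measurableT_comp.
Qed.

Lemma cmeasurable_sum (I : Type) (s : seq I) (F : I -> T -> C) :
  (forall i, cmeasurable (F i)) -> cmeasurable (fun x => \sum_(i <- s) F i x).
Proof.
move=> mF; elim: s => [|i s ih].
  by apply: eq_cmeasurable (cmeasurable_cst 0) => x; rewrite big_nil.
by apply: eq_cmeasurable (cmeasurableD (mF i) ih) => x; rewrite big_cons.
Qed.

Lemma cmeasurable_prod (I : Type) (s : seq I) (F : I -> T -> C) :
  (forall i, cmeasurable (F i)) -> cmeasurable (fun x => \prod_(i <- s) F i x).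
Proof.
move=> mF; elim: s => [|i s ih].
  by apply: eq_cmeasurable (cmeasurable_cst 1) => x; rewrite big_nil.
by apply: eq_cmeasurable (cmeasurableM (mF i) ih) => x; rewrite big_cons.
Qed.

Lemma cmeasurableX F k : cmeasurable F -> cmeasurable (fun x => F x ^+ k).
Proof.
move=> mF; apply: (@eq_cmeasurable (fun x => \prod_(i < k) F x)).
  by move=> x; rewrite prodr_const card_ord.
by apply: cmeasurable_prod.
Qed.

Lemma cmeasurable_cvg (F_ : nat -> T -> C) F : (forall k, cmeasurable (F_ k)) ->
  (forall x, (fun k => F_ k x) @ \oo --> F x) -> cmeasurable F.
Proof.
move=> mF cF; split; apply: measurable_fun_cvg => [k|x _].
- exact: (mF k).1.
- by apply: cvg_Re; exact: cF.
- exact: (mF k).2.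
- by apply: cvg_Im; exact: cF.
Qed.

Lemma sqr_normc (z : C) : normc z ^+ 2 = complex.Re z ^+ 2 + complex.Im z ^+ 2.
Proof. by case: z => a b /=; rewrite sqr_sqrtr// addr_ge0 ?sqr_ge0. Qed.

Lemma mulc_conj (z : C) : z * Num.conj z = (normc z ^+ 2)%:C.
Proof. by rewrite sqr_normc; case: z => a b; apply: complex_eq => /=; ring. Qed.

Lemma normc_conj (z : C) : normc (Num.conj z) = normc z.
Proof. by case: z => a b /=; rewrite sqrrN. Qed.

Lemma measurable_sqr_normc F : cmeasurable F ->
  measurable_fun setT (fun x => normc (F x) ^+ 2).
Proof.
move=> [fr fi]; under eq_fun do rewrite sqr_normc.
by apply: measurable_funD; exact: measurable_funX.
Qed.

End complex_measurability.

Section square_integrable.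
Context d (T : measurableType d) (R : realType) (m : {measure set T -> \bar R}).
Local Notation C := R[i].
Implicit Types F G : T -> C.

Definition sqint F := cmeasurable F /\
  m.-integrable setT (EFin \o (fun x => normc (F x) ^+ 2)).

Definition l2dot F G : C := cintegral m setT (fun x => F x * Num.conj (G x)).

Lemma eq_sqint F G : F =1 G -> sqint F -> sqint G.
Proof. by move/funext ->. Qed.

Lemma le_sqint F G : cmeasurable F -> sqint G ->
  (forall x, normc (F x) <= normc (G x)) -> sqint F.
Proof.
move=> mF [_ iG] FG; split=> //; apply: le_integrable iG => //.
  exact/measurable_EFinP/measurable_sqr_normc.
move=> x _; rewrite lee_fin !ger0_norm ?exprn_ge0 ?normc_ge0//.
by rewrite ler_pXn2r ?nnegrE ?normc_ge0.
Qed.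

Lemma sqint_comb (a : C) F G : sqint F -> sqint G -> sqint (fun x => a * F x + G x).
Proof.
move=> [mF iF] [mG iG].
have mFG : cmeasurable (fun x => a * F x + G x).
  by apply: cmeasurableD => //; apply: cmeasurableM => //; exact: cmeasurable_cst.
split=> //.
have h := integrableD measurableT (integrableZl measurableT (2 * normc a ^+ 2) iF)
  (integrableZl measurableT 2 iG).
apply: le_integrable h => //.
  exact/measurable_EFinP/measurable_sqr_normc.
move=> x _; change (`|(normc (a * F x + G x) ^+ 2)%:E| <=
  `|(2 * normc a ^+ 2 * normc (F x) ^+ 2 + 2 * normc (G x) ^+ 2)%:E|)%E.
rewrite lee_fin !ger0_norm ?exprn_ge0 ?normc_ge0//; last first.
  by rewrite addr_ge0// !mulr_ge0// ?exprn_ge0 ?normc_ge0.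
apply: (@le_trans _ _ ((normc a * normc (F x) + normc (G x)) ^+ 2)).
  rewrite ler_pXn2r ?nnegrE ?normc_ge0 ?addr_ge0 ?mulr_ge0 ?normc_ge0//.
  by rewrite -normcM le_normcD.
have := sqr_ge0 (normc a * normc (F x) - normc (G x)); nra.
Qed.

Lemma sqint_cintegrable F G : sqint F -> sqint G ->
  cintegrable m setT (fun x => F x * Num.conj (G x)).
Proof.
move=> [mF iF] [mG iG].
have [mr mi] := cmeasurableM mF (cmeasurable_conj mG).
have h := integrableD measurableT iF iG.
have le x : normc (F x * Num.conj (G x)) <= normc (F x) ^+ 2 + normc (G x) ^+ 2.
  rewrite normcM normc_conj.
  have := sqr_ge0 (normc (F x) - normc (G x)).
  have := mulr_ge0 (normc_ge0 (F x)) (normc_ge0 (G x)); nra.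
have h0 x : 0 <= normc (F x) ^+ 2 + normc (G x) ^+ 2.
  by rewrite addr_ge0// exprn_ge0// normc_ge0.
split; apply: le_integrable h => //; try exact/measurable_EFinP; move=> x _.
  change (`|(complex.Re (F x * Num.conj (G x)))%:E| <=
    `|(normc (F x) ^+ 2 + normc (G x) ^+ 2)%:E|)%E.
  rewrite lee_fin (ger0_norm (h0 x)); exact: le_trans (Re_le_normc _) (le x).
change (`|(complex.Im (F x * Num.conj (G x)))%:E| <=
  `|(normc (F x) ^+ 2 + normc (G x) ^+ 2)%:E|)%E.
rewrite lee_fin (ger0_norm (h0 x)); exact: le_trans (Im_le_normc _) (le x).
Qed.

Lemma l2dot_comb (a : C) F G K : sqint F -> sqint G -> sqint K ->
  l2dot (fun x => a * F x + G x) K = a * l2dot F K + l2dot G K.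
Proof.
move=> hF hG hK; rewrite /l2dot -cintegralZ//; last exact: sqint_cintegrable.
rewrite -cintegralD//; last 2 first.
- by apply: cintegrableZ => //; exact: sqint_cintegrable.
- exact: sqint_cintegrable.
by apply: eq_cintegral => x _; rewrite mulrDl mulrA.
Qed.

Lemma l2dotC F G : sqint F -> sqint G -> l2dot G F = Num.conj (l2dot F G).
Proof.
move=> hF hG; rewrite /l2dot -conj_cintegral//; last exact: sqint_cintegrable.
apply: eq_cintegral => x _; apply: complex_eq; case: (F x) => a b; case: (G x) => a' b' /=; ring.
Qed.

Lemma l2dot_diag F : l2dot F F = (\int[m]_x normc (F x) ^+ 2)%:C.
Proof.
rewrite /l2dot /cintegral; apply: complex_eq => /=.
  by apply: eq_Rintegral => x _; rewrite mulc_conj.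
rewrite (@eq_Rintegral _ _ _ _ _ (fun=> 0)); last by move=> x _; rewrite mulc_conj.
by rewrite /Rintegral integral0.
Qed.

Lemma l2dot_ge0 F : 0 <= l2dot F F.
Proof. by rewrite l2dot_diag ler0c Rintegral_ge0// => x _; rewrite exprn_ge0// normc_ge0. Qed.

End square_integrable.

Section tuple_coordinates.
Variables (R : realType) (S : sfspace R).

Lemma measurable_sf_tuple n (i : 'I_n) :
  measurable_fun setT (fun x : sf_sort (sf_pow S n) => tnth (sf_tuple x) i).
Proof.
elim: n i => [[]//|n ih i].
have [j ->|->] := unliftP ord0 i.
  have -> : (fun x : sf_sort (sf_pow S n.+1) => tnth (sf_tuple x) (lift ord0 j)) =
      (fun x : sf_sort (sf_pow S n) => tnth (sf_tuple x) j) \o snd.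
    by apply/funext => -[x y] /=; rewrite tnthS.
  by apply: measurableT_comp; [exact: ih|exact: measurable_snd].
exact: measurable_fst.
Qed.

End tuple_coordinates.

Section polydisc_weight.
Variables (R : realType) (n : nat) (mu : R).
Hypothesis mu1 : 1 < mu.
Local Notation C := R[i].
Local Notation X := (sf_sort (sf_pow (sf_polar R) n)).
Local Notation m := (sf_measure (sf_pow (sf_polar R) n)).
Implicit Types (x : X) (r : R) (a b : 'I_n -> nat).

Definition root_density r x : R := \prod_i root_weight mu r (tnth (sf_tuple x) i).

Lemma polar_pointE x i : polar_point x 0 i = polar_coord (tnth (sf_tuple x) i).
Proof.
rewrite mxE /polar_coord /Defs.radius /Defs.angle; case: (tnth _ _) => u v.
by apply: complex_eq => /=; ring.
Qed.

Lemma root_weight_ge0 r (y : R * R) : 0 <= root_weight mu r y.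
Proof. exact: sqrtr_ge0. Qed.

Lemma root_density_ge0 r x : 0 <= root_density r x.
Proof. by apply: prodr_ge0 => i _; exact: root_weight_ge0. Qed.

Lemma root_weightP r (y : R * R) : root_weight mu r y != 0 ->
  0 <= y.1 < r /\ 0 <= y.2 < 2 * pi.
Proof.
rewrite /root_weight radial_weightE angular_weightE => y0; split.
  by apply/negPn/negP => /negbTE h; move: y0; rewrite h mul0r sqrtr0 eqxx.
by apply/negPn/negP => /negbTE h; move: y0; rewrite h mulr0 sqrtr0 eqxx.
Qed.

Lemma root_densityP r x : root_density r x != 0 ->
  forall i, 0 <= Defs.radius x i < r /\ 0 <= Defs.angle x i < 2 * pi.
Proof. by move/prodf_neq0 => h i; exact: root_weightP (h i isT). Qed.

Lemma root_density_cpolydisc r x : root_density r x != 0 -> cpolydisc r (polar_point x).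
Proof.
move=> h i; have [/andP[x0 xr] _] := root_densityP h i.
rewrite polar_pointE /polar_coord normcM normc_cis normc_real mulr1.
by rewrite ger0_norm// ltW.
Qed.

Lemma root_density_box x : root_density 1 x != 0 -> polar_box x.
Proof. exact: root_densityP. Qed.

Lemma root_density_eq r x : r <= 1 -> (forall i, Defs.radius x i < r) ->
  root_density r x = root_density 1 x.
Proof.
move=> r1 xr; apply: eq_bigr => i _; rewrite /root_weight !radial_weightE.
by have := xr i; rewrite /Defs.radius => h; rewrite h (lt_le_trans h r1).
Qed.

Lemma root_weight_le r (y : R * R) : r <= 1 -> root_weight mu r y <= root_weight mu 1 y.
Proof.
move=> r1; have [->|/root_weightP[/andP[y0 yr] _]] := eqVneq (root_weight mu r y) 0.
  exact: root_weight_ge0.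
by rewrite /root_weight !radial_weightE y0 yr (lt_le_trans yr r1).
Qed.

Lemma root_density_le r x : r <= 1 -> root_density r x <= root_density 1 x.
Proof.
by move=> r1; apply: ler_prod => i _; rewrite root_weight_ge0 root_weight_le.
Qed.

Lemma sqr_root_density x : polar_box x -> root_density 1 x ^+ 2 = polar_density mu x.
Proof.
move=> h; rewrite /root_density -prodrXl /polar_density -[X in _ ^+ X](card_ord n).
rewrite -prodr_const -big_split /=; apply: eq_bigr => i _.
have [hr ha] := h i; rewrite sqr_root_weight// radial_weightE angular_weightE.
rewrite /Defs.radius /Defs.angle in hr ha; rewrite hr ha mulr1 /radial_monomial double0 expr1.
by rewrite /Defs.radius; congr (_ * _); rewrite mulrC.
Qed.

Lemma measurable_root_weight r : measurable_fun setT (root_weight mu r).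
Proof.
apply: (measurableT_comp (continuous_measurable_fun (@sqrt_continuous R))).
apply: measurable_funM.
  by apply: (measurableT_comp (measurable_radial_weight mu r)); exact: measurable_fst.
apply: (@measurableT_comp _ _ _ _ _ _ (@angular_weight R) _ (fun x : R * R => x.2)).
  exact: measurable_angular_weight.
exact: measurable_snd.
Qed.

Lemma measurable_root_density r : measurable_fun setT (root_density r).
Proof.
apply: measurable_prod => i _.
by apply: (measurableT_comp (measurable_root_weight r)); exact: measurable_sf_tuple.
Qed.

Lemma cmeasurable_polar_point i : cmeasurable (fun x => polar_point x 0 i).
Proof.
apply: (@eq_cmeasurable _ _ _ (fun x => polar_coord (tnth (sf_tuple x) i))).
  by move=> x; rewrite polar_pointE.
have mt := @measurable_sf_tuple R (sf_polar R) n i.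
have m1 := measurableT_comp (@measurable_fst _ _ _ _) mt.
have m2 := measurableT_comp (@measurable_snd _ _ _ _) mt.
apply: cmeasurableM; first exact: cmeasurable_real.
split; first by apply: (measurableT_comp _ m2); apply: continuous_measurable_fun; exact: continuous_cos.
by apply: (measurableT_comp _ m2); apply: continuous_measurable_fun; exact: continuous_sin.
Qed.

Lemma monomial_moment r a b : r <= 1 ->
  let F x := \prod_i polar_point x 0 i ^+ a i *
             Num.conj (\prod_i polar_point x 0 i ^+ b i) * (root_density r x ^+ 2)%:C in
  cintegrable m setT F /\
  cintegral m setT F = \prod_i ((a i == b i)%:R * (radial_norm mu r (a i))%:C).
Proof.
move=> r1 F.
pose phi i (y : R * R) := polar_coord y ^+ a i * Num.conj (polar_coord y ^+ b i) *
             (root_weight mu r y ^+ 2)%:C.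
have [h e] := @cintegral_pow R (sf_polar R) n phi (fun i => (polar_moment mu1 (a i) (b i) r1).1).
have FE : F = fun x => \prod_i phi i (tnth (sf_tuple x) i).
  apply/funext => x; rewrite /F /root_density -prodrXl rmorph_prod [(_)%:C]rmorph_prod /=.
  rewrite -!big_split /=; apply: eq_bigr => i _.
  by rewrite polar_pointE.
rewrite FE; split; first exact: h.
apply: etrans e _; apply: eq_bigr => i _; exact: (polar_moment mu1 (a i) (b i) r1).2.
Qed.

End polydisc_weight.

(** * The weighted Bergman space *)

Section alternant_moments.
Variables (R : realType) (n : nat) (mu : R).
Hypothesis mu1 : 1 < mu.
Local Notation C := R[i].
Local Notation X := (sf_sort (sf_pow (sf_polar R) n)).
Local Notation m := (sf_measure (sf_pow (sf_polar R) n)).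
Implicit Types (x : X) (r : R) (p q : npart n).

Definition shifted p (j : 'I_n) : nat := (part p j + delta j)%N.

(** A strictly decreasing sequence is determined by its set of values, which gives p = q; its
    entries being distinct, the permutations then agree. *)
Lemma shifted_perm_inj p q (s t : 'S_n) :
  (forall i, shifted p (s i) = shifted q (t i)) -> p = q /\ s = t.
Proof.
move=> e; pose tp p := [tuple shifted p j | j < n].
have tp_sorted p' : sorted geq (tp p').
  apply/(sortedP 0%N) => i; rewrite size_tuple => iSn.
  have iln : (i < n)%N by exact: ltnW.
  rewrite -(tnth_nth 0%N (tp p') (Ordinal iSn)) -(tnth_nth 0%N (tp p') (Ordinal iln)).
  rewrite !tnth_mktuple; apply: ltnW.
  exact: (@part_delta_lt n p' (Ordinal iln) (Ordinal iSn)).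
have tpq : tp p = tp q.
  apply: val_inj; apply: (@sorted_eq _ geq) => //.
  - by move=> a b c ab bc; exact: leq_trans bc ab.
  - by move=> a b /= h; apply/eqP; rewrite eqn_leq andbC.
  - exact: tp_sorted.
  - exact: tp_sorted.
  - apply/tuple_permP; exists (s^-1 * t)%g; congr (val _); apply: eq_from_tnth => i.
    by rewrite !tnth_mktuple permM -e permKV.
have pq : p = q.
  apply: npart_inj => j; have := congr1 (fun u => tnth u j) tpq.
  by rewrite !tnth_mktuple /shifted => /addIn.
split=> //; apply/permP => i; apply: (@part_delta_inj n p).
by have := e i; rewrite -pq.
Qed.

(** Expanding both determinants gives pairs of permutations, and orthogonality of monomials leaves
    the pairs s = t, with p = q; these are n! equal terms, their two signs cancelling. *)
Lemma alt_moment r p q : r <= 1 ->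
  let F x := alt_det (shifted p) (polar_point x) *
    Num.conj (alt_det (shifted q) (polar_point x)) * (root_density mu r x ^+ 2)%:C in
  cintegrable m setT F /\
  cintegral m setT F =
    (p == q)%:R * (n`!%:R * \prod_j radial_norm mu r (shifted p j))%:C.
Proof.
move=> r1 F.
pose G (s t : 'S_n) x := \prod_i polar_point x 0 i ^+ shifted p (s i) *
  Num.conj (\prod_i polar_point x 0 i ^+ shifted q (t i)) * (root_density mu r x ^+ 2)%:C.
have [Gi Ge] : (forall s t, cintegrable m setT (G s t)) /\
    forall s t, cintegral m setT (G s t) = \prod_i
    ((shifted p (s i) == shifted q (t i))%:R * (radial_norm mu r (shifted p (s i)))%:C).
  by split=> s t; have [h1 h2] :=
    @monomial_moment R n mu mu1 r (fun i => shifted p (s i)) (fun i => shifted q (t i)) r1.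
(* Summing over inverses attaches the permutation to the exponents instead of the variables, as
   [monomial_moment] expects. *)
have altE p' x : alt_det (shifted p') (polar_point x) =
    \sum_(s : 'S_n) (-1) ^+ s * \prod_i polar_point x 0 i ^+ shifted p' (s i).
  rewrite alt_detE (reindex_inj invg_inj) /=; apply: eq_bigr => s _.
  rewrite odd_permV; congr (_ * _); rewrite (reindex_inj (@perm_inj _ s)) /=.
  by apply: eq_bigr => i _; rewrite permK.
have alg (a b u v w : C) : a * u * (b * v) * w = a * b * (u * v * w) by ring.
have FE : F = fun x => \sum_(s : 'S_n) \sum_(t : 'S_n) ((-1) ^+ s * (-1) ^+ t) * G s t x.
  apply/funext => x; rewrite /F !altE rmorph_sum /= mulr_suml mulr_suml.
  apply: eq_bigr => s _; rewrite mulr_sumr mulr_suml; apply: eq_bigr => t _.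
  by rewrite rmorphM rmorph_sign; exact: alg.
have Hi (s t : 'S_n) : cintegrable m setT (fun x => (-1) ^+ s * (-1) ^+ t * G s t x).
  exact: cintegrableZ.
have Hs (s : 'S_n) : cintegrable m setT
    (fun x => \sum_(t : 'S_n) ((-1) ^+ s * (-1) ^+ t) * G s t x).
  exact: cintegrable_sum.
rewrite FE; split; first exact: cintegrable_sum.
rewrite cintegral_sum//.
set u := \prod_j radial_norm mu r (shifted p j).
have -> : (p == q)%:R * (n`!%:R * u)%:C =
    \sum_(s : 'S_n) \sum_(t : 'S_n) ((p == q) && (s == t))%:R * u%:C.
  rewrite (eq_bigr (fun=> (p == q)%:R * u%:C)) => [|s _].
    by rewrite sumr_const card_Sn rmorphM rmorph_nat mulrCA -[RHS]mulr_natl.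
  rewrite (bigD1 s)//= eqxx andbT big1 ?addr0// => t /negbTE ts.
  by rewrite (eq_sym s) ts andbF mul0r.
apply: eq_bigr => s _; rewrite cintegral_sum//; apply: eq_bigr => t _.
rewrite cintegralZ// Ge big_split /=.
case: (pickP (fun i => shifted p (s i) != shifted q (t i))) => [i ni|h].
  rewrite (bigD1 i)//= (negbTE ni) !mul0r mulr0.
  case: andP => [[/eqP pq /eqP st]|_]; last by rewrite mul0r.
  by move: ni; rewrite pq st eqxx.
have h' i : shifted p (s i) = shifted q (t i) by apply/eqP/negbFE/h.
have [pq st] := shifted_perm_inj h'; rewrite -pq st.
rewrite !eqxx /= -signr_addb addbb !mul1r big1 => [|i _]; last by rewrite eqxx.
by rewrite mul1r /u rmorph_prod /= [RHS](reindex_inj (@perm_inj _ t)).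
Qed.

End alternant_moments.

Lemma invn_lt (R : realType) (e : R) : 0 < e ->
  exists N, forall k, (N <= k)%N -> k.+1%:R^-1 < e.
Proof.
by move=> e0; have [N _ NP] := @near_infty_natSinv_lt R (PosNum e0); exists N.
Qed.

(** * Bergman functions as square integrable functions *)

Section weighted_pullback.
Variables (R : realType) (n : nat) (mu : R).
Hypothesis mu1 : 1 < mu.
Local Notation C := R[i].
Local Notation X := (sf_sort (sf_pow (sf_polar R) n)).
Local Notation m := (sf_measure (sf_pow (sf_polar R) n)).
Implicit Types (x : X) (r : R) (p q : npart n) (f g : 'rV[C]_n -> C).

Definition pullback f (z : 'rV[C]_n) : C := f (symmetrization z) * vdm z.

(* The square root of the density is absorbed in the function, so that the Bergman inner product becomes
   an unweighted one on the whole product space. *)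
Definition weighted_pullback r f x : C :=
  pullback f (polar_point x) * (root_density mu r x)%:C.

Lemma pullback_conj_det p : exists b : bool, forall z,
  pullback (fun u => conj_det p u) z = (-1) ^+ b * alt_det (shifted p) z.
Proof.
have [b e] := @alt_det_conj_det R n p; exists b => z.
by rewrite e mulrA -signr_addb addbb mul1r.
Qed.

Lemma cmeasurable_pullback_conj_det p :
  cmeasurable (fun x => pullback (fun u => conj_det p u) (polar_point x)).
Proof.
have [b e] := pullback_conj_det p.
apply: (@eq_cmeasurable _ _ _ (fun x => (-1) ^+ b * \sum_(s : 'S_n) (-1) ^+ s *
   \prod_j polar_point x 0 (s j) ^+ shifted p j)).
  by move=> x; rewrite e alt_detE.
apply: cmeasurableM; first exact: cmeasurable_cst.
apply: cmeasurable_sum => s; apply: cmeasurableM; first exact: cmeasurable_cst.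
by apply: cmeasurable_prod => j; apply: cmeasurableX; exact: cmeasurable_polar_point.
Qed.

Definition exhaust_radius (k : nat) : R := 1 - k.+1%:R^-1.
Local Notation rho := exhaust_radius.

Lemma exhaust_radius_ge0 k : 0 <= rho k.
Proof. by rewrite subr_ge0 invf_le1 ?ler1n ?ltr0n. Qed.

Lemma exhaust_radius_lt1 k : rho k < 1.
Proof. by rewrite ltrBlDr ltrDl invr_gt0. Qed.

Lemma polar_box_exhaustion x : polar_box x -> exists N, forall k, (N <= k)%N ->
  forall i, Defs.radius x i < rho k.
Proof.
move=> bx.
have h (i : 'I_n) : exists N, forall k, (N <= k)%N -> Defs.radius x i < rho k.
  have [/andP[_ xi] _] := bx i.
  have e0 : 0 < 1 - Defs.radius x i by rewrite subr_gt0.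
  have [N NP] := invn_lt e0.
  by exists N => k Nk; have := NP k Nk; rewrite ltrBrDl -ltrBrDr.
have [N NP] := choice h.
exists (\max_i N i)%N => k Nk i; apply: NP.
exact: leq_trans (leq_bigmax i) Nk.
Qed.

(* Measurability comes from polynomial approximation on an exhaustion of the polydisc, since continuity
   is not related to the product sigma-algebra of [sf_pow]. *)
Lemma cmeasurable_weighted_pullback r f : r <= 1 ->
  holomorphic_on (@sym_polydisc R n) f -> cmeasurable (weighted_pullback r f).
Proof.
move=> r1 fhol.
have /choice[s sP] k : exists s : seq (C * npart n), forall z, cpolydisc (rho k) z ->
    normc (pullback f z - \sum_(y <- s) y.1 * pullback (fun u => conj_det y.2 u) z) <= k.+1%:R^-1.
  by apply: holomorphic_approx => //; rewrite ?invr_gt0 ?exhaust_radius_ge0 ?exhaust_radius_lt1.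
pose F_ k x := (\sum_(y <- s k) y.1 * pullback (fun u => conj_det y.2 u) (polar_point x)) *
  (root_density mu r x)%:C.
apply: (@cmeasurable_cvg _ _ _ F_).
  move=> k; apply: cmeasurableM; last exact/cmeasurable_real/measurable_root_density.
  apply: cmeasurable_sum => y; apply: cmeasurableM; first exact: cmeasurable_cst.
  exact: cmeasurable_pullback_conj_det.
move=> x; have [d0|d0] := eqVneq (root_density mu r x) 0.
  rewrite /weighted_pullback d0 mulr0; apply: cvg_near_cst.
  by apply: nearW => k; rewrite /F_ d0 mulr0.
have bx : polar_box x.
  move=> i; have [/andP[h0 h1] h2] := root_densityP d0 i.
  by rewrite h0 (lt_le_trans h1 r1).
have [N NP] := polar_box_exhaustion bx.
apply: cvgM; last exact: cvg_cst.
apply/cvg_complexP => e e0.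
have [N' N'P] := invn_lt e0.
exists (maxn N N') => // k /=; rewrite geq_max => /andP[Nk N'k].
rewrite normcB; apply: le_lt_trans (N'P k N'k); apply: sP => i.
have [/andP[h0 _] _] := bx i.
rewrite polar_pointE /polar_coord normcM normc_cis normc_real mulr1.
by rewrite ger0_norm// ltW// NP.
Qed.

Lemma normc_weighted_pullback r f x :
  normc (weighted_pullback r f x) = normc (pullback f (polar_point x)) * root_density mu r x.
Proof. by rewrite normcM normc_real ger0_norm// root_density_ge0. Qed.

Lemma sqint_root_density r (c : R) : r <= 1 -> 0 <= c ->
  sqint m (fun x => (c * root_density mu r x)%:C).
Proof.
move=> r1 c0; split.
  by apply: cmeasurable_real; apply: measurable_funM => //; exact: measurable_root_density.
have [[h _] _] := @monomial_moment R n mu mu1 r (fun=> 0%N) (fun=> 0%N) r1.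
have := integrableZl measurableT (c ^+ 2) h.
apply: eq_integrable => // x _ /=; congr EFin.
rewrite expr0n addr0 sqr_sqrtr ?sqr_ge0// exprMn; congr (_ * _).
have -> : \prod_(i < n) polar_point x 0 i ^+ 0 = 1 by apply: big1 => i _; rewrite expr0.
by rewrite conjC1 !mul1r.
Qed.

Lemma sqint_bounded r f (M : R) : r <= 1 -> 0 <= M ->
  holomorphic_on (@sym_polydisc R n) f ->
  (forall x, root_density mu r x != 0 -> normc (pullback f (polar_point x)) <= M) ->
  sqint m (weighted_pullback r f).
Proof.
move=> r1 M0 fhol fM.
apply: le_sqint (sqint_root_density r1 M0) _.
  exact: cmeasurable_weighted_pullback.
move=> x; rewrite normc_weighted_pullback normc_real ger0_norm ?mulr_ge0 ?root_density_ge0//.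
have [->|d0] := eqVneq (root_density mu r x) 0; first by rewrite !mulr0.
by rewrite ler_wpM2r ?root_density_ge0// fM.
Qed.

Lemma sqint_weighted_pullback r f : r <= 1 -> holomorphic_on (@sym_polydisc R n) f ->
  sqint m (weighted_pullback 1 f) -> sqint m (weighted_pullback r f).
Proof.
move=> r1 fhol h; apply: le_sqint h _; first exact: cmeasurable_weighted_pullback.
move=> x; rewrite !normc_weighted_pullback ler_wpM2l ?normc_ge0//.
exact: root_density_le.
Qed.

Lemma weighted_pullbackM r f g x :
  weighted_pullback r f x * Num.conj (weighted_pullback r g x) =
  pullback f (polar_point x) * Num.conj (pullback g (polar_point x)) *
  (root_density mu r x ^+ 2)%:C.
Proof.
rewrite /weighted_pullback; move: (pullback f _) (pullback g _) (root_density mu r x).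
move=> [a b] [c d] y; apply: complex_eq => /=; ring.
Qed.

Lemma l2dot_conj_det r p q : r <= 1 ->
  l2dot m (weighted_pullback r (fun u => conj_det p u))
          (weighted_pullback r (fun u => conj_det q u)) =
  (p == q)%:R * (n`!%:R * \prod_j radial_norm mu r (shifted p j))%:C.
Proof.
move=> r1; have [i e] := alt_moment mu1 p q r1.
have [b be] := choice pullback_conj_det.
have -> : l2dot m (weighted_pullback r (fun u => conj_det p u))
          (weighted_pullback r (fun u => conj_det q u)) =
  cintegral m setT (fun x => ((-1) ^+ b p * (-1) ^+ b q) *
   (alt_det (shifted p) (polar_point x) * Num.conj (alt_det (shifted q) (polar_point x)) *
    (root_density mu r x ^+ 2)%:C)).
  apply: eq_cintegral => x _; rewrite weighted_pullbackM !be rmorphM rmorph_sign.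
  by rewrite mulrACA -!mulrA.
rewrite cintegralZ// e; case: eqP => [pq|_]; last by rewrite !mul0r mulr0.
by rewrite pq -signr_addb addbb mul1r.
Qed.

End weighted_pullback.

Section bergman_l2.
Variables (R : realType) (n : nat) (mu : R).
Hypothesis mu1 : 1 < mu.
Local Notation C := R[i].
Local Notation X := (sf_sort (sf_pow (sf_polar R) n)).
Local Notation m := (sf_measure (sf_pow (sf_polar R) n)).
Local Notation wp := (weighted_pullback mu).
Implicit Types (x : X) (r : R) (p q : npart n) (f g : 'rV[C]_n -> C).

Let dot_integrand f g z : C := f (symmetrization z) * Num.conj (g (symmetrization z)) *
  `|peval (vandermonde R n) z| ^+ 2.

Let dot_integrandE f g z :
  dot_integrand f g z = pullback f z * Num.conj (pullback g z).
Proof.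
rewrite /dot_integrand /pullback -[peval (vandermonde R n) z]/(vdm z).
have -> : `|vdm z| ^+ 2 = vdm z * Num.conj (vdm z).
  by rewrite mulc_conj normrcE rmorphXn.
by rewrite rmorphM mulrACA.
Qed.

Let boxE f g x : polar_box x ->
  wp 1 f x * Num.conj (wp 1 g x) =
  dot_integrand f g (polar_point x) * (polar_density mu x)%:C.
Proof. by move=> bx; rewrite weighted_pullbackM sqr_root_density// dot_integrandE. Qed.

Let nboxE f g x : ~ polar_box x -> wp 1 f x * Num.conj (wp 1 g x) = 0.
Proof.
move=> bx; rewrite weighted_pullbackM; have -> : root_density mu 1 x = 0.
  by apply/eqP/negPn/negP => /root_density_box.
by rewrite expr0n mulr0.
Qed.

Let ReMr (z : C) (y : R) : complex.Re (z * y%:C) = complex.Re z * y.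
Proof. by case: z => a b; rewrite /= mulr0 subr0. Qed.

Let ImMr (z : C) (y : R) : complex.Im (z * y%:C) = complex.Im z * y.
Proof. by case: z => a b; rewrite /= mulr0 add0r. Qed.

Lemma bergman_dotE f g :
  bergman_dot mu f g = n`!%:R^-1 * l2dot m (wp 1 f) (wp 1 g).
Proof.
congr (_ * _); apply: complex_eq => /=; rewrite /dV_Rintegral Rintegral_mkcond;
  apply: eq_Rintegral => x _; rewrite patchE; case: ifPn => [/set_mem bx|bx].
- by rewrite boxE// ReMr.
- by rewrite nboxE//; move=> h; case/negP: bx; exact: mem_set.
- by rewrite boxE// ImMr.
- by rewrite nboxE//; move=> h; case/negP: bx; exact: mem_set.
Qed.

Lemma bergman_sqnormE f : holomorphic_on (@sym_polydisc R n) f ->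
  bergman_sqnorm mu f = ((n`!%:R^-1)%:E * \int[m]_x (normc (wp 1 f x) ^+ 2)%:E)%E.
Proof.
move=> fhol; congr (_ * _)%E; rewrite /dV_integral_ge0 integral_mkcond.
apply: eq_integral => x _; rewrite patchE; case: ifPn => [/set_mem bx|bx].
  congr EFin; rewrite -[RHS]/(complex.Re (normc (wp 1 f x) ^+ 2)%:C) -mulc_conj boxE// ReMr.
  by rewrite /dot_integrand mulc_conj normrcE rmorphXn.
have : wp 1 f x * Num.conj (wp 1 f x) = 0.
  by apply: nboxE => h; case/negP: bx; exact: mem_set.
by rewrite mulc_conj => /(congr1 (@complex.Re R)) /= ->.
Qed.

Lemma bergman_memP f : fs_mem (@bergman_space R n mu) f <->
  holomorphic_on (@sym_polydisc R n) f /\ sqint m (wp 1 f).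
Proof.
have n0 : 0 < n`!%:R^-1 :> R by rewrite invr_gt0 ltr0n fact_gt0.
split=> -[fhol h]; split=> //.
  split; first exact: cmeasurable_weighted_pullback.
  move: h; rewrite bergman_sqnormE// => h.
  have mf := cmeasurable_weighted_pullback mu (lexx 1) fhol.
  apply/integrableP; split; first exact/measurable_EFinP/measurable_sqr_normc.
  rewrite ltey; apply: contraTN h => /eqP.
  under eq_integral do rewrite /= ger0_norm ?exprn_ge0 ?normc_ge0//.
  by move=> ->; rewrite gt0_muley ?lte_fin// ltxx.
have [_ /integrableP[_ i]] := h; rewrite bergman_sqnormE//.
apply: lte_mul_pinfty; rewrite ?lee_fin ?ltW//.
move: i; under eq_integral do rewrite /= ger0_norm ?exprn_ge0 ?normc_ge0//.
done.
Qed.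

Local Notation rho := (@exhaust_radius R).

(** Dominated convergence. Polynomial approximation is uniform only on smaller polydiscs, so
    identities for general members of the space are proved there and passed to the limit by this
    lemma. *)
Lemma l2dot_exhaustion f g : fs_mem (@bergman_space R n mu) f ->
  fs_mem (@bergman_space R n mu) g ->
  (fun k => l2dot m (wp (rho k) f) (wp (rho k) g)) @ \oo --> l2dot m (wp 1 f) (wp 1 g).
Proof.
move=> /bergman_memP[fhol hf] /bergman_memP[ghol hg].
have hfk k := sqint_weighted_pullback (ltW (exhaust_radius_lt1 R k)) fhol hf.
have hgk k := sqint_weighted_pullback (ltW (exhaust_radius_lt1 R k)) ghol hg.
have [ur ui] := sqint_cintegrable hf hg.
pose F (k : nat) x := wp (rho k) f x * Num.conj (wp (rho k) g x).
pose F1 x := wp 1 f x * Num.conj (wp 1 g x).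
(* The squared ratio of the two root densities, with value 0 where the larger one vanishes: it lies
   in [0, 1] and at each point is eventually constant. *)
pose c k x : R := if root_density mu 1 x == 0 then 0
  else (root_density mu (rho k) x / root_density mu 1 x) ^+ 2.
have c0 k x : 0 <= c k x <= 1.
  rewrite /c; case: ifPn => [_|d0]; first by rewrite lexx ler01.
  have d1 : 0 < root_density mu 1 x by rewrite lt_def d0 root_density_ge0.
  rewrite exprn_ge0 ?divr_ge0 ?root_density_ge0//=.
  rewrite exprn_ile1 ?divr_ge0 ?root_density_ge0// ler_pdivrMr// mul1r.
  exact/root_density_le/ltW/exhaust_radius_lt1.
have FE k x : F k x = F1 x * (c k x)%:C.
  rewrite /F /F1 !weighted_pullbackM -[RHS]mulrA; congr (_ * _).
  rewrite -(rmorphM (real_complex R)); congr _%:C.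
  rewrite /c; case: eqP => [d0|/eqP d0].
    have -> : root_density mu (rho k) x = 0.
      by apply/eqP; rewrite eq_le root_density_ge0 andbT -d0 root_density_le// ltW// exhaust_radius_lt1.
    by rewrite mulr0 expr0n.
  by rewrite -exprMn mulrCA divff// mulr1.
have cF x : (fun k => c k x) @ \oo --> (if root_density mu 1 x == 0 then 0 else 1 : R).
  apply: cvg_near_cst; rewrite /c; case: ifPn => [_|d0]; first exact: nearW.
  have [N NP] := polar_box_exhaustion (root_density_box d0).
  exists N => // k /= Nk; rewrite root_density_eq ?divff ?expr1n// ?(ltW (exhaust_radius_lt1 R _))//.
  exact: NP.
have F1E x : F1 x = F1 x * (if root_density mu 1 x == 0 then 0 else 1 : R)%:C.
  rewrite {1}/F1 weighted_pullbackM; case: eqP => [d0|_]; last by rewrite -weighted_pullbackM mulr1.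
  by rewrite d0 expr0n mulr0 mulr0.
have mF k : cmeasurable (F k).
  by apply: cmeasurableM; [exact: (hfk k).1|apply: cmeasurable_conj; exact: (hgk k).1].
have dom (G : C -> R) : (G = @complex.Re R \/ G = @complex.Im R) ->
    m.-integrable setT (EFin \o (fun x => G (F1 x))) ->
    (fun k => \int[m]_x G (F k x)) @ \oo --> \int[m]_x G (F1 x).
  move=> GE Gi.
  have GM z (y : R) : G (z * y%:C) = G z * y by case: GE => ->; rewrite ?ReMr ?ImMr.
  have mG k : measurable_fun setT (fun x => (G (F k x))%:E).
    by apply/measurable_EFinP; case: GE => ->; case: (mF k).
  have Ga : m.-integrable setT (fun x => `|(G (F1 x))%:E|)%E by exact: integrable_abse.
  have h := @dominated_cvg _ _ _ m setT measurableT (fun k x => (G (F k x))%:E)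
    (fun x => (G (F1 x))%:E) (fun x => `|(G (F1 x))%:E|)%E mG.
  have {}h : ((\int[m]_x (G (F k x))%:E) @[k --> \oo] --> \int[m]_x (G (F1 x))%:E)%E.
    apply: h => //.
    - move=> x _; apply: cvg_EFin; first exact: nearW.
      rewrite F1E GM; under eq_fun do rewrite /= FE GM.
      by apply: cvgM; [exact: cvg_cst|exact: cF].
    - move=> k x _; rewrite FE GM lee_fin normrM ler_piMr//.
      by have /andP[h0 h1] := c0 k x; rewrite ger0_norm.
  have fin : (\int[m]_x (G (F1 x))%:E)%E \is a fin_num by exact: integrable_fin_num.
  by apply: fine_cvg; rewrite /Rintegral fineK.
by apply: cvg_complexE; apply: dom; [left|exact: ur|right|exact: ui].
Qed.

End bergman_l2.

(** * Homogeneity under dilations *)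

Section homogeneity.
Variables (R : realType) (n : nat).
Local Notation C := R[i].
Implicit Types (z u : 'rV[C]_n) (p : npart n) (rho : C).

Definition part_size p : nat := (\sum_(i < part1 p) conj_part p i)%N.

Lemma ecoord_dilate rho u (k : int) : rho != 0 ->
  ecoord (dilate_sym rho u) k = rho ^ k * ecoord u k.
Proof.
case: k => [[|k]|k] rho0 /=; rewrite ?expr0z ?mulr1 ?mulr0//.
by case: insubP => [j _ jk|_]; rewrite ?mulr0// mxE jk.
Qed.

(** The entry at (i, j) is scaled by rho^(p'_i + j - i), that is rho^(p'_i - i) from its row and
    rho^j from its column; the exponents sum to |p|. Since p'_i - i may be negative, rho has to be
    invertible. *)
Lemma conj_det_dilate rho p u : rho != 0 ->
  conj_det p (dilate_sym rho u) = rho ^+ part_size p * conj_det p u.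
Proof.
move=> rho0; pose r := part1 p.
pose M (i j : 'I_r) := ecoord u ((conj_part p i)%:Z + j%:Z - i%:Z).
have -> : conj_det p (dilate_sym rho u) =
    \det (\matrix_(i < r, j < r) (rho ^ ((conj_part p i)%:Z - i%:Z) * M i j * rho ^ j%:Z)).
  congr (\det _); apply/matrixP => i j; rewrite !mxE ecoord_dilate// mulrAC.
  by rewrite -expfzDr//; congr (rho ^ _ * _); rewrite addrAC.
rewrite (det_scale_col (fun i j => rho ^ ((conj_part p i)%:Z - i%:Z) * M i j)).
rewrite -det_tr.
have -> : (\matrix_(i < r, j < r) (rho ^ ((conj_part p i)%:Z - i%:Z) * M i j))^T =
    \matrix_(i < r, j < r) (M j i * rho ^ ((conj_part p j)%:Z - j%:Z)).
  by apply/matrixP => i j; rewrite !mxE mulrC.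
rewrite (det_scale_col (fun i j => M j i)) -det_tr.
have -> : (\matrix_(i, j) M j i)^T = \matrix_(i < r, j < r) M i j.
  by apply/matrixP => i j; rewrite !mxE.
rewrite -mulrA mulrC -big_split /= -/(conj_det p u) /part_size expr_sum; congr (_ * _).
by apply: eq_bigr => i _; rewrite -expfzDr// subrK.
Qed.

Lemma alt_det_scale rho (a : 'I_n -> nat) z :
  alt_det a (rho *: z) = rho ^+ (\sum_j a j)%N * alt_det a z.
Proof.
rewrite /alt_det expr_sum mulrC -det_scale_col; congr (\det _).
by apply/matrixP => i j; rewrite !mxE exprMn mulrC.
Qed.

Lemma vdm_scale rho z : vdm (rho *: z) = rho ^+ (\sum_j @delta n j)%N * vdm z.
Proof. by have [b e] := @vdmE R n; rewrite !e alt_det_scale mulrCA. Qed.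

Lemma pullback_scale rho (f : 'rV[C]_n -> C) z :
  pullback f (rho *: z) =
  rho ^+ (\sum_j @delta n j)%N * pullback (fun u => f (dilate_sym rho u)) z.
Proof. by rewrite /pullback symmetrization_scale vdm_scale mulrCA. Qed.

Definition lincomb (s : seq (C * npart n)) u : C := \sum_(y <- s) y.1 * conj_det y.2 u.

Lemma pullback_lincomb s z :
  pullback (lincomb s) z = \sum_(y <- s) y.1 * pullback (fun u => conj_det y.2 u) z.
Proof. by rewrite /pullback /lincomb mulr_suml; apply: eq_bigr => y _; rewrite mulrA. Qed.

Definition dilate_comb rho (s : seq (C * npart n)) : seq (C * npart n) :=
  [seq (y.1 * rho ^+ part_size y.2, y.2) | y <- s].

Lemma lincomb_dilate rho s u : rho != 0 ->
  lincomb s (dilate_sym rho u) = lincomb (dilate_comb rho s) u.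
Proof.
move=> rho0; rewrite /lincomb big_map; apply: eq_bigr => y _ /=.
by rewrite conj_det_dilate// mulrA.
Qed.

(** Delta is homogeneous of degree the sum of the [delta j], so scaling the point produces that
    power of r on both functions; the factor in the hypothesis cancels it. *)
Lemma pullback_dilate_close (f : 'rV[C]_n -> C) (s : seq (C * npart n)) (r e : R) z :
  0 < r ->
  normc (pullback f (r%:C *: z) - pullback (lincomb s) (r%:C *: z)) <=
    r ^+ (\sum_j @delta n j)%N * e ->
  normc (pullback (fun u => f (dilate_sym r%:C u)) z -
    pullback (lincomb (dilate_comb r%:C s)) z) <= e.
Proof.
move=> r0; have rC0 : r%:C != 0 :> C by rewrite (fmorph_eq0 (real_complex R)) gt_eqF.
have rD : 0 < r ^+ (\sum_j @delta n j)%N by rewrite exprn_gt0.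
rewrite !pullback_scale -mulrBr normcM -(rmorphXn (real_complex R)) normc_real.
rewrite (ger0_norm (ltW rD)) ler_pM2l//.
have -> // : (fun u => lincomb s (dilate_sym r%:C u)) = lincomb (dilate_comb r%:C s).
by apply/funext => u; rewrite lincomb_dilate.
Qed.

End homogeneity.

(** * Orthogonal expansions in the Bergman space *)

Section bergman_inner_product.
Variables (R : realType) (n : nat) (mu : R).
Hypothesis mu1 : 1 < mu.
Local Notation C := R[i].
Local Notation X := (sf_sort (sf_pow (sf_polar R) n)).
Local Notation m := (sf_measure (sf_pow (sf_polar R) n)).
Local Notation wp := (weighted_pullback mu).
Local Notation A := (fs_mem (@bergman_space R n mu)).
Local Notation dot := (bergman_dot mu).
Implicit Types (f g h : 'rV[C]_n -> C) (p q : npart n) (s : seq (C * npart n)).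

Let wp_comb r (a : C) f g : wp r (fun u => a * f u + g u) =
  fun x => a * wp r f x + wp r g x.
Proof.
by apply/funext => x; rewrite /weighted_pullback /pullback !mulrDl !mulrA.
Qed.

Lemma bergman_mem_comb (a : C) f g : A f -> A g -> A (fun u => a * f u + g u).
Proof.
move=> /(bergman_memP mu1)[fhol hf] /(bergman_memP mu1)[ghol hg].
apply/(bergman_memP mu1); split; last by rewrite wp_comb; exact: sqint_comb.
move=> u Gu; apply: differentiable_add; last exact: ghol.
by apply: differentiable_mul; [exact: differentiable_const|exact: fhol].
Qed.

Lemma bergman_dot_comb (a : C) f g h : A f -> A g -> A h ->
  dot (fun u => a * f u + g u) h = a * dot f h + dot g h.
Proof.
move=> /(bergman_memP mu1)[_ hf] /(bergman_memP mu1)[_ hg] /(bergman_memP mu1)[_ hh].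
by rewrite !(bergman_dotE mu1) wp_comb l2dot_comb// mulrDr mulrCA.
Qed.

Lemma bergman_dotC f g : A f -> A g -> dot g f = Num.conj (dot f g).
Proof.
move=> /(bergman_memP mu1)[_ hf] /(bergman_memP mu1)[_ hg].
rewrite !(bergman_dotE mu1) (l2dotC hf hg) rmorphM; congr (_ * _).
by rewrite fmorphV rmorph_nat.
Qed.

Lemma bergman_dot_ge0 f : 0 <= dot f f.
Proof. by rewrite (bergman_dotE mu1) mulr_ge0 ?l2dot_ge0// invr_ge0 ler0n. Qed.

Lemma bergman_mem_continuous f : holomorphic_on (@sym_polydisc R n) f ->
  (forall z, cpolydisc 1 z -> {for z, continuous (pullback f)}) -> A f.
Proof.
move=> fhol fc; have [M M0 fM] := cpolydisc_bounded fc.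
apply/(bergman_memP mu1); split=> //.
apply: (sqint_bounded mu1 _ M0) => // x /root_density_cpolydisc; exact: fM.
Qed.

Lemma bergman_mem_conj_det p : A (fun u => conj_det p u).
Proof.
apply: bergman_mem_continuous => [u _|z _]; first exact: differentiable_conj_det.
apply: differentiable_continuous; apply: differentiable_mul; last exact: differentiable_peval.
apply: (@differentiable_comp _ _ _ _ (@symmetrization R n) (fun u => conj_det p u)).
  exact: differentiable_symmetrization.
exact: differentiable_conj_det.
Qed.

(** The n! of the surviving permutations cancels the normalization 1 / n!, leaving (p + delta)! /
    (mu)_(p + delta). *)
Lemma bergman_dot_conj_det p q :
  dot (fun u => conj_det p u) (fun u => conj_det q u) = (p == q)%:R * ((gamma mu p ^+ 2)^-1)%:C.
Proof.
rewrite (bergman_dotE mu1) l2dot_conj_det// mulrCA; congr (_ * _).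
have f0 : (n`!%:R : R) != 0 by rewrite pnatr_eq0 -lt0n fact_gt0.
rewrite -(rmorph_nat (real_complex R)) -fmorphV -rmorphM mulKf//; congr _%:C.
rewrite sqr_gamma ?(lt_trans _ mu1)// invf_div /mfact natr_prod /mpochhammer -prodf_div.
by apply: eq_bigr => j _; rewrite radial_norm1.
Qed.

Lemma bergman_mem0 : A (fun=> 0).
Proof.
have := bergman_mem_comb (-1) (bergman_mem_conj_det (npart0 n)) (bergman_mem_conj_det (npart0 n)).
by congr (A _); apply/funext => u; rewrite mulN1r addNr.
Qed.

Lemma bergman_mem_lincomb s : A (lincomb s).
Proof.
elim: s => [|y s ih].
  by have := bergman_mem0; congr (A _); apply/funext => u; rewrite /lincomb big_nil.
have := bergman_mem_comb y.1 (bergman_mem_conj_det y.2) ih.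
by congr (A _); apply/funext => u; rewrite /lincomb big_cons.
Qed.

Lemma bergman_dot_lincomb s h : A h ->
  dot (lincomb s) h = \sum_(y <- s) y.1 * dot (fun u => conj_det y.2 u) h.
Proof.
move=> hh; elim: s => [|y s ih].
  rewrite big_nil; have <- : -1 * dot (fun=> 0) h + dot (fun=> 0) h = 0 by rewrite mulN1r addNr.
  rewrite -bergman_dot_comb //; try exact: bergman_mem0.
  congr (dot _ h); apply/funext => u.
  by rewrite /lincomb big_nil mulr0 addr0.
rewrite big_cons -ih -bergman_dot_comb//; last 2 first.
- exact: bergman_mem_conj_det.
- exact: bergman_mem_lincomb.
by congr (dot _ h); apply/funext => u; rewrite /lincomb big_cons.
Qed.

(** The factor gamma_p^2 divides by the squared norm of e_p. *)
Definition fourier_sum f (S : seq (npart n)) : seq (C * npart n) :=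
  [seq ((gamma mu p ^+ 2)%:C * dot f (fun u => conj_det p u), p) | p <- S].

Lemma fourier_residual_orthogonal f (S : seq (npart n)) q : A f -> uniq S -> q \in S ->
  dot (fun u => -1 * lincomb (fourier_sum f S) u + f u) (fun u => conj_det q u) = 0.
Proof.
move=> hf uS qS; have hq := bergman_mem_conj_det q.
rewrite bergman_dot_comb//; last exact: bergman_mem_lincomb.
rewrite bergman_dot_lincomb// big_map (bigD1_seq q)//= big1 ?addr0 => [|p pq]; last first.
  by rewrite bergman_dot_conj_det (negbTE pq) mul0r mulr0.
have g0 : gamma mu q ^+ 2 != 0.
  rewrite sqr_gamma ?(lt_trans _ mu1)// mulf_neq0 ?invr_eq0 ?gt_eqF ?ltr0n ?mfact_gt0//.
  by rewrite mpochhammer_gt0// (lt_trans _ mu1).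
rewrite bergman_dot_conj_det eqxx mul1r mulrAC fmorphV /= mulfV ?mul1r ?mulN1r ?addNr//.
by rewrite (fmorph_eq0 (real_complex R)).
Qed.

(* The residual of the Fourier sum over S is orthogonal to the span of S, so Pythagoras applies. *)
Lemma fourier_sum_best f (S : seq (npart n)) s : A f -> uniq S ->
  (forall y, y \in s -> y.2 \in S) ->
  dot (fun u => f u - lincomb (fourier_sum f S) u) (fun u => f u - lincomb (fourier_sum f S) u)
  <= dot (fun u => f u - lincomb s u) (fun u => f u - lincomb s u).
Proof.
move=> hf uS sS; set F := lincomb (fourier_sum f S).
pose h u := -1 * F u + f u.
have hh : A h by apply: bergman_mem_comb => //; exact: bergman_mem_lincomb.
have -> : (fun u => f u - F u) = h by apply/funext => u; rewrite /h mulN1r addrC.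
(* k is the Fourier sum minus the competitor; it is a combination of functions indexed by S, hence
   orthogonal to the residual h. *)
pose k := lincomb (fourier_sum f S ++ [seq (- y.1, y.2) | y <- s]).
have hk : A k by exact: bergman_mem_lincomb.
have -> : (fun u => f u - lincomb s u) = fun u => 1 * k u + h u.
  apply/funext => u; rewrite /h /k /F /lincomb big_cat /= [in RHS]big_map mul1r.
  under [X in _ + X + _]eq_bigr do rewrite mulNr.
  by rewrite sumrN mulN1r addrACA subrr add0r addrC.
have kh : dot k h = 0.
  rewrite bergman_dot_lincomb// big_seq big1// => y yin.
  have yS : y.2 \in S.
    move: yin; rewrite mem_cat => /orP[/mapP[p pS ->]//|/mapP[y' /sS y'S ->]//].
  rewrite (bergman_dotC hh (bergman_mem_conj_det _)) fourier_residual_orthogonal//.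
  by rewrite conjC0 mulr0.
have hkh : A (fun u => 1 * k u + h u) by exact: bergman_mem_comb.
have hk0 : dot h k = 0 by rewrite (bergman_dotC hk hh) kh conjC0.
have e g : A g -> dot (fun u => 1 * k u + h u) g = dot k g + dot h g.
  by move=> hg; rewrite (bergman_dot_comb _ hk hh hg) mul1r.
have khk : dot k (fun u => 1 * k u + h u) = dot k k.
  by rewrite (bergman_dotC hkh hk) (e k hk) hk0 addr0 -(bergman_dotC hk hk).
have khh : dot h (fun u => 1 * k u + h u) = dot h h.
  by rewrite (bergman_dotC hkh hh) (e h hh) kh add0r -(bergman_dotC hh hh).
by rewrite (e _ hkh) khk khh lerDr bergman_dot_ge0.
Qed.

End bergman_inner_product.

(** * Inner products of dilates *)

Section dilated_expansion.
Variables (R : realType) (n : nat) (mu : R).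
Hypothesis mu1 : 1 < mu.
Local Notation C := R[i].
Local Notation X := (sf_sort (sf_pow (sf_polar R) n)).
Local Notation m := (sf_measure (sf_pow (sf_polar R) n)).
Local Notation wp := (weighted_pullback mu).
Local Notation A := (fs_mem (@bergman_space R n mu)).
Local Notation dot := (bergman_dot mu).
Local Notation e_ p := (fun u : 'rV[C]_n => conj_det p u).
Implicit Types (r : R) (z u : 'rV[C]_n) (f g h : 'rV[C]_n -> C) (p q : npart n) (s : seq (C * npart n)).

Let hol f := holomorphic_on (@sym_polydisc R n) f.

Lemma pullbackB f g z : pullback (fun u => f u - g u) z = pullback f z - pullback g z.
Proof. exact: mulrBl. Qed.

(** The product of the root density with |h| is bounded by the sum of their squares, so a constant
    depending only on r and h is obtained without the Cauchy-Schwarz inequality. *)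
Lemma l2dot_uniform r f g h (e : R) : r <= 1 -> 0 <= e ->
  sqint m (wp r f) -> sqint m (wp r g) -> sqint m (wp r h) ->
  (forall z, cpolydisc r z -> normc (pullback f z - pullback g z) <= e) ->
  normc (l2dot m (wp r f) (wp r h) - l2dot m (wp r g) (wp r h)) <=
  e * (2 * \int[m]_x (root_density mu r x ^+ 2 + normc (wp r h x) ^+ 2)).
Proof.
move=> r1 e0 hf hg hh fg.
have fh := sqint_cintegrable hf hh; have gh := sqint_cintegrable hg hh.
have hV : sqint m (fun x : X => (root_density mu r x)%:C).
  by have := sqint_root_density n mu1 r1 ler01; apply: eq_sqint => x; rewrite mul1r.
have iK : m.-integrable setT (EFin \o (fun x : X => root_density mu r x ^+ 2 + normc (wp r h x) ^+ 2)).
  have := integrableD measurableT hV.2 hh.2; apply: eq_integrable => // x _.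
  change ((normc (root_density mu r x)%:C ^+ 2 + normc (wp r h x) ^+ 2)%:E =
    (root_density mu r x ^+ 2 + normc (wp r h x) ^+ 2)%:E).
  by rewrite normc_real real_normK ?num_real//.
rewrite /l2dot -cintegralB// mulrCA -RintegralZl//.
apply: normc_cintegral => //.
- exact: cintegrableB.
- by have := integrableZl measurableT e iK; apply: eq_integrable.
move=> x _; rewrite -mulrBl normcM normc_conj.
have -> : wp r f x - wp r g x =
    (pullback f (polar_point x) - pullback g (polar_point x)) * (root_density mu r x)%:C.
  by rewrite mulrBl.
rewrite normcM normc_real (ger0_norm (root_density_ge0 mu r x)) -mulrA.
have [->|d0] := eqVneq (root_density mu r x) 0.
  by rewrite mul0r mulr0 mulr_ge0 ?addr_ge0 ?exprn_ge0 ?normc_ge0.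
apply: ler_pM; rewrite ?mulr_ge0 ?normc_ge0 ?root_density_ge0//.
  exact/fg/(root_density_cpolydisc d0).
have := sqr_ge0 (root_density mu r x - normc (wp r h x)).
have := mulr_ge0 (root_density_ge0 mu r x) (normc_ge0 (wp r h x)); nra.
Qed.

Lemma bergman_dot_uniform h (e : R) : 0 <= e -> A h ->
  (forall z, cpolydisc 1 z -> normc (pullback h z) <= e) ->
  complex.Re (dot h h) <= e ^+ 2 * (n`!%:R^-1 * \int[m]_x (root_density mu 1 x ^+ 2)).
Proof.
move=> e0 /(bergman_memP mu1)[hhol hh] he.
have iV : m.-integrable setT (EFin \o (fun x : X => root_density mu 1 x ^+ 2)).
  have [_] := sqint_root_density n mu1 (lexx 1) ler01; apply: eq_integrable => // x _.
  change ((normc (1 * root_density mu 1 x)%:C ^+ 2)%:E = (root_density mu 1 x ^+ 2)%:E).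
  by rewrite normc_real real_normK ?num_real ?mul1r//.
rewrite (bergman_dotE mu1) l2dot_diag -(rmorph_nat (real_complex R)) -fmorphV.
rewrite -rmorphM [complex.Re _]/= mulrCA ler_wpM2l ?invr_ge0 ?ler0n//.
rewrite -RintegralZl//; apply: le_Rintegral => //.
- exact: hh.2.
- by have := integrableZl measurableT (e ^+ 2) iV; apply: eq_integrable.
move=> x _; rewrite normc_weighted_pullback exprMn.
have [->|d0] := eqVneq (root_density mu 1 x) 0; first by rewrite expr0n !mulr0.
rewrite ler_wpM2r ?exprn_ge0 ?root_density_ge0// ler_pXn2r ?nnegrE ?normc_ge0//.
exact/he/(root_density_cpolydisc d0).
Qed.

Variables (f : 'rV[C]_n -> C) (rho : R).
Hypotheses (hf : A f) (rho0 : 0 < rho) (rho1 : rho < 1).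

Let rhoC0 : rho%:C != 0 :> C.
Proof. by rewrite (fmorph_eq0 (real_complex R)) gt_eqF. Qed.

Let D := (\sum_j @delta n j)%N.
Let frho u := f (dilate_sym rho%:C u).

Let fhol : hol f.
Proof. by have [] := (bergman_memP mu1 f).1 hf. Qed.

Let scale_cpolydisc r z : 0 <= r -> cpolydisc r z -> cpolydisc (rho * r) (rho%:C *: z).
Proof.
move=> r0 zr i; rewrite mxE normcM normc_real (ger0_norm (ltW rho0)).
by rewrite ler_wpM2l ?(ltW rho0)//; exact: zr.
Qed.

Let scale_polydisc z : cpolydisc 1 z -> polydisc (rho%:C *: z).
Proof.
by move=> /(scale_cpolydisc ler01); rewrite mulr1; exact: cpolydisc_polydisc.
Qed.

Let frhoE z : frho (symmetrization z) = f (symmetrization (rho%:C *: z)).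
Proof. by rewrite /frho symmetrization_scale. Qed.

Let dilate_mem u : sym_polydisc u -> sym_polydisc (dilate_sym rho%:C u).
Proof.
move=> [z Dz <-]; exists (rho%:C *: z); last by rewrite symmetrization_scale.
apply: scale_polydisc => i; apply: ltW; exact: (polydiscP _).1.
Qed.

(** Scaling by rho < 1 sends the closed polydisc into the open one, so the pulled-back dilate is
    continuous up to the boundary and therefore bounded. *)
Lemma bergman_mem_dilate : A frho.
Proof.
apply: bergman_mem_continuous => // [u Gu|z z1].
  apply: (@differentiable_comp _ _ _ _ (dilate_sym rho%:C) f).
    exact: differentiable_dilate_sym.
  exact/fhol/dilate_mem.
apply: differentiable_continuous.
have -> : pullback frho = fun z => f (symmetrization (rho%:C *: z)) * vdm z.
  by apply/funext => y; rewrite /pullback frhoE.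
apply: differentiable_mul; last exact: differentiable_peval.
apply: (@differentiable_comp _ _ _ _ (fun z => rho%:C *: z) (fun z => f (symmetrization z))).
  exact: differentiableZ.
apply: (@differentiable_comp _ _ _ _ (@symmetrization R n) f).
  exact: differentiable_symmetrization.
by apply: fhol; exists (rho%:C *: z) => //; exact: scale_polydisc.
Qed.

(** For combinations of the e_q this is homogeneity plus orthogonality. A general f is approximated
    uniformly by such combinations on a polydisc of radius r < 1, and r then tends to 1. *)
Lemma bergman_dot_dilate p : dot frho (e_ p) = rho%:C ^+ part_size p * dot f (e_ p).
Proof.
have hp := bergman_mem_conj_det mu1 p; have hr := bergman_mem_dilate.
rewrite !(bergman_dotE mu1) mulrCA; congr (_ * _).
have h1 := l2dot_exhaustion mu1 hr hp.
have h2 : (fun k => rho%:C ^+ part_size p *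
    l2dot m (wp (exhaust_radius R k) f) (wp (exhaust_radius R k) (e_ p))) @ \oo -->
    rho%:C ^+ part_size p * l2dot m (wp 1 f) (wp 1 (e_ p)).
  by apply: cvgM; [exact: cvg_cst|exact: l2dot_exhaustion].
suff E k : l2dot m (wp (exhaust_radius R k) frho) (wp (exhaust_radius R k) (e_ p)) =
    rho%:C ^+ part_size p *
    l2dot m (wp (exhaust_radius R k) f) (wp (exhaust_radius R k) (e_ p)).
  move: h1; rewrite (funext E) => h1.
  exact: (@cvg_unique _ (@norm_hausdorff _ _) _ _ _ _ h1 h2).
set r := exhaust_radius R k.
have r0 : 0 <= r := exhaust_radius_ge0 R k; have r1 : r < 1 := exhaust_radius_lt1 R k.
have sq g : A g -> sqint m (wp r g).
  by move=> /(bergman_memP mu1)[ghol hg]; exact: sqint_weighted_pullback (ltW r1) ghol hg.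
pose K := 2 * \int[m]_x (root_density mu r x ^+ 2 + normc (wp r (e_ p) x) ^+ 2).
have K0 : 0 <= K.
  by rewrite mulr_ge0// Rintegral_ge0// => x _; rewrite addr_ge0 ?exprn_ge0 ?normc_ge0 ?root_density_ge0.
set L1 := l2dot _ _ _; set L2 := l2dot _ _ _.
suff close e : 0 < e -> normc (L1 - rho%:C ^+ part_size p * L2) <= e.
  apply/eqP; rewrite -subr_eq0; apply/eqP/eq0_normc/eqP.
  rewrite eq_le normc_ge0 andbT; apply/ler_addgt0Pr => e e0; rewrite add0r; exact: close.
move=> e0.
(* Two errors of at most e' K each are added at the end. *)
pose e' := e / (2 * K + 1).
have e'0 : 0 < e' by rewrite divr_gt0// ltr_wpDl// mulr_ge0.
have rD0 : 0 < rho ^+ D by rewrite exprn_gt0.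
have [s sP] := holomorphic_approx fhol r0 r1 (mulr_gt0 rD0 e'0).
have {}sP z : cpolydisc r z -> normc (pullback f z - pullback (lincomb s) z) <= rho ^+ D * e'.
  by move=> zr; rewrite pullback_lincomb; exact: sP.
have sP' z : cpolydisc r z ->
    normc (pullback frho z - pullback (lincomb (dilate_comb rho%:C s)) z) <= e'.
  move=> zr; apply: pullback_dilate_close => //; apply: sP => i.
  by apply: le_trans (scale_cpolydisc r0 zr i) _; rewrite ler_piMl// ltW.
have hs := bergman_mem_lincomb mu1 s; have hs' := bergman_mem_lincomb mu1 (dilate_comb rho%:C s).
have b1 := l2dot_uniform (ltW r1) (ltW e'0) (sq _ hr) (sq _ hs') (sq _ hp) sP'.
have b2 := l2dot_uniform (ltW r1) (ltW (mulr_gt0 rD0 e'0)) (sq _ hf) (sq _ hs) (sq _ hp) sP.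
have comb t : l2dot m (wp r (lincomb t)) (wp r (e_ p)) =
    \sum_(y <- t) y.1 * l2dot m (wp r (e_ y.2)) (wp r (e_ p)).
  elim: t => [|y t ih].
    rewrite big_nil /l2dot -[RHS](cintegral0 m setT); apply: eq_cintegral => x _.
    by rewrite /weighted_pullback /pullback /lincomb big_nil !mul0r.
  rewrite big_cons -ih -(l2dot_comb y.1 (sq _ (bergman_mem_conj_det mu1 y.2))
    (sq _ (bergman_mem_lincomb mu1 t)) (sq _ hp)).
  apply: eq_cintegral => x _; congr (_ * _).
  by rewrite /weighted_pullback /pullback /lincomb big_cons !mulrDl !mulrA.
(* Only the terms indexed by p itself survive the pairing, and for these the dilation factor is
   rho^|p|. *)
have combE : l2dot m (wp r (lincomb (dilate_comb rho%:C s))) (wp r (e_ p)) =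
    rho%:C ^+ part_size p * l2dot m (wp r (lincomb s)) (wp r (e_ p)).
  rewrite !comb big_map mulr_sumr; apply: eq_bigr => y _ /=.
  rewrite (l2dot_conj_det mu1 _ _ (ltW r1)).
  by case: eqP => [->|_]; [rewrite [RHS]mulrCA -[LHS]mulrA|rewrite !mul0r !mulr0].
have -> : L1 - rho%:C ^+ part_size p * L2 =
    (L1 - l2dot m (wp r (lincomb (dilate_comb rho%:C s))) (wp r (e_ p))) -
    rho%:C ^+ part_size p * (L2 - l2dot m (wp r (lincomb s)) (wp r (e_ p))).
  by rewrite combE mulrBr opprB addrA subrK.
apply: le_trans (le_normcD _ _) _; rewrite normcN normcM -(rmorphXn (real_complex R)).
rewrite normc_real (ger0_norm (exprn_ge0 _ (ltW rho0))).
apply: (@le_trans _ _ (e' * K + e' * K)).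
  apply: lerD => //; apply: (@le_trans _ _ (1 * (1 * e' * K))); last by rewrite !mul1r.
  have pow1 k' : rho ^+ k' <= 1 by rewrite exprn_ile1 ?(ltW rho0) ?(ltW rho1).
  apply: ler_pM (exprn_ge0 _ (ltW rho0)) (normc_ge0 _) (pow1 _) _.
  apply: le_trans b2 _; rewrite -/K ler_wpM2r// ler_wpM2r ?(ltW e'0)//.
have K1 : 0 < 2 * K + 1 by rewrite ltr_wpDl// mulr_ge0.
have -> : e' * K + e' * K = e * (2 * K) / (2 * K + 1) by rewrite /e'; ring.
by rewrite ler_pdivrMr// ler_wpM2l ?(ltW e0)// lerDl ler01.
Qed.

End dilated_expansion.

(** * Pointwise expansion of the reproducing kernel *)

Section reproducing_expansion.
Variables (R : realType) (n : nat) (mu : R).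
Hypothesis mu1 : 1 < mu.
Local Notation C := R[i].
Local Notation X := (sf_sort (sf_pow (sf_polar R) n)).
Local Notation m := (sf_measure (sf_pow (sf_polar R) n)).
Local Notation A := (fs_mem (@bergman_space R n mu)).
Local Notation dot := (bergman_dot mu).
Local Notation e_ p := (fun u : 'rV[C]_n => conj_det p u).
Implicit Types (z u w : 'rV[C]_n) (f h : 'rV[C]_n -> C) (p : npart n).
Variable B : 'rV[C]_n -> 'rV[C]_n -> C.
Hypothesis rk : reproducing_kernel (@sym_polydisc R n) (@bergman_space R n mu) B.

(* Weak Cauchy-Schwarz: K = ||k||^2 + 1 avoids a separate case for ||k|| = 0. *)
Lemma reproducing_bound w : sym_polydisc w -> exists2 K : R, 0 < K &
  forall h, A h -> normc (h w) ^+ 2 <= K * complex.Re (dot h h).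
Proof.
move=> Gw; have hk := rk.1 w Gw; pose k u := B u w.
have [kap kap0 kapE] : exists2 kap : R, 0 <= kap & dot k k = kap%:C.
  have h0 := bergman_dot_ge0 mu1 k.
  have /complex_realP[kap kapE] := ger0_real h0.
  by exists kap => //; move: h0; rewrite kapE ler0c.
have K0 : 0 < kap + 1 by rewrite ltr_wpDl.
exists (kap + 1) => // h hh.
have xE : h w = dot h k := rk.2 h w hh Gw.
set x := h w in xE *; set t : R := (kap + 1)^-1.
have t0 : 0 < t by rewrite invr_gt0.
(* Positivity of ||h - t x k||^2 reads t |x|^2 (2 - t ||k||^2) <= ||h||^2, where the parenthesis is
   at least 1 for t = 1 / (||k||^2 + 1). *)
pose g u := (- t%:C * x) * k u + h u.
have hg : A g by exact: bergman_mem_comb.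
have gk : dot g k = (- t%:C * x) * kap%:C + x by rewrite bergman_dot_comb// kapE -xE.
have gh : dot g h = (- t%:C * x) * Num.conj x + dot h h.
  by rewrite bergman_dot_comb// (bergman_dotC mu1 hh hk) -xE.
have hhC := bergman_dotC mu1 hh hh.
have gg : dot g g = (- t%:C * x) * dot k g + dot h g by rewrite bergman_dot_comb.
have := bergman_dot_ge0 mu1 g.
rewrite gg (bergman_dotC mu1 hg hk) (bergman_dotC mu1 hg hh) gk gh.
have hh0 := bergman_dot_ge0 mu1 h.
have /complex_realP[eta etaE] := ger0_real hh0.
rewrite etaE /=.
have -> : - t%:C * x * Num.conj (- t%:C * x * kap%:C + x) +
    Num.conj (- t%:C * x * Num.conj x + eta%:C) =
    (eta - t * normc x ^+ 2 * (2 - t * kap))%:C.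
  rewrite sqr_normc; case: (x) => a b; apply: complex_eq => /=; ring.
rewrite ler0c subr_ge0 => le.
have tk : t * kap <= 1 by rewrite /t mulrC ler_pdivrMr// mul1r lerDl.
have : t * normc x ^+ 2 <= eta.
  apply: le_trans le; rewrite ler_peMr ?mulr_ge0 ?exprn_ge0 ?normc_ge0 ?(ltW t0)//; lra.
by rewrite /t mulrC ler_pdivrMr// mulrC.
Qed.

(** A combination uniformly close to the dilate on the closed polydisc is close in norm; a Fourier
    sum over a larger index set is no worse, and the evaluation bound at w turns this into a
    pointwise estimate. *)
Lemma dilated_expansion f (rho : R) w : A f -> 0 < rho -> rho < 1 -> sym_polydisc w ->
  partial_sum (fun p => (gamma mu p ^+ 2)%:C * dot f (e_ p) *
     conj_det p (dilate_sym rho%:C w)) @ totally --> f (dilate_sym rho%:C w).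
Proof.
move=> hf rho0 rho1 Gw.
have rhoC0 : rho%:C != 0 :> C by rewrite (fmorph_eq0 (real_complex R)) gt_eqF.
have fhol := ((bergman_memP mu1 f).1 hf).1.
pose frho u := f (dilate_sym rho%:C u).
have hr : A frho := bergman_mem_dilate mu1 hf rho0 rho1.
have [K K0 KP] := reproducing_bound Gw.
pose I := n`!%:R^-1 * \int[m]_x (root_density mu 1 x ^+ 2).
have I0 : 0 <= I.
  by rewrite mulr_ge0 ?invr_ge0 ?ler0n// Rintegral_ge0// => x _; rewrite exprn_ge0// root_density_ge0.
apply/cvg_complexP => e e0.
(* The final bound on the squared error is K e'^2 I, which is below e^2 because K I < (K I +
   1)^2. *)
pose e' := e / (K * I + 1).
have KI1 : 0 < K * I + 1 by rewrite ltr_wpDl// mulr_ge0// ltW.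
have e'0 : 0 < e' by rewrite divr_gt0.
pose D := (\sum_j @delta n j)%N.
have rD0 : 0 < rho ^+ D by rewrite exprn_gt0.
have [s sP] := holomorphic_approx fhol (ltW rho0) rho1 (mulr_gt0 rD0 e'0).
have {}sP z : cpolydisc 1 z ->
    normc (pullback frho z - pullback (lincomb (dilate_comb rho%:C s)) z) <= e'.
  move=> z1; apply: pullback_dilate_close => //; rewrite pullback_lincomb.
  apply: sP => i; rewrite mxE normcM normc_real (ger0_norm (ltW rho0)).
  by rewrite ler_piMr ?(ltW rho0)//; exact: z1.
(* The indices of one good approximant: every finite set containing them has a partial sum at least
   as accurate. *)
exists [fset y.2 | y in s]%fset => // T /= /fsubsetP sT.
pose S := fourier_sum mu frho (enum_fset T).
have alg (a b c d : C) : a * b * (c * d) = a * (c * b) * d by ring.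
have SE : partial_sum (fun p => (gamma mu p ^+ 2)%:C * dot f (e_ p) *
     conj_det p (dilate_sym rho%:C w)) T = lincomb S w.
  rewrite /partial_sum /lincomb big_map /=.
  rewrite -(big_seq_fsetE _ T xpredT (fun p => (gamma mu p ^+ 2)%:C * dot f (e_ p) *
     conj_det p (dilate_sym rho%:C w))) /=.
  apply: eq_bigr => p _.
  rewrite conj_det_dilate// -/frho (bergman_dot_dilate mu1 hf rho0 rho1).
  exact: alg.
(* The coefficients are now those of the dilate, the factor rho^|p| having passed from e_p at the
   dilated point to the inner product. *)
rewrite SE normcB -[f _]/(frho w).
have hd : A (fun u => frho u - lincomb S u).
  have := bergman_mem_comb mu1 (-1) (bergman_mem_lincomb mu1 S) hr.
  by congr (A _); apply/funext => u; rewrite mulN1r addrC.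
have hq : A (fun u => frho u - lincomb (dilate_comb rho%:C s) u).
  have := bergman_mem_comb mu1 (-1) (bergman_mem_lincomb mu1 (dilate_comb rho%:C s)) hr.
  by congr (A _); apply/funext => u; rewrite mulN1r addrC.
have best : complex.Re (dot (fun u => frho u - lincomb S u) (fun u => frho u - lincomb S u)) <=
    e' ^+ 2 * I.
  apply: le_trans (bergman_dot_uniform mu1 (ltW e'0) hq _); last first.
    by move=> z z1; rewrite pullbackB; exact: sP.
  have := fourier_sum_best mu1 hr (fset_uniq T) (s := dilate_comb rho%:C s) _.
  move=> H; have {H} : forall y, y \in dilate_comb rho%:C s -> y.2 \in T.
    by move=> y /mapP[y' ys ->] /=; apply: sT; apply/imfsetP; exists y'.
  move=> /(fourier_sum_best mu1 hr (fset_uniq T)).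
  by rewrite lecE => /andP[].
have := KP _ hd; move=> /le_trans/(_ (ler_wpM2l (ltW K0) best)) le2.
rewrite -(ltr_pXn2r (n := 2)) ?nnegrE ?normc_ge0 ?(ltW e0)//.
apply: le_lt_trans le2 _.
have -> : K * (e' ^+ 2 * I) = e ^+ 2 * ((K * I) / (K * I + 1) ^+ 2).
  by rewrite /e' exprMn exprVn; ring.
rewrite gtr_pMr ?exprn_gt0// ltr_pdivrMr ?exprn_gt0// mul1r.
have : 0 <= K * I by rewrite mulr_ge0// ltW.
nra.
Qed.

Lemma bergman_kernel_expansion : kernel_expansion mu B.
Proof.
move=> s t Gs Gt.
have [z /polydiscP Dz zs] := Gs.
have [rho [rho0 rho1 zrho]] : exists rho : R, [/\ 0 < rho, rho < 1 & forall i, normc (z 0 i) < rho].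
  (* Any rho strictly between the largest modulus of the coordinates and 1 leaves room to divide z
     by rho inside the polydisc. *)
  pose M := \big[Num.max/0]_i normc (z 0 i).
  have M1 : M < 1 by apply/bigmax_ltP; split=> // i _; exact: Dz.
  have M0 : 0 <= M by apply/bigmax_geP; left.
  exists ((M + 1) / 2); split; [lra|lra|] => i.
  have : normc (z 0 i) <= M by exact: (le_bigmax _ (fun i => normc (z 0 i))).
  lra.
have rhoC0 : rho%:C != 0 :> C by rewrite (fmorph_eq0 (real_complex R)) gt_eqF.
pose w := symmetrization ((rho%:C)^-1 *: z).
have Gw : sym_polydisc w.
  exists ((rho%:C)^-1 *: z) => //; apply/polydiscP => i.
  rewrite mxE normcM normcV normc_real (ger0_norm (ltW rho0)).
  by rewrite mulrC ltr_pdivrMr// mul1r.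
have sE : s = dilate_sym rho%:C w.
  by rewrite -symmetrization_scale scalerA mulfV// scale1r.
have := dilated_expansion (rk.1 t Gt) rho0 rho1 Gw; rewrite -sE.
have -> // : (fun p => (gamma mu p ^+ 2)%:C * dot (fun u => B u t) (e_ p) * conj_det p s) =
    kernel_term mu s t.
apply/funext => p; rewrite /kernel_term -mulrA; congr (_ * _).
have hp := bergman_mem_conj_det mu1 p.
(* Reproduction applies to e_p on the left of the product, so Hermitian symmetry turns <B(., t),
   e_p> into the conjugate of e_p(t). *)
rewrite (bergman_dotC mu1 hp (rk.1 t Gt)) mulrC; congr (_ * Num.conj _).
exact/esym/(rk.2 _ t hp Gt).
Qed.

End reproducing_expansion.

Theorem theorem4p11 (R : realType) (n : nat) (mu : R) (H : fun_space R n)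
    (B : 'rV[R[i]]_n -> 'rV[R[i]]_n -> R[i]) :
  (1 <= n)%N -> 0 < mu ->
  is_weighted_space mu H ->
  reproducing_kernel (@sym_polydisc R n) H B ->
  forall s t : 'rV[R[i]]_n, sym_polydisc s -> sym_polydisc t ->
    let term (p : npart n) : R[i] :=
      (gamma mu p ^+ 2)%:C * (conj_det p s * Num.conj (conj_det p t)) in
    cvg (partial_sum term @ totally) /\
    normalized_kernel B s t =
      ((mfact (@delta n))%:R / mpochhammer mu (@delta n))%:C * sum term.
Proof.
move=> _ mu0 [mu_gt1 mu_le1] rB s t Gs Gt.
apply: (@kernel_expansion_normalized R n mu B s t mu0) => //.
(* For mu > 1 the space is rewritten as the Bergman space; for mu <= 1 a kernel with the expansion
   is given, and uniqueness transfers it to [B]. *)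
have [mu1|mu1] := leP mu 1; last first.
  by apply: bergman_kernel_expansion => //; rewrite -mu_gt1.
have [hH _ [B' kB' rB']] := mu_le1 mu1.
move=> s' t' Gs' Gt'; rewrite (reproducing_kernel_unique hH rB rB' Gs' Gt').
exact: schur_kernel_expansion.
Qed.
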